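(* Let $\alpha\in(0,2)$, $d\ge1$. Then for all $m>0$ and $\lambda>m$ there exists a constant $C_{d,\alpha,\lambda,m}$ such that for all $x\in\mathbb{R}^d\setminus\{0\}$ $$R^m_\lambda(x)\le C_{d,\alpha,\lambda,m}H^m_{d,\alpha}(|x|).$$
   Context: For $\alpha\in(0,2)$, $m>0$, $L_{m,\alpha}=(-\Delta+m^{2/\alpha})^{\alpha/2}-m$ on $L^2(\mathbb{R}^d)$ is the operator with Fourier multiplier $(|y|^2+m^{2/\alpha})^{\alpha/2}-m$. $p^m_t(x-y)$ is the integral kernel of $e^{-tL_{m,\alpha}}$, and $R^m_\lambda(x)=\int_0^\infty e^{-\lambda t}p^m_t(x)\,dt$ is the resolvent kernel. For $r>0$, $H^m_{d,\alpha}(r)=h(r)\mathbf{1}_{\{r\le1\}}+r^{-\frac{d+\alpha}{2}}\kappa_m(r)\mathbf{1}_{\{r>1\}}$, with $h(r)=r^{-(d-\alpha)}$ if $\alpha<d$, $h(r)=\log(1+\frac1r)$ if $\alpha=d=1$, $h(r)=1$ if $\alpha>d=1$, $\kappa_m(r)=m^{(d+\alpha)/(2\alpha)}K_{(d+\alpha)/2}(m^{1/\alpha}r)$, and $K_\rho(z)=\frac12(\frac z2)^\rho\int_0^\infty t^{-\rho-1}e^{-t-\frac{z^2}{4t}}dt$ the modified Bessel function of the second kind. *)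

(* Defs.v *)
From HB Require Import structures.
From mathcomp Require Import all_boot all_order all_algebra.
From mathcomp Require Import all_classical all_reals all_analysis.
From mathcomp Require Import complex.

Set Implicit Arguments.
Unset Strict Implicit.
Unset Printing Implicit Defensive.
Import Order.TTheory GRing.Theory Num.Theory.
Import numFieldNormedType.Exports.

Local Open Scope classical_set_scope.
Local Open Scope ring_scope.

Definition rV_display : measure_display.
Proof. exact. Qed.

Section measurable_rV.
Context {R : realType} {n : nat}.

Let coord (i : 'I_n) (x : 'rV[R]_n) : measurableTypeR R := x ord0 i.

Let rV_set0 : g_sigma_preimage coord set0.
Proof. exact: sigma_algebra0. Qed.

Let rV_setC A : g_sigma_preimage coord A -> g_sigma_preimage coord (~` A).
Proof. exact: sigma_algebraC. Qed.

Let rV_bigcup (F : _^nat) : (forall i, g_sigma_preimage coord (F i)) ->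
  g_sigma_preimage coord (\bigcup_i (F i)).
Proof. exact: sigma_algebra_bigcup. Qed.

(* The Borel sigma-algebra of R^n, as the product sigma-algebra. *)
HB.instance Definition _ := @isMeasurable.Build rV_display
  'rV[R]_n (g_sigma_preimage coord) rV_set0 rV_setC rV_bigcup.

Lemma measurable_rV_coord (i : 'I_n) :
  measurable_fun [set: 'rV[R]_n] (fun x => x ord0 i : measurableTypeR R).
Proof.
move=> _ Y mY; rewrite setTI; apply: sub_sigma_algebra => /=.
rewrite -bigcup_seq/=; exists i => /=; first by rewrite mem_index_enum.
by exists Y => //; rewrite setTI.
Qed.

End measurable_rV.

Lemma measurable_fun_rV (R : realType) n d (T : measurableType d)
    (f : T -> 'rV[R]_n) :
  (forall i, measurable_fun [set: T] (fun x => f x ord0 i : measurableTypeR R)) ->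
  measurable_fun [set: T] f.
Proof.
move=> mf.
pose coord (i : 'I_n) (x : 'rV[R]_n) : measurableTypeR R := x ord0 i.
have H : g_sigma_preimage (fun i => coord i \o f) `<=` @measurable _ T.
  apply: smallest_sub; first exact: sigma_algebra_measurable.
  case: n => [|n] in f mf @coord *; first by rewrite big_ord0.
  rewrite -bigcup_mkord_ord; apply: bigcup_sub => i Ii.
  by move=> A [B mB <-]; exact: mf.
move=> _ Y mY; apply: H.
by rewrite g_sigma_preimage_comp; exists Y.
Qed.

Section lebesgue_rV.
Context {R : realType}.

Definition rV_cons n (p : measurableTypeR R * 'rV[R]_n) : 'rV[R]_n.+1 :=
  \row_i oapp (fun j => p.2 ord0 j) p.1 (unlift ord0 i).

Lemma rV_cons0 n p : @rV_cons n p ord0 ord0 = p.1.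
Proof. by rewrite mxE unlift_none. Qed.

Lemma rV_consS n p j : @rV_cons n p ord0 (lift ord0 j) = p.2 ord0 j.
Proof. by rewrite mxE liftK. Qed.

Lemma measurable_rV_cons n : measurable_fun setT (@rV_cons n).
Proof.
apply: measurable_fun_rV => i; case: (unliftP ord0 i) => [j|] ->.
  rewrite (_ : (fun _ => _) =
      (fun x : 'rV[R]_n => x ord0 j : measurableTypeR R) \o snd).
    by apply: measurableT_comp => //; exact: measurable_rV_coord.
  by apply/funext => x; rewrite rV_consS.
by rewrite (_ : (fun _ => _) = fst)//; apply/funext => x; rewrite rV_cons0.
Qed.

Definition rV_uncons n (x : 'rV[R]_n.+1) : measurableTypeR R * 'rV[R]_n :=
  (x ord0 ord0, \row_j x ord0 (lift ord0 j)).

Lemma rV_consK n : cancel (@rV_cons n) (@rV_uncons n).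
Proof.
move=> p; rewrite /rV_uncons rV_cons0 [RHS]surjective_pairing; congr (_, _).
by apply/rowP => j; rewrite mxE rV_consS.
Qed.

Lemma measurable_rV_uncons n : measurable_fun setT (@rV_uncons n).
Proof.
apply/measurable_fun_pairP; split; first exact: measurable_rV_coord.
apply: measurable_fun_rV => j.
rewrite (_ : (fun _ => _) =
    (fun x : 'rV[R]_n.+1 => x ord0 (lift ord0 j) : measurableTypeR R)).
  exact: measurable_rV_coord.
by apply/funext => x; rewrite /= mxE.
Qed.

Definition lebesgue_cons n (mu : set 'rV[R]_n -> \bar R) :
    set 'rV[R]_n.+1 -> \bar R :=
  pushforward (lebesgue_measure \x mu)%E (@rV_cons n).

Section lebesgue_cons_measure.
Variables (n : nat) (mu : {sigma_finite_measure set 'rV[R]_n -> \bar R}).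

HB.instance Definition _ := Measure.copy (lebesgue_cons mu)
  (measure_function_pushforward__canonical__measure_function_Measure
    (lebesgue_measure \x mu)%E (@measurable_rV_cons n)).

Let lebesgue_cons_sigma_finite : sigma_finite setT (lebesgue_cons mu).
Proof.
have /sigma_finiteP[F [TF ndF Foo]] := sigma_finiteT (@lebesgue_measure R).
have /sigma_finiteP[G [TG ndG Goo]] := sigma_finiteT mu.
exists (fun k => @rV_uncons n @^-1` (F k `*` G k)).
  rewrite -preimage_bigcup -[LHS](preimage_setT (@rV_uncons n)); congr (_ @^-1` _).
  apply/seteqP; split=> // -[x y] _.
  have [k _ Fx] : (\bigcup_k F k) x by rewrite -TF.
  have [l _ Gy] : (\bigcup_k G k) y by rewrite -TG.
  exists (maxn k l) => //; split => /=.
    by move: x Fx; exact/subsetPset/ndF/leq_maxl.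
  by move: y Gy; exact/subsetPset/ndG/leq_maxr.
move=> k; have [mF Fk] := Foo k; have [mG Gk] := Goo k; split.
  by rewrite -[X in measurable X]setTI; apply: measurable_rV_uncons => //;
    exact: measurableX.
rewrite /lebesgue_cons /pushforward -comp_preimage.
rewrite (_ : _ \o _ = id); last by apply/funext => x; exact: rV_consK.
by rewrite preimage_id product_measure1E// lte_mul_pinfty// ge0_fin_numE.
Qed.

HB.instance Definition _ := @Measure_isSigmaFinite.Build _ _ _
  (lebesgue_cons mu) lebesgue_cons_sigma_finite.

End lebesgue_cons_measure.

Fixpoint lebesgue_rV n : {sigma_finite_measure set 'rV[R]_n -> \bar R} :=
  if n is n'.+1 then lebesgue_cons (lebesgue_rV n')
  else @dirac _ 'rV[R]_0 0 R.

End lebesgue_rV.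

Lemma lebesgue_rV_box (R : realType) n (A : 'I_n -> set (measurableTypeR R)) :
  (forall i, measurable (A i)) ->
  lebesgue_rV n [set x : 'rV[R]_n | forall i, A i (x ord0 i)] =
  (\prod_(i < n) lebesgue_measure (A i))%E.
Proof.
elim: n A => [|n IHn] A mA.
  by rewrite big_ord0 /= diracE mem_set// => -[].
pose B := [set x : 'rV[R]_n | forall i, A (lift ord0 i) (x ord0 i)].
rewrite big_ord_recl -IHn//= /lebesgue_cons /pushforward.
rewrite (_ : _ @^-1` _ = A ord0 `*` B); last first.
  apply/seteqP; split=> -[a v] /=.
    move=> Aav; split; first by have := Aav ord0; rewrite rV_cons0.
    by move=> i; have := Aav (lift ord0 i); rewrite rV_consS.
  move=> [Aa Bv] i; case: (unliftP ord0 i) => [j|] ->.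
    by rewrite rV_consS; exact: Bv.
  by rewrite rV_cons0.
rewrite product_measure1E//.
rewrite (_ : B = \bigcap_(i in [set: 'I_n])
    ((fun x : 'rV[R]_n => x ord0 i : measurableTypeR R) @^-1` A (lift ord0 i))).
  apply: fin_bigcap_measurable => // i _.
  by rewrite -[X in measurable X]setTI; exact: measurable_rV_coord.
by apply/seteqP; split=> x /= Bx i; [move=> _|]; exact: Bx.
Qed.

Section euclidean.
Context {R : realType} {d : nat}.
Implicit Types x y : 'rV[R]_d.

Definition dot x y : R := \sum_(i < d) x ord0 i * y ord0 i.

(* The library norm `|x| on row vectors is the sup norm. *)
Definition enorm x : R := Num.sqrt (dot x x).

End euclidean.

Local Open Scope complex_scope.

Section fourier.
Context {R : realType} {d : nat}.
Let mu := @lebesgue_rV R d.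
Implicit Types (f g : 'rV[R]_d -> R[i]) (sigma : 'rV[R]_d -> R).

Definition cis (theta : R) : R[i] := cos theta +i* sin theta.

Definition cmeasurable f :=
  measurable_fun setT (fun x => complex.Re (f x)) /\
  measurable_fun setT (fun x => complex.Im (f x)).

Definition cintegrable f :=
  mu.-integrable setT (fun x => (complex.Re (f x))%:E) /\
  mu.-integrable setT (fun x => (complex.Im (f x))%:E).

Definition cintegral f : R[i] :=
  (\int[mu]_x complex.Re (f x)) +i* (\int[mu]_x complex.Im (f x)).

Definition cLfun (p : \bar R) f :=
  (fun x => complex.Re (f x)) \in Lfun mu p /\ (fun x => complex.Im (f x)) \in Lfun mu p.

Definition cLnorm (p : \bar R) f : \bar R :=
  Lnorm mu p (fun x => (Normc.normc (f x))%:E).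

Definition fourier1 f : 'rV[R]_d -> R[i] :=
  fun xi => cintegral (fun x => cis (- dot x xi) * f x).

Definition inv_fourier1 f : 'rV[R]_d -> R[i] :=
  fun x => ((2 * pi) ^- d)%:C * cintegral (fun xi => cis (dot x xi) * f xi).

(* The graph of the closure in L^2 x L^2 of an operator F that is given by an
   explicit formula on the intersection of L^1 and L^2.  When F is bounded for
   the L^2 norm, as for the two Fourier transforms (Plancherel), this is the
   unique continuous extension of F to L^2. *)
Definition L2_extension (F : ('rV[R]_d -> R[i]) -> 'rV[R]_d -> R[i]) f g :=
  [/\ cmeasurable f, cmeasurable g &
  exists u : nat -> 'rV[R]_d -> R[i],
  [/\ forall n, cLfun 1%:E (u n) /\ cLfun 2%:E (u n),
      cLnorm 2%:E (fun x => u n x - f x) @[n --> \oo] --> 0%E &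
      cLnorm 2%:E (fun x => F (u n) x - g x) @[n --> \oo] --> 0%E]].

(* g is the image of f under the operator on L^2(R^d) whose Fourier multiplier
   is sigma. *)
Definition multiplier_op sigma f g :=
  exists fhat : 'rV[R]_d -> R[i],
    L2_extension fourier1 f fhat /\
    L2_extension inv_fourier1 (fun xi => (sigma xi)%:C * fhat xi) g.

End fourier.

Section relativistic_stable.
Context {R : realType} (d : nat) (alpha m : R).

Definition L_symbol (xi : 'rV[R]_d) : R :=
  (enorm xi ^+ 2 + m `^ (2 / alpha)) `^ (alpha / 2) - m.

(* exp (- t L): as L is multiplier_op L_symbol, its functional calculus acts on
   the symbol. *)
Definition L_semigroup (t : R) (f g : 'rV[R]_d -> R[i]) :=
  multiplier_op (fun xi => expR (- t * L_symbol xi)) f g.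

(* p t (x - y) is the integral kernel of exp (- t L) for t > 0.  The operator
   determines p t only almost everywhere; p t is its continuous version. *)
Definition heat_kernel (p : R -> 'rV[R]_d -> R) :=
  forall t : R, 0 < t ->
    continuous (p t) /\
    forall f g : 'rV[R]_d -> R[i], cLfun 2%:E f -> L_semigroup t f g ->
      {ae lebesgue_rV d, forall x,
        cintegrable (fun y => (p t (x - y))%:C * f y) /\
        g x = cintegral (fun y => (p t (x - y))%:C * f y)}.

(* Valued in the extended reals, so that no convergence is presupposed. *)
Definition resolvent_kernel (p : R -> 'rV[R]_d -> R) (lambda : R)
    (x : 'rV[R]_d) : \bar R :=
  (\int[lebesgue_measure]_(t in `]0%R, +oo[) (expR (- lambda * t) * p t x)%:E)%E.

Definition bessel_K (rho z : R) : R :=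
  2^-1 * (z / 2) `^ rho *
  \int[lebesgue_measure]_(t in `]0, +oo[)
    (t `^ (- rho - 1) * expR (- t - z ^+ 2 / (4 * t))).

Definition kappa (r : R) : R :=
  m `^ ((d%:R + alpha) / (2 * alpha)) *
  bessel_K ((d%:R + alpha) / 2) (m `^ alpha^-1 * r).

(* For 0 < alpha < 2 the last two cases only occur with d = 1. *)
Definition h_da (r : R) : R :=
  if alpha < d%:R then r `^ (- (d%:R - alpha))
  else if alpha == d%:R then ln (1 + r^-1)
  else 1.

Definition H_da (r : R) : R :=
  if r <= 1 then h_da r else r `^ (- ((d%:R + alpha) / 2)) * kappa r.

End relativistic_stable.

(* Main.v *)
(** Put [b = alpha / 2], [M = m ^ (2 / alpha)] and let [G s] be the Gaussian heat kernel at time [s].  The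
    symbol of [exp (- t L)] is [exp (t m) * exp (- t (|xi|^2 + M) ^ b)].  For [T > 0] the coefficients [a k] of
    [exp (- T (1 - y) ^ b) = \sum_k a k * y ^ k] are nonnegative, and a recurrence gives
    [a k <= C * min (T * k ^ (- b - 1)) (T ^ (- 1 / b))].  Taking [y = exp (- delta (|xi|^2 + M))] and
    [T = t * delta ^ (- b)], each [y ^ k] is, up to a constant, the transform of [G (k * delta)], so that
    [delta -> 0] yields, for the kernel tested against narrow Gaussians and then for its continuous version,
      [p t x <= C * exp (t m) * \int_(s > 0) G s x * exp (- M s) * min (t * s ^ (- b - 1)) (t ^ (- 1 / b))].
    This replaces the density of the stable subordinator and its tail estimates.  By Tonelli, integrating
    against [exp (- lambda t)] leaves
      [\int_(s > 0) G s x * exp (- M s) * min (s ^ (- b - 1)) (s ^ (b - 1))],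
    which for [|x| <= 1] is estimated on [0, |x|^2], [|x|^2, 1] and [1, +oo) separately, and for [|x| > 1]
    becomes a Bessel integral after [u = M s]. *)

Require Import Defs.
From HB Require Import structures.
From mathcomp Require Import all_boot all_order all_algebra.
From mathcomp Require Import all_classical all_reals all_analysis.
From mathcomp Require Import measurable_realfun complex.
From mathcomp Require Import ring lra.

Set Implicit Arguments.
Unset Strict Implicit.
Unset Printing Implicit Defensive.
Import Order.TTheory GRing.Theory Num.Theory.
Import numFieldNormedType.Exports.

Local Open Scope classical_set_scope.
Local Open Scope ring_scope.

(** * Power series with subexponential coefficients *)

(** A power series in one Gaussian multiplier [y] only needs nonnegative coefficients, because each
    [y ^ k] times the test Gaussian is again a Gaussian. The two bounds on [a k] are the ones that
    scale: with [s = k * delta] and [T = t * delta ^ (- b)] they become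
    [delta * (t * s ^ (- b - 1))] and [delta * t ^ (- 1 / b)], so the series is dominated by a
    Riemann sum of mesh [delta] whose weight is the minimum of the two. As
    [(1 - exp (- delta z)) / delta] tends to [z], the exponent [T (1 - y) ^ b] tends to [t z ^ b],
    and the term [k = 0], of weight [exp (- T)], disappears. The operator fixes the kernel only
    almost everywhere and only through its action on functions. Gaussian test functions make both
    Fourier integrals explicit, and they dominate the integrands in both limits. The condition
    [b < 1] makes [t ^ (- 1 / b)] integrable at infinity, and [lambda > m] absorbs [exp (t m)]. *)

Section subexponential.
Context {R : realType}.
Implicit Types (c u v : nat -> R).

(** Radius of convergence at least 1, in a form that termwise differentiation visibly preserves. *)
Definition subexponential c :=
  forall r : R, 1 < r -> exists M : R, forall k, `|c k| <= M * r ^+ k.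

Lemma bernoulli_ineq (h : R) n : 0 <= h -> 1 + n%:R * h <= (1 + h) ^+ n.
Proof.
move=> h0; elim: n => [|n IH]; first by rewrite mul0r addr0 expr0.
rewrite exprS; apply: le_trans (_ : (1 + h) * (1 + n%:R * h) <= _).
  by have := ler0n R n; rewrite -natr1; nra.
by rewrite ler_wpM2l// addr_ge0.
Qed.

Lemma subexponential_diffs c : subexponential c -> subexponential (pseries_diffs c).
Proof.
move=> sc r r1.
(* An intermediate ratio [s] leaves [r / s > 1], whose powers absorb the factor [k + 1] by
   Bernoulli. *)
pose s := (1 + r) / 2.
have s1 : 1 < s by rewrite /s; lra.
have [M Mc] := sc s s1.
have M0 : 0 <= M by have := Mc 0; rewrite expr0 mulr1; apply: le_trans.
pose h := r / s - 1.
have s0 : 0 < s by lra.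
have h0 : 0 < h.
  by rewrite /h subr_gt0 ltr_pdivlMr ?mul1r; rewrite /s in s1 *; lra.
exists (M * s * (1 + h^-1)) => k.
rewrite /pseries_diffs normrM ger0_norm//.
apply: le_trans (ler_wpM2l _ (Mc _)) _ => //.
have -> : r ^+ k = (1 + h) ^+ k * s ^+ k.
  by rewrite -exprMn; congr (_ ^+ _); rewrite /h; field; rewrite gt_eqF.
rewrite exprS.
have B : k.+1%:R <= (1 + h^-1) * (1 + h) ^+ k.
  have B := bernoulli_ineq k (ltW h0).
  have hi : 0 < h^-1 by rewrite invr_gt0.
  have := ler_wpM2l (ltW hi) B; rewrite mulrDr mulrCA mulVf ?gt_eqF// !mulr1 => B'.
  have k0 : 0 <= k%:R :> R by [].
  have : 0 <= k%:R * h by rewrite mulr_ge0// ltW.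
  rewrite -natr1 mulrDl mul1r; lra.
have sk : 0 <= s ^+ k by rewrite exprn_ge0// ltW.
have Ms : 0 <= M * s by rewrite mulr_ge0// ltW.
rewrite [leLHS](_ : _ = (M * s * s ^+ k) * k.+1%:R); last by rewrite mulrC !mulrA.
rewrite [leRHS](_ : _ = (M * s * s ^+ k) * ((1 + h^-1) * (1 + h) ^+ k)); last first.
  by rewrite [X in _ * X]mulrC mulrACA.
by rewrite ler_wpM2l// mulr_ge0.
Qed.

Lemma is_cvg_pseries_subexponential c (x : R) :
  subexponential c -> `|x| < 1 -> cvgn (pseries c x).
Proof.
move=> sc x1.
have [r [r1 rx]] : exists r : R, 1 < r /\ `|r * x| < 1.
  have [->|x0] := eqVneq x 0; first by exists 2; rewrite mulr0 normr0; split; lra.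
  have nx0 : 0 < `|x| by rewrite normr_gt0.
  exists ((1 + `|x|^-1) / 2).
  have xi1 : 1 < `|x|^-1 by rewrite invf_gt1.
  split; first by lra.
  rewrite normrM gtr0_norm; last by lra.
  rewrite mulrAC mulrDl mulVf ?gt_eqF// mul1r; lra.
have [M Mc] := sc r r1.
have M0 : 0 <= M by have := Mc 0; rewrite expr0 mulr1; apply: le_trans.
apply: normed_cvg.
apply: (@series_le_cvg _ _ (geometric M `|r * x|)) => //.
- by move=> n; exact: normr_ge0.
- by move=> n; rewrite /= mulr_ge0// exprn_ge0.
- move=> n; rewrite /= normrM normrX normrM exprMn mulrA ler_wpM2r//.
  by rewrite (gtr0_norm (lt_trans ltr01 r1)).
- by apply: is_cvg_geometric_series; rewrite normr_id.
Qed.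

Lemma is_derive_pseries_subexponential c (x : R) :
  subexponential c -> `|x| < 1 ->
  is_derive x 1 (fun y => limn (pseries c y)) (limn (pseries (pseries_diffs c) x)).
Proof.
move=> sc x1.
pose K := (1 + `|x|) / 2.
have K1 : `|K| < 1 by rewrite ger0_norm /K; have := normr_ge0 x; lra.
apply: (@pseries_snd_diffs _ c K).
- exact: is_cvg_pseries_subexponential.
- by apply: is_cvg_pseries_subexponential => //; exact: subexponential_diffs.
- by apply: is_cvg_pseries_subexponential => //; do 2 apply: subexponential_diffs.
- by rewrite [X in _ < X]ger0_norm /K; have := normr_ge0 x; lra.
Qed.

Definition conv u v n := \sum_(j < n.+1) u j * v (n - j)%N.

Lemma conv_ge0 u v n : (forall k, 0 <= u k) -> (forall k, 0 <= v k) -> 0 <= conv u v n.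
Proof. by move=> u0 v0; apply: sumr_ge0 => i _; rewrite mulr_ge0. Qed.

(** Nonnegativity gives a sandwich: the product of the two truncations of length [N] lies between
    the partial sums of the Cauchy product of lengths [N] and [2 N]. Multiplying polynomials
    provides both comparisons. *)
Lemma pseries_conv u v (x lu lv : R) :
  (forall k, 0 <= u k) -> (forall k, 0 <= v k) -> 0 <= x ->
  pseries u x @ \oo --> lu -> pseries v x @ \oo --> lv ->
  pseries (conv u v) x @ \oo --> lu * lv.
Proof.
move=> u0 v0 x0 ulu vlv.
pose P N := \poly_(i < N) u i; pose Q N := \poly_(i < N) v i.
have PE N : pseries u x N = (P N).[x].
  by rewrite /pseries/= /series/= horner_poly big_mkord.
have QE N : pseries v x N = (Q N).[x].
  by rewrite /pseries/= /series/= horner_poly big_mkord.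
have PQ0 N k : 0 <= (P N * Q N)`_k.
  rewrite coefM sumr_ge0// => i _; rewrite !coef_poly.
  by case: ifP => _; case: ifP => _; rewrite ?mul0r ?mulr0// mulr_ge0.
have PQle N k : (P N * Q N)`_k <= conv u v k.
  rewrite coefM /conv ler_sum// => i _; rewrite !coef_poly.
  by case: ifP => _; case: ifP => _; rewrite ?mul0r ?mulr0// mulr_ge0.
have PQeq N k : (k < N)%N -> (P N * Q N)`_k = conv u v k.
  move=> kN; rewrite coefM /conv; apply: eq_bigr => i _; rewrite !coef_poly.
  rewrite (leq_ltn_trans _ kN) ?leq_ord//.
  by rewrite (leq_ltn_trans _ kN)// leq_subr.
have szPQ N : (size (P N * Q N)%R <= N.*2)%N.
  apply: leq_trans (size_polyMleq _ _) _.
  rewrite -addnn (leq_trans (leq_pred _))// leq_add// size_poly//.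
have lower N : pseries u x N * pseries v x N <= pseries (conv u v) x N.*2.
  rewrite PE QE -hornerM (horner_coef_wide _ (szPQ N)) /pseries/= /series/= big_mkord.
  by apply: ler_sum => i _; rewrite ler_wpM2r// exprn_ge0.
have upper N : pseries (conv u v) x N <= pseries u x N * pseries v x N.
  rewrite PE QE -hornerM.
  rewrite (horner_coef_wide _ (leq_trans (szPQ N) (leq_addr N _))).
  rewrite -(big_mkord xpredT (fun i => (P N * Q N)`_i * x ^+ i)).
  rewrite (@big_cat_nat _ _ _ N)//=; last by rewrite leq_addl.
  rewrite -[leLHS]addr0 lerD//.
    rewrite /pseries/= /series/= ler_sum_nat// => i /andP[_ iN].
    by rewrite PQeq.
  by apply: sumr_ge0 => i _; rewrite mulr_ge0// exprn_ge0.
have nd : nondecreasing_seq (pseries (conv u v) x).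
  apply/nondecreasing_seqP => n; rewrite /pseries/= /series/= big_nat_recr//=.
  by rewrite lerDl mulr_ge0 ?exprn_ge0 ?conv_ge0.
have uv : (fun N => pseries u x N * pseries v x N) @ \oo --> lu * lv by exact: cvgM.
have up N : pseries (conv u v) x N <= lu * lv.
  apply: (cvgr_to_ge uv).
  by near=> n; apply: le_trans (upper n); apply: nd; near: n; exact: nbhs_infty_ge.
apply/cvgrPdist_le => e e0.
move/cvgrPdist_le : (uv) => /(_ e e0)[N0 _ HN0].
near=> n.
rewrite ger0_norm ?subr_ge0//.
have := HN0 N0 (leqnn _); rewrite /= => H.
rewrite (le_trans _ H)// (le_trans _ (ler_norm _))// lerB//.
rewrite (le_trans (lower N0))//; apply: nd.
by near: n; exact: nbhs_infty_ge.
Unshelve. all: by end_near. Qed.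

End subexponential.

(** * A generating function for the stable subordinator *)

(** The integrating factor makes [F * expR (- G)] constant, by the mean value theorem. Both
    generating functions and the Gaussian transform are identified through this. *)
Lemma linear_ode {R : realType} (F G G' : R -> R) (y : R) :
  0 <= y ->
  (forall x, x \in `[0, y]%R -> is_derive x 1 F (G' x * F x)) ->
  (forall x, x \in `[0, y]%R -> is_derive x 1 G (G' x)) ->
  F y = F 0 * expR (G y - G 0).
Proof.
move=> y0 dF dG.
pose H := F * (expR \o (- G)).
have dH x : x \in `[0, y]%R -> is_derive x 1 H 0.
  move=> xy; have ? := dF x xy; have ? := dG x xy.
  apply: is_derive_eq; rewrite /GRing.scale/=; ring.
have cH : {within `[0, y], continuous H}.
  apply: derivable_within_continuous => x xy.
  by have [] := dH x xy.
have dH' (x : R) : x \in `]0, y[%R -> is_derive x 1 H ((fun=> 0) x).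
  by move=> /subset_itv_oo_cc; exact: dH.
have [c _] := MVT_segment y0 dH' cH.
rewrite mul0r => /eqP; rewrite subr_eq0 => /eqP.
move=> E; have {}E : F y * expR (- G y) = F 0 * expR (- G 0) by exact: E.
by rewrite expRD mulrCA mulrC -E -mulrA -expRD addNr expR0 mulr1.
Qed.

Section stable_coefficients.
Context {R : realType}.
Variable (b : R).
Hypotheses (b_gt0 : 0 < b) (b_lt1 : b < 1).

(* The coefficients of [(1 - y) ^ (b - 1)]. *)
Fixpoint vcoef n : R := if n is n'.+1 then vcoef n' * (1 - b / n'.+1%:R) else 1.

(** The equation [(1 - y) W' = (1 - b) W], read coefficientwise. *)
Lemma vcoefS n : n.+1%:R * vcoef n.+1 = (n%:R + (1 - b)) * vcoef n.
Proof.
by rewrite /= mulrCA mulrBr mulr1 mulrCA divff ?pnatr_eq0// mulr1 -natr1 mulrC; congr (_ * _); ring.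
Qed.

Lemma vcoef_ge0 n : 0 <= vcoef n.
Proof.
elim: n => [|n IH] //=; rewrite mulr_ge0// subr_ge0 ler_pdivrMr// mul1r.
by rewrite (le_trans (ltW b_lt1))// ler1n.
Qed.

(** Each factor [1 - b / (n + 1)] is at most [exp (- b / (n + 1))], hence at most
    [((n + 1) / (n + 2)) ^ b] because [ln (1 + 1 / (n + 1)) <= 1 / (n + 1)]; the product
    telescopes. *)
Lemma vcoef_le n : vcoef n <= n.+1%:R `^ (- b).
Proof.
elim: n => [|n IH] /=; first by rewrite powR1.
have n1 : 0 < n.+1%:R :> R by rewrite ltr0n.
have n2 : 0 < n.+2%:R :> R by rewrite ltr0n.
apply: le_trans (_ : n.+1%:R `^ (- b) * expR (- (b / n.+1%:R)) <= _).
  apply: ler_pM => //; first exact: vcoef_ge0.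
    rewrite subr_ge0 ler_pdivrMr// mul1r (le_trans (ltW b_lt1))// ler1n//.
  by rewrite (le_trans _ (expR_ge1Dx _)).
rewrite /powR !gt_eqF// -expRD ler_expR.
have : ln (n.+2%:R / n.+1%:R) <= (n.+1%:R^-1 : R).
  rewrite (_ : _ / _ = 1 + n.+1%:R^-1).
    by apply: le_ln1Dx; rewrite (lt_le_trans (ltrN10 _))// invr_ge0.
  by rewrite -[n.+2%:R]nat1r mulrDl divff ?gt_eqF// mul1r addrC.
rewrite ln_div ?posrE// => H.
have := ler_wpM2l (ltW b_gt0) H; rewrite mulrBr.
by move: (ln _) (ln _) (_ ^-1) => u w i; lra.
Qed.

Lemma vcoef_le1 n : vcoef n <= 1.
Proof.
apply: (le_trans (vcoef_le n)); rewrite powRN invf_le1 ?powR_gt0//.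
by rewrite -[leLHS](powRr0 n.+1%:R) ler_powR ?ler1n// ltW.
Qed.

(** Telescopes: by [vcoefS], the increment of [n * vcoef n] is [(1 - b) * vcoef n]. *)
Lemma sum_vcoef n : (1 - b) * (\sum_(j < n) vcoef j) = n%:R * vcoef n.
Proof.
elim: n => [|n IH]; first by rewrite big_ord0 mul0r mulr0.
by rewrite vcoefS [RHS]mulrDl -IH big_ord_recr/= mulrDr.
Qed.

Lemma sum_vcoef_le n : \sum_(j < n) vcoef j <= n%:R `^ (1 - b) / (1 - b).
Proof.
have b1 : 0 < 1 - b by rewrite subr_gt0.
rewrite ler_pdivlMr// mulrC sum_vcoef.
case: n => [|n]; first by rewrite mul0r powR_ge0.
rewrite powRB ?pnatr_eq0 ?implybT// powRr1// ler_wpM2l// -powRN.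
apply: (le_trans (vcoef_le _)).
rewrite !powRN lef_pV2 ?posrE ?powR_gt0 ?ltr0n//.
by rewrite ge0_ler_powR ?nnegrE ?ltW// ltr_nat.
Qed.

Lemma subexponential_vcoef : subexponential vcoef.
Proof.
move=> r r1; exists 1 => k; rewrite mul1r ger0_norm ?vcoef_ge0//.
by rewrite (le_trans (vcoef_le1 _))// exprn_ege1// ltW.
Qed.

Lemma lim_pseries_vcoef (y : R) : 0 <= y < 1 ->
  limn (pseries vcoef y) = (1 - y) `^ (b - 1).
Proof.
move=> /andP[y0 y1].
pose W := (fun x : R => limn (pseries vcoef x)).
pose G := (fun x : R => (b - 1) * ln (1 - x)).
have dW x : x \in `[0, y]%R -> is_derive x 1 W ((1 - b) / (1 - x) * W x).
  rewrite in_itv/= => /andP[x0 xy].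
  have x1 : `|x| < 1 by rewrite ger0_norm// (le_lt_trans xy).
  have x1' : 1 - x != 0 by rewrite subr_eq0 gt_eqF// (le_lt_trans xy).
  have sv := subexponential_vcoef.
  apply: (is_derive_eq (is_derive_pseries_subexponential sv x1)).
  set W' := limn _.
  have cW : pseries vcoef x @ \oo --> W x by exact: is_cvg_pseries_subexponential.
  have cd : cvgn (pseries (pseries_diffs vcoef) x).
    by apply: is_cvg_pseries_subexponential => //; exact: subexponential_diffs.
  have cW' := pseries_diffs_equiv cd; rewrite -/W' in cW'.
  (* The differential equation, rearranged so that it follows term by term from [vcoefS]. *)
  suff E : W' = x * W' + (1 - b) * W x.
    apply: (mulfI x1'); rewrite mulrA mulrCA divff// mulr1 mulrBl mul1r.
    by rewrite {1}E; ring.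
  have H : pseries (pseries_diffs vcoef) x @ \oo --> x * W' + (1 - b) * W x.
    rewrite (_ : pseries _ _ = (fun n =>
        x * series (fun i => i%:R * vcoef i * x ^+ i.-1) n +
        (1 - b) * pseries vcoef x n)).
      by apply: cvgD; apply: cvgMr.
    apply/funext => n; rewrite /pseries/series/= !mulr_sumr -big_split/=.
    apply: eq_bigr => i _; rewrite /pseries_diffs vcoefS.
    by case: i => [|i]; rewrite /= ?expr0 ?exprS; ring.
  exact: (cvg_unique _ cd H).
have dG x : x \in `[0, y]%R -> is_derive x 1 G ((1 - b) / (1 - x)).
  rewrite in_itv/= => /andP[x0 xy].
  have x1' : 0 < 1 - x by rewrite subr_gt0 (le_lt_trans xy).
  have ? := is_derive1_ln x1'.
  rewrite /G.
  have : is_derive x 1 ((b - 1) \*: (@ln R \o (cst 1 - id))) ((b - 1) *: ((1 - x)^-1 * (0 - 1))).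
    by apply: is_deriveZ; apply: is_derive1_comp.
  by move/is_derive_eq; apply; rewrite /GRing.scale/=; ring.
have := linear_ode y0 dW dG.
rewrite /W /G subr0 ln1 mulr0 subr0 => ->.
have -> : limn (pseries vcoef 0) = 1.
  apply/cvg_lim => //; rewrite -(cvg_shiftS).
  rewrite (_ : (fun n => _) = cst 1); first exact: cvg_cst.
  apply/funext => n; rewrite /pseries/series/= big_nat_recl//= expr0 mulr1.
  by rewrite big1 ?addr0// => i _; rewrite exprS mul0r mulr0.
by rewrite mul1r /powR gt_eqF// subr_gt0.
Qed.

Variable T : R.
Hypothesis T_gt0 : 0 < T.

(* The list [:: a_n; ...; a_0] of coefficients of [f y = exp (- T (1 - y) ^ b)]; the recurrence is the
   equation [f' y = T b (1 - y) ^ (b - 1) f y] read coefficientwise. *)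
Fixpoint acoefs n : seq R :=
  if n is n'.+1 then
    T * b / n'.+1%:R * (\sum_(j < n'.+1) vcoef j * (acoefs n')`_j) :: acoefs n'
  else [:: expR (- T)].

Definition acoef n : R := (acoefs n)`_0.

Lemma acoefsE n j : (j <= n)%N -> (acoefs n)`_j = acoef (n - j).
Proof.
elim: n j => [|n IH] [|j] //=; rewrite ltnS => jn.
by rewrite subSS IH.
Qed.

Lemma acoefS n : n.+1%:R * acoef n.+1 = T * b * conv vcoef acoef n.
Proof.
have -> : acoef n.+1 =
  T * b / n.+1%:R * (\sum_(j < n.+1) vcoef j * (acoefs n)`_j) by [].
rewrite mulrA [n.+1%:R * _]mulrC divfK ?pnatr_eq0//; congr (_ * _).
by apply: eq_bigr => i _; rewrite acoefsE// leq_ord.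
Qed.

Lemma acoefSE n : acoef n.+1 = T * b * conv vcoef acoef n / n.+1%:R.
Proof. by rewrite -acoefS mulrAC divff ?pnatr_eq0// mul1r. Qed.

Lemma acoef_ge0 n : 0 <= acoef n.
Proof.
have Tb : 0 <= T * b by rewrite mulr_ge0// ltW.
elim/ltn_ind: n => -[_|n IH]; first exact: expR_ge0.
rewrite acoefSE divr_ge0// mulr_ge0// sumr_ge0// => i _.
by rewrite mulr_ge0 ?vcoef_ge0// IH// ltnS leq_subr.
Qed.

Lemma conv_vcoef_le n : conv vcoef acoef n <= \sum_(i < n.+1) acoef i.
Proof.
rewrite /conv (reindex_inj rev_ord_inj)/= ler_sum// => i _.
rewrite subSS subKn ?leq_ord// -[leRHS]mul1r ler_wpM2r ?acoef_ge0//.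
exact: vcoef_le1.
Qed.

(** Summing a geometric bound in the recurrence costs [T * b / (r - 1)], which the division by
    [n + 1] repairs from index [K] on; [M] covers the earlier indices. This a priori growth is what
    allows the series to be differentiated. *)
Lemma subexponential_acoef : subexponential acoef.
Proof.
move=> r r1.
have Tb : 0 <= T * b by rewrite mulr_ge0// ltW.
have r0 : 0 < r - 1 by rewrite subr_gt0.
pose K := (Num.truncn (T * b / (r - 1))).+1.
have HK : T * b / (r - 1) <= K%:R by apply/ltW; rewrite /K truncnS_gt.
pose M := \sum_(i < K) acoef i.
have M0 : 0 <= M by apply: sumr_ge0 => i _; exact: acoef_ge0.
exists M; elim/ltn_ind => k IH; rewrite ger0_norm ?acoef_ge0//.
have [kK|] := ltnP k K.
  rewrite (@le_trans _ _ M)//; last by rewrite ler_peMr// exprn_ege1// ltW.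
  rewrite /M (bigD1 (Ordinal kK))//= lerDl.
  by apply: sumr_ge0 => i _; exact: acoef_ge0.
case: k IH => [//|n IH] Kn.
rewrite acoefSE ler_pdivrMr ?ltr0n//.
apply: le_trans (ler_wpM2l Tb (conv_vcoef_le n)) _.
apply: le_trans (_ : T * b * (\sum_(i < n.+1) M * r ^+ i) <= _).
  rewrite ler_wpM2l//; apply: ler_sum => i _.
  by rewrite (le_trans (ler_norm _))// IH.
have -> : \sum_(i < n.+1) M * r ^+ i = M * ((r ^+ n.+1 - 1) / (r - 1)).
  by rewrite -mulr_sumr subrX1 mulrAC divff ?mul1r// gt_eqF.
rewrite mulrCA -[leRHS]mulrA ler_wpM2l//.
rewrite mulrCA ler_pM ?divr_ge0 ?(ltW r0)//.
- by rewrite subr_ge0 exprn_ege1// ltW.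
- by rewrite lerBlDr lerDl.
- by rewrite (le_trans HK)// ler_nat.
Qed.

Lemma cvg_pseries_acoef (y : R) : 0 <= y < 1 ->
  pseries acoef y @ \oo --> expR (- (T * (1 - y) `^ b)).
Proof.
move=> /andP[y0 y1].
pose A := (fun x : R => limn (pseries acoef x)).
(* The power [(1 - x) ^ b] is written with [expR] and [ln] so that the chain rule applies
   directly. *)
pose G := (fun x : R => - (T * expR (b * ln (1 - x)))).
have sa := subexponential_acoef.
have dA x : x \in `[0, y]%R ->
    is_derive x 1 A (T * b * (1 - x) `^ (b - 1) * A x).
  rewrite in_itv/= => /andP[x0 xy].
  have x1 : `|x| < 1 by rewrite ger0_norm// (le_lt_trans xy).
  have x01 : 0 <= x < 1 by rewrite x0 (le_lt_trans xy).
  apply: (is_derive_eq (is_derive_pseries_subexponential sa x1)).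
  have cA : pseries acoef x @ \oo --> A x by exact: is_cvg_pseries_subexponential.
  have cV : pseries vcoef x @ \oo --> (1 - x) `^ (b - 1).
    rewrite -lim_pseries_vcoef//.
    by apply: is_cvg_pseries_subexponential => //; exact: subexponential_vcoef.
  have := pseries_conv vcoef_ge0 acoef_ge0 x0 cV cA.
  move=> /(@cvgMr _ _ _ _ _ (T * b)) H.
  apply/cvg_lim => //; rewrite -mulrA.
  rewrite (_ : pseries _ _ = (fun n => T * b * pseries (conv vcoef acoef) x n)) //.
  apply/funext => n; rewrite /pseries/series/= mulr_sumr.
  by apply: eq_bigr => i _; rewrite /pseries_diffs acoefS mulrA.
have dG x : x \in `[0, y]%R -> is_derive x 1 G (T * b * (1 - x) `^ (b - 1)).
  rewrite in_itv/= => /andP[x0 xy].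
  have x1' : 0 < 1 - x by rewrite subr_gt0 (le_lt_trans xy).
  have ? := is_derive1_ln x1'.
  have : is_derive x 1 (- T \*: (expR \o (b \*: (@ln R \o (cst 1 - id)))))
     (- T *: (expR (b * ln (1 - x)) * (b *: ((1 - x)^-1 * (0 - 1))))).
    by apply: is_deriveZ; apply: is_derive1_comp.
  rewrite (_ : _ \*: _ = G); last first.
    by apply/funext => z; rewrite /G/= /GRing.scale/= mulNr.
  move/is_derive_eq; apply; rewrite /GRing.scale/=.
  have -> : (1 - x) `^ (b - 1) = expR (b * ln (1 - x)) / (1 - x).
    rewrite powRB ?(gt_eqF x1') ?implybT//.
    by rewrite powRr1 ?(ltW x1')// /powR (gt_eqF x1').
  ring.
have := linear_ode y0 dA dG.
rewrite /A => E; have -> : expR (- (T * (1 - y) `^ b)) = limn (pseries acoef y).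
  rewrite E /G subr0 ln1 mulr0 expR0 mulr1.
  have -> : limn (pseries acoef 0) = expR (- T).
    apply/cvg_lim => //; rewrite -(cvg_shiftS).
    rewrite (_ : (fun n => _) = cst (expR (- T))); first exact: cvg_cst.
    apply/funext => n; rewrite /pseries/series/= big_nat_recl//= expr0 mulr1.
    by rewrite big1 ?addr0// => i _; rewrite exprS mul0r mulr0.
  rewrite -expRD; congr expR; rewrite /powR gt_eqF ?subr_gt0//; ring.
by apply: is_cvg_pseries_subexponential; rewrite ?ger0_norm.
Qed.

(* Evaluate the generating function at [y = 1 - 1 / (n + 1)], where [y ^ n >= 1 / e]. *)
Lemma sum_acoef_le n : \sum_(i < n.+1) acoef i <= expR (1 - T * n.+1%:R `^ (- b)).
Proof.
have n0 : 0 < n.+1%:R :> R by rewrite ltr0n.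
pose y : R := 1 - n.+1%:R^-1.
have i1 : n.+1%:R^-1 <= 1 :> R by rewrite invf_le1 ?ler1n.
have i0 : 0 < n.+1%:R^-1 :> R by rewrite invr_gt0.
have y01 : 0 <= y < 1 by rewrite /y subr_ge0 i1 ltrBlDr ltrDl.
have yn : expR (- 1) <= y ^+ n.
  case: n @y y01 n0 i1 i0 => [|n] y y01 n0 i1 i0.
    by rewrite expr0 expR_le1 lerN10.
  have -> : y = (1 + n.+1%:R^-1)^-1.
    by rewrite /y -[n.+2%:R]natr1; field; rewrite !gt_eqF ?ltr0n// natr1 ltr0n.
  rewrite exprVn expRN lef_pV2 ?posrE ?expR_gt0 ?exprn_gt0 ?addr_gt0 ?invr_gt0//.
  rewrite -[leRHS](_ : expR (n.+1%:R^-1) ^+ n.+1 = _).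
    by rewrite lerXn2r ?nnegrE ?expR_ge0 ?addr_ge0// expR_ge1Dx.
  by rewrite -expRM_natr mulVf// pnatr_eq0.
have H : \sum_(i < n.+1) acoef i * y ^+ i <= expR (- (T * (1 - y) `^ b)).
  apply: (cvgr_to_ge (cvg_pseries_acoef y01)).
  exists n.+1 => //= N /= nN.
  rewrite /pseries/series/= (@big_cat_nat _ _ _ n.+1)//= big_mkord lerDl.
  case/andP: y01 => y0 _.
  by apply: sumr_ge0 => i _; rewrite mulr_ge0 ?acoef_ge0 ?exprn_ge0.
have Ey : 1 - y = n.+1%:R `^ (- 1) by rewrite /y subKr powR_inv1// ltW.
rewrite Ey -powRrM mulN1r in H.
rewrite expRD -ler_pdivrMl ?expR_gt0// -expRN (le_trans _ H)// mulr_sumr.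
apply: ler_sum => i _; rewrite mulrC ler_wpM2l ?acoef_ge0//.
rewrite (le_trans yn)//; case/andP: y01 => y0 y1.
by rewrite ler_wiXn2l// ?ltW// -ltnS.
Qed.

(** For [j < L] the coefficient [acoef (n - j)] is at most [D] and the sum of the [vcoef j] is
    controlled by [sum_vcoef_le]; for [j >= L] the small factor is [vcoef j], and the other one is
    summed over all indices. *)
Lemma conv_vcoef_split n L D :
  (forall i, (n.+1 - L <= i <= n)%N -> acoef i <= D) -> 0 <= D ->
  conv vcoef acoef n <= D * (L%:R `^ (1 - b) / (1 - b)) +
    L.+1%:R `^ (- b) * \sum_(i < n.+1) acoef i.
Proof.
move=> aD D0.
apply: (@le_trans _ _ (\sum_(j < n.+1)
    ((if (j < L)%N then vcoef j * D else 0) + L.+1%:R `^ (- b) * acoef (n - j)))).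
  apply: ler_sum => j _; have a0 := acoef_ge0 (n - j); have v0 := vcoef_ge0 j.
  case: ltnP => jL.
    rewrite -[leLHS]addr0 lerD ?mulr_ge0 ?powR_ge0// ler_wpM2l// aD//.
    by rewrite leq_subr andbT -(subSS j n) leq_sub2l.
  rewrite add0r ler_wpM2r// (le_trans (vcoef_le j))//.
  rewrite !powRN lef_pV2 ?posrE ?powR_gt0 ?ltr0n//.
  by rewrite ge0_ler_powR ?nnegrE ?(ltW b_gt0)// ler_nat.
rewrite big_split/= lerD//; last first.
  rewrite -mulr_sumr [X in _ <= _ * X](reindex_inj rev_ord_inj)/=.
  by rewrite ler_wpM2l ?powR_ge0// ler_sum// => i _; rewrite subSS.
rewrite -big_mkcond/= -mulr_suml mulrC ler_wpM2l//.
apply: le_trans (sum_vcoef_le L).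
(* [L] may exceed [n + 1], so both sums are extended to a common range before being compared. *)
rewrite -(big_mkord (fun j => (j < L)%N)) (big_nat_widen 0 _ (maxn n.+1 L)) ?leq_maxl//.
rewrite -(big_mkord xpredT vcoef) [leRHS](big_nat_widen 0 _ (maxn n.+1 L)) ?leq_maxr//=.
rewrite big_mkcond [leRHS]big_mkcond/= ler_sum// => j _.
by have := vcoef_ge0 j; do 2 case: (_ < _)%N.
Qed.

(** The exponent forced by homogeneity: for [l = c * (k / T) ^ (1 / (1 - b))] one has [T * l ^ (- b)
    = k * c ^ (- b) * T ^ (- 1 / b) * (T * k ^ (- b)) ^ p]. *)
Let p : R := (b * (1 - b))^-1.
(* [c] makes the part of the convolution below [L ~ c (k / T) ^ (1 / (1 - b))] contribute at most half of the
   claimed bound, so that the induction closes. *)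
Let c : R := ((1 - b) / (2 * b)) `^ (1 - b)^-1.
Let C0 : R := b * c `^ (- b) * expR 1 * p `^ p.
(** The last summand covers [acoef 0 = exp (- T)]; the factor 2 lets the tail of the convolution
    take only half of the bound. *)
Definition acoef_cst1 : R := 2 * C0 + b^-1 `^ b^-1.

(** This is [ln (x / q) <= x / q], multiplied by [q] and exponentiated. *)
Lemma powR_le_expR (q x : R) : 0 < q -> 0 <= x -> x `^ q <= q `^ q * expR x.
Proof.
move=> q0; rewrite le_eqVlt => /predU1P[<-|x0].
  by rewrite powR0 ?gt_eqF// mulr_ge0 ?powR_ge0 ?expR_ge0.
rewrite /powR !gt_eqF// -expRD ler_expR.
have := ln_sublinear (divr_gt0 x0 q0); rewrite ln_div ?posrE// ltr_pdivlMr//.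
by lra.
Qed.

Lemma acoef_le1 k : acoef k <= acoef_cst1 * T `^ (- b^-1).
Proof.
have b1 : 0 < 1 - b by rewrite subr_gt0.
have bV : 0 < b^-1 by rewrite invr_gt0.
have p0 : 0 < p by rewrite invr_gt0 mulr_gt0.
have c0 : 0 < c by rewrite powR_gt0// divr_gt0// mulr_gt0.
have C00 : 0 <= C0 by rewrite !mulr_ge0 ?powR_ge0 ?expR_ge0// ltW.
have D0 : 0 <= acoef_cst1 by rewrite /acoef_cst1 addr_ge0 ?powR_ge0// mulr_ge0.
have TV0 := powR_ge0 T (- b^-1).
elim/ltn_ind: k => -[_|n IH].
  rewrite /acoef/= expRN powRN ler_pdivlMr ?powR_gt0// mulrC ler_pdivrMr ?expR_gt0//.
  apply: le_trans (powR_le_expR bV (ltW T_gt0)) _.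
  by rewrite ler_wpM2r ?expR_ge0// lerDr mulr_ge0.
have k0 : 0 < n.+1%:R :> R by rewrite ltr0n.
set k : R := n.+1%:R in k0 *.
(* The exponent makes [l ^ (1 - b)] proportional to [k / T], which cancels the factor [T / k] of the
   recurrence in front of the terms that use the induction hypothesis. *)
pose l := c * (k / T) `^ (1 - b)^-1.
have l0 : 0 < l by rewrite mulr_gt0// powR_gt0// divr_gt0.
pose L := Num.truncn l.
have Ll : L%:R <= l by rewrite /L truncn_le// ltW.
have lL : l <= L.+1%:R by rewrite ltW// /L truncnS_gt.
have aD i : (n.+1 - L <= i <= n)%N -> acoef i <= acoef_cst1 * T `^ (- b^-1).
  by move=> /andP[_ i_n]; rewrite IH.
have := conv_vcoef_split aD (mulr_ge0 D0 TV0) => H.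
have E1 : L%:R `^ (1 - b) <= (1 - b) / (2 * b) * (k / T).
  apply: (@le_trans _ _ (l `^ (1 - b))).
    by rewrite ge0_ler_powR ?nnegrE// ltW.
  rewrite /l powRM ?powR_ge0 ?(ltW c0)// /c -!powRrM !mulVf ?gt_eqF// !powRr1//.
    by rewrite divr_ge0// ltW.
  by rewrite divr_ge0 ?mulr_ge0// ltW.
have E2 : L.+1%:R `^ (- b) * \sum_(i < n.+1) acoef i <=
    l `^ (- b) * expR (1 - T * k `^ (- b)).
  apply: ler_pM; rewrite ?powR_ge0 ?sum_acoef_le//.
    by rewrite sumr_ge0// => i _; exact: acoef_ge0.
  rewrite !powRN lef_pV2 ?posrE ?powR_gt0 ?ltr0n//.
  by rewrite ge0_ler_powR ?nnegrE ?(ltW b_gt0)// ltW.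
(* Scaling leaves a surplus [(T * k ^ (- b)) ^ p]; the exponential supplied by [sum_acoef_le]
   absorbs it. *)
have E3 : T * b * (l `^ (- b) * expR (1 - T * k `^ (- b))) <= k * C0 * T `^ (- b^-1).
  have X0 : 0 <= T * k `^ (- b) by rewrite mulr_ge0 ?powR_ge0// ltW.
  have X1 := powR_le_expR p0 X0.
  have E : T * l `^ (- b) = k * c `^ (- b) * T `^ (- b^-1) * (T * k `^ (- b)) `^ p.
    (* Writing positive numbers as exponentials turns an identity between powers into a field
       identity between exponents. *)
    have [t tE] := expR_total T_gt0; have [u uE] := expR_total k0.
    have [v vE] := expR_total c0.
    rewrite /l -tE -uE -vE -expRB -!expRM -!expRD -!expRM -!expRD.
    by congr expR; rewrite /p; field; rewrite !gt_eqF.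
  rewrite expRD mulrACA E.
  set A := k * c `^ (- b) * T `^ (- b^-1).
  rewrite [leLHS](_ : _ = A * b * expR 1 * ((T * k `^ (- b)) `^ p * (expR (T * k `^ (- b)))^-1)); last first.
    by rewrite -expRN /A; ring.
  rewrite [leRHS](_ : _ = A * b * expR 1 * p `^ p); last by rewrite /A /C0; ring.
  apply: ler_wpM2l; last by rewrite ler_pdivrMr ?expR_gt0.
  have A0 : 0 <= A by do 2?[apply: mulr_ge0]; [exact: ltW|exact: powR_ge0|].
  by apply: mulr_ge0 (expR_ge0 _); apply: mulr_ge0 (ltW b_gt0).
have E4 : k * acoef n.+1 <= k * (acoef_cst1 * T `^ (- b^-1)).
  rewrite acoefS.
  have Tb : 0 <= T * b by rewrite mulr_ge0// ltW.
  apply: le_trans (ler_wpM2l Tb H) _; rewrite mulrDr.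
  set N := T `^ (- b^-1) in TV0 E3 *; set S := _ * \sum_(i < _) _ in E2 *.
  have E5 : T * b * (acoef_cst1 * N * (L%:R `^ (1 - b) / (1 - b))) <=
      k * (acoef_cst1 * N) / 2.
    rewrite [leRHS](_ : _ = T * b * (acoef_cst1 * N *
        ((1 - b) / (2 * b) * (k / T) / (1 - b)))); last first.
      by field; rewrite !gt_eqF.
    by rewrite ler_wpM2l// ler_wpM2l ?mulr_ge0// ler_wpM2r// invr_ge0 ltW.
  have E6 := le_trans (ler_wpM2l Tb E2) E3.
  apply: le_trans (lerD E5 E6) _.
  have bb : 0 <= b^-1 `^ b^-1 * N by rewrite mulr_ge0 ?powR_ge0.
  have kbb : 0 <= k * (b^-1 `^ b^-1 * N) by rewrite mulr_ge0// ltW.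
  by rewrite /acoef_cst1; lra.
by rewrite ler_pM2l in E4.
Qed.

(* If [T k ^ (- b) >= x0] the claim follows from [acoef_le1]; below [x0], splitting the convolution at [k / 2]
   costs at most half of the claimed bound. *)
Let x0 : R := (1 - b) / (b * 2 `^ (2 + b)).
Definition acoef_cst2 : R :=
  acoef_cst1 * x0 `^ (- (b^-1 + 1)) + 2 * b * 2 `^ b * expR 1.

Lemma acoef_le2 n : acoef n.+1 <= acoef_cst2 * (T * n.+1%:R `^ (- b - 1)).
Proof.
have b1 : 0 < 1 - b by rewrite subr_gt0.
have x00 : 0 < x0 by rewrite divr_gt0// mulr_gt0// powR_gt0.
have D1 : 0 <= acoef_cst1.
  by rewrite -(pmulr_lge0 _ (powR_gt0 (- b^-1) T_gt0)) (le_trans _ (acoef_le1 0)) ?acoef_ge0.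
have D2 : 0 <= acoef_cst2.
  by rewrite /acoef_cst2 addr_ge0 ?mulr_ge0 ?powR_ge0 ?expR_ge0// ltW.
elim/ltn_ind: n => n IH.
have k0 : 0 < n.+1%:R :> R by rewrite ltr0n.
set k : R := n.+1%:R in k0 *.
have Tk : 0 <= T * k `^ (- b - 1) by rewrite mulr_ge0 ?powR_ge0// ltW.
have [x0X|Xx0] := leP x0 (T * k `^ (- b)).
  apply: (le_trans (acoef_le1 _)).
  (* The bound of [acoef_le1] is the claimed one times a negative power of [T * k ^ (- b)], which is
     controlled because [T * k ^ (- b) >= x0]. *)
  have -> : T `^ (- b^-1) = T * k `^ (- b - 1) * (T * k `^ (- b)) `^ (- (b^-1 + 1)).
    have [t tE] := expR_total T_gt0; have [u uE] := expR_total k0.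
    rewrite -tE -uE -!expRM -!expRD -!expRM -!expRD.
    by congr expR; field; rewrite gt_eqF.
  rewrite [leLHS](_ : _ = acoef_cst1 * (T * k `^ (- b)) `^ (- (b^-1 + 1)) *
     (T * k `^ (- b - 1))); last by ring.
  rewrite ler_wpM2r// /acoef_cst2 -[leLHS]addr0 lerD ?mulr_ge0 ?powR_ge0 ?expR_ge0 ?(ltW b_gt0)//.
  set X := T * k `^ (- b) in x0X *.
  rewrite ler_wpM2l// !powRN lef_pV2 ?posrE ?powR_gt0 ?(lt_le_trans x00)//.
  have bV : 0 < b^-1 by rewrite invr_gt0.
  have X0 := le_trans (ltW x00) x0X.
  by apply: ge0_ler_powR; rewrite ?nnegrE ?addr_ge0 ?(ltW x00) ?(ltW bV).
(* Coefficients of index at least [k / 2] obey the induction hypothesis up to the factor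
   [2 ^ (b + 1)] contained in [D]; for the remaining terms it is enough that all the coefficients
   sum to at most [exp 1]. *)
pose L := n.+1./2.
pose D := acoef_cst2 * (T * (k / 2) `^ (- b - 1)).
have k20 : 0 < k / 2 by rewrite divr_gt0.
have D0 : 0 <= D by rewrite /D !mulr_ge0 ?powR_ge0// ltW.
have L1 : L%:R <= k / 2.
  by rewrite ler_pdivlMr// -natrM ler_nat muln2 /L -[leqRHS]odd_double_half leq_addl.
have L2 : k / 2 <= L.+1%:R.
  rewrite ler_pdivrMr// -natrM ler_nat muln2 /L -[leqLHS]odd_double_half doubleS.
  by rewrite -[leqRHS]add2n leq_add2r (leq_trans (leq_b1 _)).
have aD i : (n.+1 - L <= i <= n)%N -> acoef i <= D.
  move=> /andP[Li i_n].
  have ki : k / 2 <= i%:R.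
    have : k - L%:R <= i%:R.
      by rewrite lerBlDr /k -natrD ler_nat addnC -leq_subLR.
    by lra.
  (* The induction hypothesis speaks of successors only; index 0 is excluded by [k / 2 <= i]. *)
  case: i Li i_n ki => [|i] Li i_n ki; first by rewrite leNgt k20 in ki.
  apply: (le_trans (IH _ i_n)); rewrite /D ler_wpM2l// ler_wpM2l ?(ltW T_gt0)//.
  rewrite -opprD !powRN lef_pV2 ?posrE ?powR_gt0//.
  by rewrite ge0_ler_powR ?nnegrE ?addr_ge0 ?(ltW b_gt0) ?(ltW k20).
have H := conv_vcoef_split aD D0.
have E1 : L%:R `^ (1 - b) <= k `^ (1 - b).
  by rewrite ge0_ler_powR ?nnegrE ?(ltW b1) ?(ltW k0)// (le_trans L1)// ler_pdivrMr// ler_peMr ?ler1n// ltW.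
have E2 : L.+1%:R `^ (- b) * \sum_(i < n.+1) acoef i <= (k / 2) `^ (- b) * expR 1.
  apply: ler_pM; rewrite ?powR_ge0//.
  - by rewrite sumr_ge0// => i _; exact: acoef_ge0.
  - rewrite !powRN lef_pV2 ?posrE ?powR_gt0 ?ltr0n//.
    by rewrite ge0_ler_powR ?nnegrE ?(ltW b_gt0) ?(ltW k20).
  - apply: le_trans (sum_acoef_le n) _; rewrite ler_expR gerBl.
    by rewrite mulr_ge0 ?powR_ge0// ltW.
have Tb : 0 <= T * b by rewrite mulr_ge0// ltW.
have E3 : T * b * (D * (L%:R `^ (1 - b) / (1 - b))) <=
    k * (acoef_cst2 * (T * k `^ (- b - 1))) / 2.
  apply: (@le_trans _ _ (T * b * (D * (k `^ (1 - b) / (1 - b))))).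
    by rewrite ler_wpM2l// ler_wpM2l// ler_wpM2r// invr_ge0 ltW.
  (* The definition of [x0] is read off here: one factor 2 of [2 ^ (2 + b)] comes from asking for
     half of the bound, the others from [k / 2] in [D]. *)
  have -> : T * b * (D * (k `^ (1 - b) / (1 - b))) =
      k * (acoef_cst2 * (T * k `^ (- b - 1))) / 2 * ((T * k `^ (- b)) / x0).
    rewrite /D /x0.
    have [t tE] := expR_total T_gt0; have [u uE] := expR_total k0.
    have [w wE] := @expR_total R 2 ltac:(by []).
    rewrite -[in k / 2]wE -[in 2 `^ _]wE -tE -uE -!expRB -!expRM.
    have -> : expR ((u - w) * (- b - 1)) = 2 / 2 * expR (u * (- b - 1)) * expR (w * (2 + b)) / expR w.
      rewrite divff// mul1r -expRD -expRB; congr expR; ring.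
    rewrite [in RHS](_ : expR u = expR (u * (1 - b)) * expR (u * b)); last first.
      by rewrite -expRD; congr expR; ring.
    have -> : u * - b = - (u * b) by ring.
    rewrite expRN wE; field.
    by rewrite !gt_eqF ?expR_gt0.
  rewrite ler_piMr// ?ler_pdivrMr// ?mul1r; last exact: ltW.
  by apply: divr_ge0 => //; apply: mulr_ge0; [exact: ltW|exact: mulr_ge0].
have E4 : T * b * ((k / 2) `^ (- b) * expR 1) <=
    k * (acoef_cst2 * (T * k `^ (- b - 1))) / 2.
  have -> : T * b * ((k / 2) `^ (- b) * expR 1) =
      k * ((2 * b * 2 `^ b * expR 1) * (T * k `^ (- b - 1))) / 2.
    have [u uE] := expR_total k0.
    have [w wE] := @expR_total R 2 ltac:(by []).
    rewrite -[in k / 2]wE -[in 2 `^ _]wE -uE -!expRB -!expRM.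
    have -> : expR ((u - w) * - b) = expR (u * (- b - 1)) * expR (w * b) * expR u.
      by rewrite -!expRD; congr expR; ring.
    by field.
  rewrite ler_wpM2r// ler_wpM2l ?(ltW k0)// ler_wpM2r//.
  by rewrite /acoef_cst2 lerDr mulr_ge0 ?powR_ge0.
have E5 : k * acoef n.+1 <= k * (acoef_cst2 * (T * k `^ (- b - 1))).
  rewrite acoefS; apply: le_trans (ler_wpM2l Tb H) _; rewrite mulrDr.
  apply: le_trans (lerD E3 (le_trans (ler_wpM2l Tb E2) E4)) _.
  by rewrite -splitr.
by rewrite ler_pM2l in E5.
Qed.

End stable_coefficients.

Lemma stable_generating_function {R : realType} (b : R) : 0 < b < 1 ->
  exists C : R, 0 <= C /\ forall T : R, 0 < T -> exists a : nat -> R,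
    [/\ forall k, 0 <= a k, a 0%N = expR (- T),
      forall y : R, 0 <= y < 1 -> pseries a y @ \oo --> expR (- (T * (1 - y) `^ b)),
      forall k, a k <= C * T `^ (- b^-1) &
      forall k, a k.+1 <= C * (T * k.+1%:R `^ (- b - 1))].
Proof.
move=> /andP[b0 b1].
(* Absolute values give one nonnegative constant, depending on [b] alone and thus uniform in [T]. *)
exists (`|acoef_cst1 b| + `|acoef_cst2 b|); split; first by rewrite addr_ge0.
move=> T T0; exists (acoef b T); split=> //.
- exact: acoef_ge0.
- exact: cvg_pseries_acoef.
- move=> k; apply: (le_trans (acoef_le1 b0 b1 T0 k)).
  by rewrite ler_wpM2r ?powR_ge0// (le_trans (ler_norm _))// lerDl.
- move=> k; apply: (le_trans (acoef_le2 b0 b1 T0 k)).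
  rewrite ler_wpM2r ?mulr_ge0 ?powR_ge0 ?(ltW T0)//.
  by rewrite (le_trans (ler_norm _))// lerDr.
Qed.

(** * Gaussian integrals on the line *)

Section real_dominated.
Context d (T : measurableType d) (R : realType).
Variables (mu : {measure set T -> \bar R}) (D : set T).
Hypothesis mD : measurable D.
Implicit Types f g : T -> R.

Lemma dominated_integrableR f g : measurable_fun D f ->
  (forall x, D x -> `|f x| <= g x) -> mu.-integrable D (EFin \o g) ->
  mu.-integrable D (EFin \o f).
Proof.
move=> mf fg; apply: le_integrable => //; first exact/measurable_EFinP.
by move=> x Dx /=; rewrite lee_fin (le_trans (fg _ Dx))// ler_norm.
Qed.

Lemma dominated_cvgR (f_ : nat -> T -> R) f g :
  (forall n, measurable_fun D (f_ n)) ->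
  (forall x, D x -> f_ n x @[n --> \oo] --> f x) ->
  mu.-integrable D (EFin \o g) ->
  (forall n x, D x -> `|f_ n x| <= g x) ->
  mu.-integrable D (EFin \o f) /\
  \int[mu]_(x in D) f_ n x @[n --> \oo] --> \int[mu]_(x in D) f x.
Proof.
move=> mf_ f_f ig fg.
have mf : measurable_fun D f by exact: measurable_fun_cvg f_f.
have H := @dominated_convergence _ _ _ mu D mD (fun n => EFin \o f_ n) (EFin \o f) (EFin \o g).
have [|||||i1 _ i2] := H => //.
- by move=> n; exact/measurable_EFinP.
- exact/measurable_EFinP.
- apply: aeW => x Dx; apply: cvg_EFin; first exact: nearW.
  exact: f_f.
- by apply: aeW => x n Dx /=; rewrite lee_fin fg.
split => //; rewrite /Rintegral; apply: fine_cvg; rewrite fineK//.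
exact: integrable_fin_num.
Qed.

Lemma integrable_lin f g (a b : R) :
  mu.-integrable D (EFin \o f) -> mu.-integrable D (EFin \o g) ->
  mu.-integrable D (EFin \o (fun x => a * f x + b * g x)).
Proof.
move=> fi gi.
rewrite (_ : _ \o _ = ((fun x => a%:E * (EFin \o f) x) \+ (fun x => b%:E * (EFin \o g) x))%E).
  by apply: integrableD => //; exact: integrableZl.
by apply/funext => x; rewrite /= EFinD !EFinM.
Qed.

Lemma Rintegral_lin f g (a b : R) :
  mu.-integrable D (EFin \o f) -> mu.-integrable D (EFin \o g) ->
  \int[mu]_(x in D) (a * f x + b * g x) =
  a * (\int[mu]_(x in D) f x) + b * (\int[mu]_(x in D) g x).
Proof.
move=> fi gi; rewrite -!RintegralZl// RintegralD//.
- rewrite (_ : _ \o _ = (fun x => a%:E * (EFin \o f) x)%E); first exact: integrableZl.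
  by apply/funext => x; rewrite /= EFinM.
- rewrite (_ : _ \o _ = (fun x => b%:E * (EFin \o g) x)%E); first exact: integrableZl.
  by apply/funext => x; rewrite /= EFinM.
Qed.

End real_dominated.

Section gaussian1.
Context {R : realType}.
Notation mu := (@lebesgue_measure R).

(** The fundamental theorem on [[-n, n]] gives boundary terms that vanish, and integrability of [f]
    lets the truncated integrals converge. *)
Lemma Rintegral_derivative0 (F f : R -> R) :
  (forall x : R, is_derive x 1 F (f x)) -> continuous f ->
  mu.-integrable setT (EFin \o f) ->
  F n%:R @[n --> \oo] --> 0 -> F (- n%:R) @[n --> \oo] --> 0 ->
  \int[mu]_x f x = 0.
Proof.
move=> dF cf intf Fy FNy.
pose I n := `[(- n%:R), n%:R]%classic : set R.
pose f_ n := f \_ (I n).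
have mf : measurable_fun [set: measurableTypeR R] f by exact: continuous_measurable_fun.
have mf_ n : measurable_fun [set: measurableTypeR R] (f_ n).
  apply/(measurable_restrictT f); first exact: measurable_itv.
  exact: measurable_funTS.
have f_f x : setT x -> f_ n x @[n --> \oo] --> f x.
  move=> _; apply: cvg_near_cst; near=> n.
  rewrite /f_ patchE mem_set// /I/= in_itv/= -ler_norml.
  by near: n; exact: nbhs_infty_ger.
have fle n x : setT x -> `|f_ n x| <= `|f x|.
  by move=> _; rewrite /f_ patchE; case: ifPn => //; rewrite normr0.
have [_ H] := dominated_cvgR measurableT mf_ f_f (integrable_abse intf) fle.
(* The index is shifted because [continuous_FTC2] needs a nondegenerate interval. *)
have E n : \int[mu]_x f_ n.+1 x = F n.+1%:R - F (- n.+1%:R).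
  rewrite /f_ -Rintegral_mkcond /Rintegral (@continuous_FTC2 _ f F) => //.
  - by rewrite (@lt_trans _ _ 0)// ?oppr_lt0 ltr0n.
  - exact: continuous_subspaceT.
  - have cF x : {for x, continuous F}.
      by apply/differentiable_continuous/derivable1_diffP; have [] := dF x.
    split; first by move=> x _; have [] := dF x.
      exact/cvg_at_right_filter/cF.
    exact/cvg_at_left_filter/cF.
  - by move=> x _; rewrite derive1E; have [_ ] := dF x.
suff H' : \int[mu]_x f_ n x @[n --> \oo] --> 0 by exact: (cvg_unique _ H H').
rewrite -cvg_shiftS.
have A1 : F n.+1%:R @[n --> \oo] --> 0 by rewrite (cvg_shiftS (fun n => F n%:R)).
have A2 : F (- n.+1%:R) @[n --> \oo] --> 0 by rewrite (cvg_shiftS (fun n => F (- n%:R))).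
have A3 : F n.+1%:R - F (- n.+1%:R) @[n --> \oo] --> 0 - 0 by apply: cvgB.
rewrite subr0 in A3; under eq_fun do rewrite E.
exact: A3.
Unshelve. all: by end_near. Qed.

Lemma gauss_peak (s : R) : 0 < s ->
  mu.-integrable setT (fun x => (expR (- (s * x ^+ 2)))%:E) /\
  \int[mu]_x expR (- (s * x ^+ 2)) = Num.sqrt (pi / s).
Proof.
move=> s0.
(* Up to normalization the Gaussian is the normal density with this standard deviation, whose mass
   is 1. *)
pose r := Num.sqrt (2 * s)^-1.
have r0 : r != 0 by rewrite gt_eqF// sqrtr_gt0 invr_gt0 mulr_gt0.
have rE : r ^+ 2 = (2 * s)^-1 by rewrite sqr_sqrtr// invr_ge0 mulr_ge0// ltW.
have peak0 : normal_peak r != 0 by rewrite gt_eqF// normal_peak_gt0.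
have E x : expR (- (s * x ^+ 2)) = (normal_peak r)^-1 * normal_pdf 0 r x.
  rewrite /normal_pdf (negbTE r0) mulKf// /normal_fun subr0 rE; congr expR.
  by field; rewrite gt_eqF.
have i1 := integrable_normal_pdf 0 r.
split.
  rewrite (_ : (fun _ => _) = (fun x => (normal_peak r)^-1%:E * (normal_pdf 0 r x)%:E)%E).
    exact: integrableZl.
  by apply/funext => x; rewrite -EFinM E.
under eq_Rintegral do rewrite E.
rewrite RintegralZl// /Rintegral integral_normal_pdf mulr1.
rewrite /normal_peak invrK rE; congr Num.sqrt.
by field; rewrite gt_eqF.
Qed.

Lemma integrable_gauss (s : R) : 0 < s ->
  mu.-integrable setT (EFin \o (fun x => expR (- (s * x ^+ 2)))).
Proof. by move=> /gauss_peak[]. Qed.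

Lemma continuous_gauss (s : R) : continuous (fun x : R => expR (- (s * x ^+ 2))).
Proof.
move=> x; apply: continuous_comp; last exact: continuous_expR.
by apply: cvgN; apply: cvgMr; exact: exprn_continuous.
Qed.

(** Half of the exponent absorbs [|x| <= 1 + x ^ 2], the other half remains as an integrable
    majorant. *)
Lemma integrable_norm_gauss (s : R) : 0 < s ->
  mu.-integrable setT (EFin \o (fun x => `|x| * expR (- (s * x ^+ 2)))).
Proof.
move=> s0.
have s20 : 0 < s / 2 by rewrite divr_gt0.
apply: (@dominated_integrableR _ _ _ mu setT measurableT _
    (fun x => (1 + 2 / s) * expR (- (s / 2 * x ^+ 2)))).
- apply: measurable_funM.
    exact: normr_measurable.
  by apply: continuous_measurable_fun; exact: continuous_gauss.
- move=> x _; rewrite ger0_norm ?mulr_ge0 ?expR_ge0//.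
  have E : expR (- (s * x ^+ 2)) = expR (- (s / 2 * x ^+ 2)) * expR (- (s / 2 * x ^+ 2)).
    by rewrite -expRD; congr expR; field.
  rewrite E mulrA ler_wpM2r ?expR_ge0// expRN ler_pdivrMr ?expR_gt0//.
  set u := s / 2 * x ^+ 2.
  have u0 : 0 <= u by rewrite /u mulr_ge0 ?sqr_ge0// ltW.
  have x2 : x ^+ 2 = 2 / s * u by rewrite /u; field; rewrite gt_eqF.
  have xle : `|x| <= 1 + x ^+ 2.
    by rewrite -real_normK ?num_real//; have := normr_ge0 x; nra.
  have e1 : 1 + u <= expR u by exact: expR_ge1Dx.
  have si : 0 < 2 / s by rewrite divr_gt0.
  apply: (le_trans xle); rewrite x2; nra.
- rewrite (_ : _ \o _ = fun x => ((1 + 2 / s)%:E * (expR (- (s / 2 * x ^+ 2)))%:E)%E); last first.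
    by apply/funext => x; rewrite /= EFinM.
  by apply: integrableZl => //; exact: integrable_gauss.
Qed.

Lemma cvg_gauss_nat (s : R) : 0 < s -> expR (- (s * n%:R ^+ 2)) @[n --> \oo] --> 0.
Proof.
move=> s0.
rewrite -cvg_shiftS.
apply: (@squeeze_cvgr _ _ _ _ (cst 0) (fun n => s^-1 * n.+1%:R^-1)).
- apply: nearW => n; rewrite expR_ge0/= expRN -invfM lef_pV2 ?posrE ?expR_gt0//; last first.
    by rewrite mulr_gt0.
  apply: le_trans (expR_ge1Dx _).
  have n1 : 1 <= n.+1%:R :> R by rewrite ler1n.
  have : s * n.+1%:R <= s * n.+1%:R ^+ 2.
    by rewrite ler_wpM2l ?(ltW s0)// expr2 ler_peMr.
  by move: (s * _) => u; lra.
- exact: cvg_cst.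
- by rewrite -[X in _ --> X](mulr0 s^-1); apply: cvgMr; exact: cvg_harmonic.
Qed.

(** The phase [phi] treats cosine and sine transforms together, and in higher dimension it carries
    the contribution of a coordinate that is held fixed. *)
Definition cgauss (s phi b : R) : R :=
  \int[mu]_x (cos (b * x + phi) * expR (- (s * x ^+ 2))).

Lemma continuous_cos_affine (b phi : R) : continuous (fun x : R => cos (b * x + phi)).
Proof.
move=> x; apply: continuous_comp; last exact: continuous_cos.
by apply: cvgD; [apply: cvgMr|exact: cvg_cst].
Qed.

Lemma integrable_cgauss (s phi b : R) : 0 < s ->
  mu.-integrable setT (EFin \o (fun x => cos (b * x + phi) * expR (- (s * x ^+ 2)))).
Proof.
move=> s0.
apply: (@dominated_integrableR _ _ _ mu setT measurableT _ _ _ _ (integrable_gauss s0)).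
  apply: continuous_measurable_fun => x.
  by apply: cvgM; [exact: continuous_cos_affine|exact: continuous_gauss].
move=> x _; rewrite normrM (ger0_norm (expR_ge0 _)) ler_piMl ?expR_ge0//.
exact: cos_max.
Qed.

(** Differentiation under the integral produces a sine integral with an extra factor [x];
    integration by parts turns it back into a multiple of [cgauss]. *)
Lemma is_derive_cgauss (s phi b : R) : 0 < s ->
  is_derive b 1 (cgauss s phi) (- (b / (2 * s)) * cgauss s phi b).
Proof.
move=> s0.
pose f (c x : R) := cos (c * x + phi) * expR (- (s * x ^+ 2)).
have df (x c : R) : is_derive c 1 (f ^~ x)
    (- (x * sin (c * x + phi)) * expR (- (s * x ^+ 2))).
  rewrite /f; apply: is_derive_eq; rewrite /GRing.scale/=; ring.
have cs c : continuous (fun x : R => sin (c * x + phi)).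
  move=> x; apply: continuous_comp; last exact: continuous_sin.
  by apply: cvgD; [apply: cvgMr|exact: cvg_cst].
have cc c := @continuous_cos_affine c phi.
have ce := @continuous_gauss s.
have intf c : mu.-integrable setT (EFin \o f c) by exact: integrable_cgauss.
pose g (c x : R) := x * sin (c * x + phi) * expR (- (s * x ^+ 2)).
have cg c : continuous (g c).
  move=> x; apply: cvgM; last exact: ce.
  by apply: cvgM; [exact: cvg_id|exact: cs].
have gle c x : `|g c x| <= `|x| * expR (- (s * x ^+ 2)).
  rewrite /g !normrM (ger0_norm (expR_ge0 _)) ler_wpM2r ?expR_ge0// ler_piMr//.
  exact: sin_max.
have intg c : mu.-integrable setT (EFin \o g c).
  apply: (@dominated_integrableR _ _ _ mu setT measurableT _ _ _ _ (integrable_norm_gauss s0)).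
    exact: continuous_measurable_fun.
  by move=> x _; exact: gle.
(* Integration by parts, as the derivative of sin (b x + phi) exp (- s x^2). *)
have ibp : \int[mu]_x (b * f b x + - (2 * s) * g b x) = 0.
  apply: (@Rintegral_derivative0 (fun x => sin (b * x + phi) * expR (- (s * x ^+ 2)))).
  - move=> x; rewrite /f /g; apply: is_derive_eq; rewrite /GRing.scale/=; ring.
  - move=> x; apply: cvgD; apply: cvgMr; last exact: cg.
    by apply: cvgM; [exact: cc|exact: ce].
  - exact: integrable_lin.
  - apply: (@squeeze_cvgr _ _ _ _ (fun n => - expR (- (s * n%:R ^+ 2)))
        (fun n => expR (- (s * n%:R ^+ 2)))); last exact: cvg_gauss_nat.
      apply: nearW => n; rewrite -ler_norml normrM (ger0_norm (expR_ge0 _)).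
      by rewrite ler_piMl ?expR_ge0// sin_max.
    by rewrite -oppr0; apply: cvgN; exact: cvg_gauss_nat.
  - apply: (@squeeze_cvgr _ _ _ _ (fun n => - expR (- (s * n%:R ^+ 2)))
        (fun n => expR (- (s * n%:R ^+ 2)))); last exact: cvg_gauss_nat.
      apply: nearW => n; rewrite sqrrN -ler_norml normrM (ger0_norm (expR_ge0 _)).
      by rewrite ler_piMl ?expR_ge0// sin_max.
    by rewrite -oppr0; apply: cvgN; exact: cvg_gauss_nat.
have ibp' : b * cgauss s phi b = 2 * s * \int[mu]_x g b x.
  apply/eqP; rewrite -subr_eq0 -ibp.
  by rewrite Rintegral_lin// mulNr.
have bI : `]b - 1, b + 1[%classic b.
  by rewrite /= in_itv/=; apply/andP; split; lra.
have g0 (x : R) : 0 <= `|x| * expR (- (s * x ^+ 2)) by rewrite mulr_ge0 ?expR_ge0.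
have df1 c x : `]b - 1, b + 1[%classic c -> setT x -> derivable (f ^~ x) c 1.
  by move=> _ _; have [] := df x c.
have d1E c x : partial1of2 f c x = - g c x.
  by rewrite partial1of2E; have [_ ->] := df x c; rewrite /g mulNr.
have d1le c x : `]b - 1, b + 1[%classic c -> setT x ->
    `|partial1of2 f c x| <= `|x| * expR (- (s * x ^+ 2)).
  by move=> _ _; rewrite d1E normrN.
have intf' c : `]b - 1, b + 1[%classic c -> mu.-integrable setT (EFin \o f c).
  by move=> _; exact: intf.
have D1 := differentiation_under_integral measurableT bI intf' df1 g0
  (integrable_norm_gauss s0) d1le.
have D2 := derivable_under_integral measurableT bI intf' df1 g0
  (integrable_norm_gauss s0) d1le.
apply: DeriveDef; first exact: D2.
rewrite -derive1E /cgauss [LHS]D1.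
under eq_Rintegral do rewrite d1E.
rewrite (_ : (fun x => - g b x) = (fun x => -1 * g b x)); last first.
  by apply/funext => x; rewrite mulN1r.
rewrite RintegralZl// mulN1r mulNr; congr (- _).
apply: (@mulfI _ (2 * s)); first by rewrite gt_eqF// mulr_gt0.
apply: etrans (esym ibp') _; rewrite -/(cgauss s phi b); field.
by rewrite gt_eqF.
Qed.

Lemma cgaussE (s phi b : R) : 0 < s ->
  cgauss s phi b = cos phi * Num.sqrt (pi / s) * expR (- (b ^+ 2 / (4 * s))).
Proof.
move=> s0.
(* [linear_ode] integrates upwards from 0 only; since cosine is even, [b] and [phi] may change sign
   together. *)
wlog b0 : b phi / 0 <= b.
  move=> H; have [b0|b0] := leP 0 b; first exact: H.
  have := H (- b) (- phi); rewrite cosN sqrrN oppr_ge0 => <-; last exact: ltW.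
  by apply: eq_Rintegral => x _; rewrite mulNr -opprD cosN.
have dF c : c \in `[0, b]%R ->
    is_derive c 1 (cgauss s phi) (- (c / (2 * s)) * cgauss s phi c).
  by move=> _; exact: is_derive_cgauss.
have dG c : c \in `[0, b]%R ->
    is_derive c 1 (fun b => - (b ^+ 2 / (4 * s))) (- (c / (2 * s))).
  by move=> _; apply: is_derive_eq; rewrite /GRing.scale/=; field; rewrite gt_eqF.
rewrite (linear_ode b0 dF dG) /cgauss; under eq_Rintegral do rewrite mul0r add0r.
rewrite RintegralZl//; last exact: integrable_gauss.
have [_ ->] := gauss_peak s0.
by rewrite expr0n/= mul0r oppr0 subr0.
Qed.

End gaussian1.

(** * Gaussians on Euclidean space *)

Section gaussian_rV.
Context {R : realType}.
Notation leb := (@lebesgue_measure R).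
Notation mu n := (@lebesgue_rV R n).

(** The measure in dimension [n + 1] is by construction the image of a product, so this is a change
    of variables followed by Tonelli. It drives the inductions on the dimension. *)
Lemma ge0_integral_rVS n (f : 'rV[R]_n.+1 -> \bar R) :
  measurable_fun setT f -> (forall x, 0 <= f x)%E ->
  (\int[mu n.+1]_x f x = \int[leb]_a \int[mu n]_v f (rV_cons (a, v)))%E.
Proof.
move=> mf f0.
transitivity (\int[leb \x mu n]_p f (rV_cons p))%E.
  rewrite -[in RHS](preimage_setT (@rV_cons R n)).
  rewrite -(@ge0_integral_pushforward _ _ _ _ R _ (@measurable_rV_cons R n) _ setT)//.
rewrite fubini_tonelli1//.
by apply: measurableT_comp => //; exact: measurable_rV_cons.
Qed.

Lemma integral_rVS n (f : 'rV[R]_n.+1 -> \bar R) :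
  (mu n.+1).-integrable setT f ->
  (\int[mu n.+1]_x f x = \int[leb]_a \int[mu n]_v f (rV_cons (a, v)))%E.
Proof.
move=> /integrableP[mf f0].
have H : (leb \x mu n)%E.-integrable setT (f \o @rV_cons R n).
  apply/integrableP; split.
    by apply: measurableT_comp => //; exact: measurable_rV_cons.
  apply: le_lt_trans f0; rewrite le_eqVlt; apply/orP; left; apply/eqP.
  rewrite -[in LHS](preimage_setT (@rV_cons R n)).
  rewrite -(@ge0_integral_pushforward _ _ _ _ R _ (@measurable_rV_cons R n) _ setT (fun x => `|f x|)%E)//.
  exact: measurableT_comp.
transitivity (\int[leb \x mu n]_p f (rV_cons p))%E; last first.
  by rewrite -integral12_prod_meas1.
rewrite -[in RHS](preimage_setT (@rV_cons R n)).
by rewrite -(@integral_pushforward _ _ _ _ R _ (@measurable_rV_cons R n) _ setT f).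
Qed.

Lemma measurable_dotr n (x : 'rV[R]_n) : measurable_fun setT (dot x).
Proof.
apply: measurable_sum => i; apply: measurable_funM => //.
exact: measurable_rV_coord.
Qed.

Lemma measurable_dotxx n : measurable_fun setT (fun x : 'rV[R]_n => dot x x).
Proof.
by apply: measurable_sum => i; apply: measurable_funM; exact: measurable_rV_coord.
Qed.

Lemma dot_ge0 n (x : 'rV[R]_n) : 0 <= dot x x.
Proof. by apply: sumr_ge0 => i _; rewrite -expr2 sqr_ge0. Qed.

Lemma dot_cons n (x : 'rV[R]_n.+1) a v :
  dot x (rV_cons (a, v)) = x ord0 ord0 * a + dot (rV_uncons x).2 v.
Proof.
rewrite /dot big_ord_recl rV_cons0; congr (_ + _).
by apply: eq_bigr => i _; rewrite rV_consS mxE.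
Qed.

Lemma rV_unconsK n : cancel (@rV_uncons R n) (@rV_cons R n).
Proof.
move=> x; apply/rowP => i; rewrite /rV_uncons mxE.
by case: (unliftP ord0 i) => [j|] -> /=; rewrite ?liftK ?unlift_none/= ?mxE.
Qed.

Lemma dot_cons2 n a (v : 'rV[R]_n) :
  dot (rV_cons (a, v)) (rV_cons (a, v)) = a ^+ 2 + dot v v.
Proof. by rewrite dot_cons rV_cons0 rV_consK expr2. Qed.

Definition gaussr n (s : R) (x : 'rV[R]_n) : R := expR (- (s * dot x x)).

Lemma measurable_gaussr n s : measurable_fun setT (@gaussr n s).
Proof.
apply: (measurableT_comp (@measurable_expR R)).
apply: measurable_funN; apply: measurable_funM => //; exact: measurable_dotxx.
Qed.

Lemma gaussr_cons n s a (v : 'rV[R]_n) :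
  gaussr s (rV_cons (a, v)) = expR (- (s * a ^+ 2)) * gaussr s v.
Proof. by rewrite /gaussr dot_cons2 -expRD; congr expR; ring. Qed.

Lemma gaussr_ge0 n s (x : 'rV[R]_n) : 0 <= gaussr s x.
Proof. exact: expR_ge0. Qed.

Lemma integral_gaussr n s : 0 < s ->
  (\int[mu n]_x (gaussr s x)%:E = (Num.sqrt (pi / s) ^+ n)%:E)%E.
Proof.
move=> s0; elim: n => [|n IH].
  rewrite expr0 /= integral_dirac//; last first.
    by apply/measurable_EFinP; exact: measurable_gaussr.
  by rewrite diracE mem_set// mul1e /gaussr /dot big_ord0 mulr0 oppr0 expR0.
rewrite ge0_integral_rVS//; last 2 first.
- by apply/measurable_EFinP; exact: measurable_gaussr.
- by move=> x; rewrite lee_fin gaussr_ge0.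
transitivity (\int[leb]_a ((expR (- (s * a ^+ 2)))%:E * (Num.sqrt (pi / s) ^+ n)%:E))%E.
  apply: eq_integral => a _.
  under eq_integral do rewrite gaussr_cons EFinM.
  rewrite ge0_integralZl ?IH//.
  - by apply/measurable_EFinP; exact: measurable_gaussr.
  - by move=> v _; rewrite lee_fin gaussr_ge0.
have [i1 i2] := gauss_peak s0.
rewrite integralZr// exprS EFinM; congr (_ * _)%E.
by rewrite -i2 /Rintegral fineK// integrable_fin_num.
Qed.

Lemma integrable_gaussr n s : 0 < s -> (mu n).-integrable setT (EFin \o @gaussr n s).
Proof.
move=> s0; apply/integrableP; split.
  by apply/measurable_EFinP; exact: measurable_gaussr.
under eq_integral do rewrite gee0_abs ?lee_fin ?gaussr_ge0//.
by rewrite integral_gaussr// ltry.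
Qed.

Definition cgaussr n (s phi : R) (x xi : 'rV[R]_n) : R :=
  cos (dot x xi + phi) * gaussr s xi.

Lemma measurable_cgaussr n s phi (x : 'rV[R]_n) :
  measurable_fun setT (cgaussr s phi x).
Proof.
apply: measurable_funM; last exact: measurable_gaussr.
apply: (measurableT_comp (continuous_measurable_fun (@continuous_cos R))).
by apply: measurable_funD => //; exact: measurable_dotr.
Qed.

Lemma cgaussr_le n s phi (x xi : 'rV[R]_n) : `|cgaussr s phi x xi| <= gaussr s xi.
Proof.
rewrite normrM (ger0_norm (gaussr_ge0 _ _)) ler_piMl ?gaussr_ge0//.
exact: cos_max.
Qed.

Lemma integrable_cgaussr n s phi (x : 'rV[R]_n) : 0 < s ->
  (mu n).-integrable setT (EFin \o cgaussr s phi x).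
Proof.
move=> s0; apply: dominated_integrableR (integrable_gaussr n s0) => //.
  exact: measurable_cgaussr.
by move=> xi _; exact: cgaussr_le.
Qed.

(** Induction on the dimension, for all phases at once: with the first coordinate [a] fixed, [x_0 a]
    joins the phase, and the inner integral returns the factor [cos (phi + x_0 a)] to which
    [cgaussE] applies. *)
Lemma Rintegral_cgaussr n s phi (x : 'rV[R]_n) : 0 < s ->
  \int[mu n]_xi cgaussr s phi x xi =
  cos phi * Num.sqrt (pi / s) ^+ n * expR (- (dot x x / (4 * s))).
Proof.
move=> s0; elim: n x phi => [|n IH] x phi.
  rewrite /Rintegral /= integral_dirac//; last first.
    by apply/measurable_EFinP; exact: measurable_cgaussr.
  rewrite diracE mem_set// mul1e /= /cgaussr /gaussr /dot !big_ord0.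
  by rewrite add0r mulr0 mul0r oppr0 expR0 !mulr1.
rewrite /Rintegral integral_rVS; last exact: integrable_cgaussr.
pose C := Num.sqrt (pi / s) ^+ n * expR (- (dot (rV_uncons x).2 (rV_uncons x).2 / (4 * s))).
transitivity (fine (\int[leb]_a
   (C * (cos (x ord0 ord0 * a + phi) * expR (- (s * a ^+ 2))))%:E)%E).
  congr fine; apply: eq_integral => a _.
  transitivity (\int[mu n]_v ((expR (- (s * a ^+ 2)))%:E *
      (cgaussr s (phi + x ord0 ord0 * a) (rV_uncons x).2 v)%:E))%E.
    apply: eq_integral => v _; rewrite -EFinM /cgaussr gaussr_cons dot_cons.
    by congr EFin; rewrite [RHS]mulrCA; congr (cos _ * _); ring.
  rewrite integralZl//; last exact: integrable_cgaussr.
  have := IH (rV_uncons x).2 (phi + x ord0 ord0 * a); rewrite /Rintegral.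
  have := @integrable_fin_num _ _ _ _ _ measurableT _
    (integrable_cgaussr (phi + x ord0 ord0 * a) (rV_uncons x).2 s0).
  move=> /fineK H E; rewrite -[X in (_ * X)%E]H E -EFinM; congr EFin.
  by rewrite /C [x ord0 ord0 * a + _]addrC; ring.
have H := cgaussE phi (x ord0 ord0) s0; rewrite /cgauss /Rintegral in H.
under eq_integral do rewrite EFinM.
have ci := integrable_cgauss phi (x ord0 ord0) s0.
rewrite integralZl// fineM//; last exact: integrable_fin_num.
rewrite H /= /C [Num.sqrt _ ^+ n.+1]exprS.
have -> : dot x x = x ord0 ord0 ^+ 2 + dot (rV_uncons x).2 (rV_uncons x).2.
  by rewrite -{1 2}(rV_unconsK x) dot_cons2.
set y := (rV_uncons x).2; set x0 := x ord0 ord0.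
have -> : - ((x0 ^+ 2 + dot y y) / (4 * s)) = - (x0 ^+ 2 / (4 * s)) - dot y y / (4 * s).
  by field; rewrite gt_eqF.
rewrite expRD; ring.
Qed.

(* The heat kernel of R^n at time u, as a function of the squared norm r2. *)
Definition hker n (u r2 : R) : R := (Num.sqrt (4 * pi * u) ^+ n)^-1 * expR (- (r2 / (4 * u))).

Lemma hker_ge0 n u r2 : 0 <= hker n u r2.
Proof. by rewrite mulr_ge0 ?expR_ge0// invr_ge0 exprn_ge0// sqrtr_ge0. Qed.

Lemma hker_gaussr n u (x : 'rV[R]_n) :
  hker n u (dot x x) = (Num.sqrt (4 * pi * u) ^+ n)^-1 * gaussr (4 * u)^-1 x.
Proof. by rewrite /hker /gaussr; congr (_ * expR (- _)); rewrite mulrC. Qed.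

Lemma fourier_gaussr n u phi (x : 'rV[R]_n) : 0 < u ->
  (2 * pi) ^- n * (\int[mu n]_xi cgaussr u phi x xi) = cos phi * hker n u (dot x x).
Proof.
move=> u0; have p0 := @pi_gt0 R.
have S : (2 * pi) ^- n * Num.sqrt (pi / u) ^+ n = (Num.sqrt (4 * pi * u) ^+ n)^-1.
  rewrite -!exprVn -exprMn; congr (_ ^+ _).
  have E (a b : R) : 0 < a -> 0 < b -> a / b = (2 * a) ^+ 2 / (4 * a * b).
    by move=> a0 b0; field; rewrite !gt_eqF.
  rewrite (E pi u)//.
  rewrite sqrtrM ?sqr_ge0// sqrtr_sqr ger0_norm; last by rewrite mulr_ge0// ltW.
  rewrite mulKf ?gt_eqF// ?mulr_gt0// sqrtrV//.
  by rewrite mulr_ge0 ?(ltW u0)// mulr_ge0// ltW.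
rewrite Rintegral_cgaussr// /hker -S.
by move: ((2 * pi) ^- n) => c; ring.
Qed.

Lemma integral_hker n u : 0 < u ->
  (mu n).-integrable setT (EFin \o (fun x => hker n u (dot x x))) /\
  \int[mu n]_x hker n u (dot x x) = 1.
Proof.
move=> u0; have u4 : 0 < (4 * u)^-1 by rewrite invr_gt0 mulr_gt0.
pose c := (Num.sqrt (4 * pi * u) ^+ n)^-1.
have p0 := @pi_gt0 R.
have E x : hker n u (dot x x) = c * @gaussr n (4 * u)^-1 x by exact: hker_gaussr.
split.
  rewrite (_ : _ \o _ = fun x => (c%:E * (EFin \o @gaussr n (4 * u)^-1) x)%E).
    by apply: integrableZl => //; exact: integrable_gaussr.
  by apply/funext => x; rewrite /= E EFinM.
under eq_Rintegral do rewrite E.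
rewrite RintegralZl//; last exact: integrable_gaussr.
rewrite /Rintegral integral_gaussr//= /c invrK -exprVn -exprMn.
have -> : pi * (4 * u) = 4 * pi * u by ring.
by rewrite mulVf ?expr1n// gt_eqF// sqrtr_gt0 !mulr_gt0.
Qed.

Lemma measurable_dot_pair n :
  measurable_fun setT (fun p : 'rV[R]_n * 'rV[R]_n => dot p.1 p.2).
Proof.
apply: measurable_sum => i; apply: measurable_funM.
  by apply: (measurableT_comp (measurable_rV_coord i)).
by apply: (measurableT_comp (measurable_rV_coord i)).
Qed.

Lemma measurable_cos_transform n (psi : 'rV[R]_n -> R) phi :
  (forall x, 0 <= psi x) -> (mu n).-integrable setT (EFin \o psi) ->
  measurable_fun setT (fun x => \int[mu n]_xi (cos (dot x xi + phi) * psi xi)).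
Proof.
move=> psi0 ipsi.
have mpsi : measurable_fun setT psi by have /integrableP[/measurable_EFinP] := ipsi.
(* Adding 1 to the cosine makes the integrand nonnegative, so that Tonelli gives measurability in
   [x]; the added constant [\int psi] is subtracted again below. *)
pose f (p : 'rV[R]_n * 'rV[R]_n) := (((cos (dot p.1 p.2 + phi) + 1) * psi p.2)%:E)%E.
have mf : measurable_fun setT f.
  apply/measurable_EFinP; apply: measurable_funM; last exact: measurableT_comp.
  apply: measurable_funD => //.
  apply: (measurableT_comp (continuous_measurable_fun (@continuous_cos R))).
  by apply: measurable_funD => //; exact: measurable_dot_pair.
have f0 p : (0 <= f p)%E.
  by rewrite lee_fin mulr_ge0// -[1]opprK subr_ge0 cos_geN1.
have := measurable_fun_fubini_tonelli_F (m2 := mu n) f mf f0.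
rewrite /fubini_F => H.
have ic x : (mu n).-integrable setT (EFin \o (fun xi => cos (dot x xi + phi) * psi xi)).
  apply: (dominated_integrableR _ _ _ ipsi) => //.
    apply: measurable_funM => //.
    apply: (measurableT_comp (continuous_measurable_fun (@continuous_cos R))).
    by apply: measurable_funD => //; exact: measurable_dotr.
  by move=> xi _; rewrite normrM (ger0_norm (psi0 _)) ler_piMl// cos_max.
rewrite (_ : (fun x => _) = (fun x => fine (\int[mu n]_xi f (x, xi)) - \int[mu n]_xi psi xi)).
  apply: measurable_funB => //; apply: measurableT_comp => //.
apply/funext => x.
have -> : fine (\int[mu n]_xi f (x, xi)) =
    \int[mu n]_xi (1 * (cos (dot x xi + phi) * psi xi) + 1 * psi xi).
  by apply: eq_Rintegral => xi _; rewrite /f/=; ring.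
by rewrite Rintegral_lin// !mul1r addrK.
Qed.

End gaussian_rV.

(** * The heat kernel tested against Gaussians *)

Section test_functions.
Context {R : realType} {n : nat}.
Notation mu := (@lebesgue_rV R n).
Local Open Scope complex_scope.
Implicit Types (phi psi : 'rV[R]_n -> R).

Lemma gauss_bounded_Lfun phi (s C : R) : 0 < s -> measurable_fun setT phi ->
  (forall x, `|phi x| <= C * gaussr s x) ->
  phi \in Lfun mu 1%:E /\ phi \in Lfun mu 2%:E.
Proof.
move=> s0 mphi phile.
have C0 : 0 <= C.
  have := le_trans (normr_ge0 _) (phile 0).
  by rewrite pmulr_lge0// expR_gt0.
have iC (D r : R) : 0 < r -> mu.-integrable setT (EFin \o (fun x => D * @gaussr R n r x)).
  move=> r0; rewrite (_ : _ \o _ = (fun x => D%:E * (EFin \o @gaussr R n r) x)%E).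
    by apply: integrableZl => //; exact: integrable_gaussr.
  by apply/funext => x; rewrite /= EFinM.
split.
  apply/Lfun1_integrable; apply: dominated_integrableR (iC C s s0) => //.
rewrite inE; apply/andP; split; rewrite inE//=.
rewrite /finite_norm unlock /=; apply: poweR_lty.
have i2 : mu.-integrable setT (EFin \o (fun x => phi x ^+ 2)).
  apply: dominated_integrableR (iC (C ^+ 2) (2 * s) _) => //.
  - exact: measurable_funX.
  - move=> x _; rewrite normrX.
    apply: le_trans (_ : (C * gaussr s x) ^+ 2 <= _).
      by rewrite lerXn2r ?nnegrE ?mulr_ge0 ?expR_ge0.
    rewrite exprMn ler_wpM2l ?sqr_ge0// /gaussr expr2 -expRD ler_expR.
    by rewrite le_eqVlt; apply/orP; left; apply/eqP; ring.
  - by rewrite mulr_gt0.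
have /integrableP[_] := i2; apply: le_lt_trans.
rewrite le_eqVlt; apply/orP; left; apply/eqP; apply: eq_integral => x _.
by rewrite powR_mulrn//= normrX.
Qed.

Lemma cLfunR phi (s C : R) : 0 < s -> measurable_fun setT phi ->
  (forall x, `|phi x| <= C * gaussr s x) ->
  cLfun 1%:E (fun x => (phi x)%:C) /\ cLfun 2%:E (fun x => (phi x)%:C).
Proof.
move=> s0 mphi phile.
have [l1 l2] := gauss_bounded_Lfun s0 mphi phile.
have [z1 z2] : (fun _ : 'rV[R]_n => 0 : R) \in Lfun mu 1%:E /\
    (fun _ : 'rV[R]_n => 0 : R) \in Lfun mu 2%:E.
  apply: (@gauss_bounded_Lfun _ s 1) => // x.
  by rewrite normr0 mul1r expR_ge0.
by split; split.
Qed.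

(** The constant sequence [f] is a witness, so on the intersection of L1 and L2 the explicit formula
    may be used. *)
Lemma L2_extension_refl (F : ('rV[R]_n -> R[i]) -> 'rV[R]_n -> R[i]) f :
  cmeasurable f -> cmeasurable (F f) -> cLfun 1%:E f -> cLfun 2%:E f ->
  L2_extension F f (F f).
Proof.
move=> mf mF f1 f2.
have N0 h : cLnorm 2%:E (fun x : 'rV[R]_n => h x - h x) = 0%E.
  rewrite -(@Lnorm0 _ _ _ mu 2%:E) ?eqe//; congr Lnorm; apply/funext => x.
  by rewrite subrr /Normc.normc/= expr0n addr0 sqrtr0.
split => //; exists (fun=> f); split => //.
  by rewrite N0; exact: cvg_cst.
by rewrite N0; exact: cvg_cst.
Qed.

Lemma Re_cisM (a b : R) : complex.Re (cis a * b%:C) = cos (a + 0) * b.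
Proof. by rewrite /= mulr0 subr0 addr0. Qed.

(** The sine is written as a shifted cosine so that one lemma about cosine transforms serves both
    parts. *)
Lemma Im_cisM (a b : R) : complex.Im (cis a * b%:C) = cos (a - pi / 2) * b.
Proof.
by rewrite /= cosB cos_pihalf sin_pihalf !mulr0 mulr1 !add0r.
Qed.

Lemma fourier1R phi : fourier1 (fun x => (phi x)%:C) =
  (fun xi => (\int[mu]_x (cos (- dot x xi + 0) * phi x)) +i*
             (\int[mu]_x (cos (- dot x xi - pi / 2) * phi x))).
Proof.
apply/funext => xi; rewrite /fourier1 /cintegral.
by congr (_ +i* _); apply: eq_Rintegral => x _; rewrite ?Re_cisM ?Im_cisM.
Qed.

Lemma inv_fourier1R phi : inv_fourier1 (fun x => (phi x)%:C) =
  (fun x => ((2 * pi) ^- n * \int[mu]_xi (cos (dot x xi + 0) * phi xi)) +i*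
            ((2 * pi) ^- n * \int[mu]_xi (cos (dot x xi - pi / 2) * phi xi))).
Proof.
apply/funext => x; rewrite /inv_fourier1 /cintegral.
transitivity (((2 * pi) ^- n)%:C * ((\int[mu]_xi (cos (dot x xi + 0) * phi xi)) +i*
            (\int[mu]_xi (cos (dot x xi - pi / 2) * phi xi)))).
  by congr (_ * (_ +i* _)); apply: eq_Rintegral => xi _; rewrite ?Re_cisM ?Im_cisM.
by apply/eqP; rewrite eq_complex/= !mul0r subr0 addr0 !eqxx.
Qed.

Lemma dotC (x y : 'rV[R]_n) : dot x y = dot y x.
Proof. by apply: eq_bigr => i _; rewrite mulrC. Qed.

Lemma fourier1_hker (e : R) : 0 < e ->
  fourier1 (fun x : 'rV[R]_n => (hker n e (dot x x))%:C) = (fun xi => (gaussr e xi)%:C).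
Proof.
move=> e0; rewrite fourier1R; apply/funext => xi.
have e4 : 0 < (4 * e)^-1 by rewrite invr_gt0 mulr_gt0.
have p0 := @pi_gt0 R.
have H (phi : R) : \int[mu]_x (cos (- dot x xi + phi) * hker n e (dot x x)) =
    cos phi * gaussr e xi.
  transitivity (\int[mu]_x ((Num.sqrt (4 * pi * e) ^+ n)^-1 *
      cgaussr (4 * e)^-1 (- phi) xi x)).
    apply: eq_Rintegral => x _; rewrite hker_gaussr /cgaussr -cosN opprD opprK dotC.
    by rewrite mulrCA.
  rewrite RintegralZl//; last exact: integrable_cgaussr.
  rewrite Rintegral_cgaussr// cosN invrK.
  have -> : pi * (4 * e) = 4 * pi * e by ring.
  set S := Num.sqrt _ ^+ n.
  have S0 : S != 0 by rewrite expf_neq0// gt_eqF// sqrtr_gt0 !mulr_gt0.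
  rewrite [cos phi * S]mulrC -mulrA mulKf//; congr (_ * _).
  rewrite /gaussr; congr (expR (- _)); field.
  by rewrite gt_eqF.
rewrite !H cos0 mul1r.
have -> : cos (- (pi / 2)) = 0 :> R by rewrite cosN cos_pihalf.
by rewrite mul0r.
Qed.

End test_functions.

Section heat_kernel_test.
Context {R : realType} (d : nat) (alpha m : R).
Notation mu := (@lebesgue_rV R d).
Local Open Scope complex_scope.

Lemma enorm_sqr (x : 'rV[R]_d) : enorm x ^+ 2 = dot x x.
Proof. by rewrite sqr_sqrtr ?dot_ge0. Qed.

Definition Lexp (t : R) (xi : 'rV[R]_d) : R := expR (- t * L_symbol alpha m xi).

Lemma measurable_Lexp t : measurable_fun setT (Lexp t).
Proof.
apply: (measurableT_comp (@measurable_expR R)); apply: measurable_funM => //.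
apply: measurable_funB => //.
apply: (measurableT_comp (@measurable_powR R _)).
apply: measurable_funD => //.
by under eq_fun do rewrite enorm_sqr; exact: measurable_dotxx.
Qed.

Lemma Lexp_le t xi : 0 <= t -> 0 <= Lexp t xi <= expR (t * m).
Proof.
move=> t0; rewrite expR_ge0 ler_expR/= mulNr -mulrN ler_wpM2l// /L_symbol opprB.
by rewrite gerBl powR_ge0.
Qed.

(** The Gaussian at time [e] has the transform [gaussr e], and its product with the bounded
    multiplier is again dominated by a Gaussian. Hence both transforms are explicit integrals and
    [L2_extension_refl] supplies both links of [L_semigroup]. *)
Lemma heat_kernel_gauss (p : R -> 'rV[R]_d -> R) (t e : R) :
  heat_kernel alpha m p -> 0 < t -> 0 < e ->
  {ae mu, forall x,
    mu.-integrable setT (EFin \o (fun y => p t (x - y) * hker d e (dot y y))) /\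
    \int[mu]_y (p t (x - y) * hker d e (dot y y)) =
    (2 * pi) ^- d * \int[mu]_xi (cos (dot x xi) * (Lexp t xi * gaussr e xi))}.
Proof.
move=> hp t0 e0; have [_ H] := hp t t0.
pose f := fun x : 'rV[R]_d => (hker d e (dot x x))%:C.
pose psi xi := Lexp t xi * gaussr e xi.
pose g := inv_fourier1 (fun xi => (psi xi)%:C).
have mpsi : measurable_fun setT psi.
  by apply: measurable_funM; [exact: measurable_Lexp|exact: measurable_gaussr].
have psi0 xi : 0 <= psi xi by rewrite mulr_ge0 ?expR_ge0.
have psile xi : `|psi xi| <= expR (t * m) * gaussr e xi.
  rewrite ger0_norm// ler_wpM2r ?expR_ge0//.
  by have /andP[] := Lexp_le xi (ltW t0).
have [p1 p2] := cLfunR e0 mpsi psile.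
have e4 : 0 < (4 * e)^-1 by rewrite invr_gt0 mulr_gt0.
have mh : measurable_fun setT (fun x : 'rV[R]_d => hker d e (dot x x)).
  have [/integrableP[/measurable_EFinP//]] := @integral_hker R d e e0.
have hle (x : 'rV[R]_d) : `|hker d e (dot x x)| <= (Num.sqrt (4 * pi * e) ^+ d)^-1 * gaussr (4 * e)^-1 x.
  by rewrite ger0_norm ?hker_ge0// hker_gaussr.
have [f1 f2] := cLfunR e4 mh hle.
have ipsi : mu.-integrable setT (EFin \o psi).
  by apply/Lfun1_integrable; case: p1.
have Lfg : L_semigroup alpha m t f g.
  exists (fun xi => (gaussr e xi)%:C); split.
    rewrite -fourier1_hker//; apply: L2_extension_refl => //.
    rewrite fourier1_hker//; split => //; exact: measurable_gaussr.
  rewrite (_ : (fun xi => _) = (fun xi => (psi xi)%:C)).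
    apply: L2_extension_refl => //.
    rewrite inv_fourier1R; split => /=; apply: measurable_funM => //;
      exact: measurable_cos_transform.
  by apply/funext => xi; rewrite /psi rmorphM.
apply: filterS (H f g f2 Lfg) => x [[i1 _] gE].
split.
  apply: eq_integrable i1 => // y _ /=.
  by rewrite mul0r subr0.
have : complex.Re (g x) = \int[mu]_y (p t (x - y) * hker d e (dot y y)).
  rewrite gE /=; apply: eq_Rintegral => y _ /=.
  by rewrite mul0r subr0.
move=> <-; rewrite /g inv_fourier1R /=; congr (_ * _).
by apply: eq_Rintegral => xi _; rewrite addr0.
Qed.

End heat_kernel_test.

(** * Narrow Gaussians as an approximate identity *)

Section approximate_identity.
Context {R : realType} {n : nat}.
Notation mu := (@lebesgue_rV R n).

Definition hkerN (k : nat) (x : 'rV[R]_n) : R := hker n k.+1%:R^-1 (dot x x).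

Lemma hkerN_ge0 k x : 0 <= hkerN k x. Proof. exact: hker_ge0. Qed.

(** Off a ball, the narrow Gaussian is compared with the fixed Gaussian [hkerN 0] rather than with a
    constant, because the functions to be tested are only known to be integrable against
    Gaussians. *)
Lemma hkerN_tail (r : R) : 0 < r -> exists C : R, 0 <= C /\
  forall k x, r ^+ 2 <= dot x x -> hkerN k x <= C / k.+1%:R * hkerN 0 x.
Proof.
move=> r0.
pose a := r ^+ 2 / 4.
have a0 : 0 < a by rewrite divr_gt0// exprn_gt0.
have n1 : 0 < n.+1%:R :> R by rewrite ltr0n.
(* The normalization grows at most like [N ^ n]; the power [n + 1] of [a * N] in [powR_le_expR]
   beats it by one, which is the decay [1 / N]. *)
pose K := n.+1%:R `^ n.+1%:R : R.
exists (K / a ^+ n.+1 * expR a); split.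
  by rewrite !mulr_ge0 ?powR_ge0 ?expR_ge0// invr_ge0 exprn_ge0// ltW.
move=> k x rx.
set N : R := k.+1%:R.
have N0 : 0 < N by rewrite ltr0n.
have N1 : 1 <= N by rewrite ler1n.
have p0 : 0 < 4 * pi :> R by rewrite mulr_gt0// pi_gt0.
have E : hkerN k x = Num.sqrt N ^+ n * expR (- (dot x x / 4 * (N - 1))) * hkerN 0 x.
  rewrite /hkerN /hker invr1 !mulr1 -/N.
  have -> : Num.sqrt (4 * pi / N) ^- n = Num.sqrt N ^+ n * Num.sqrt (4 * pi) ^- n :> R.
    rewrite sqrtrM ?(ltW p0)// sqrtrV ?(ltW N0)// exprMn exprVn invfM invrK.
    by rewrite mulrC.
  rewrite -!mulrA; congr (_ * _); rewrite mulrCA; congr (_ * _).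
  rewrite -expRD; congr expR; field.
  by rewrite gt_eqF.
rewrite E ler_wpM2r ?hkerN_ge0//.
apply: (@le_trans _ _ (N ^+ n * (expR a * (expR (a * N))^-1))).
  apply: ler_pM; rewrite ?exprn_ge0 ?sqrtr_ge0 ?expR_ge0//.
    rewrite lerXn2r ?nnegrE ?sqrtr_ge0 ?(ltW N0)//.
    rewrite -[leRHS](ger0_norm (ltW N0)) -sqrtr_sqr ler_wsqrtr//.
    by rewrite expr2 ler_peMr// ltW.
  rewrite -expRN -expRD ler_expR.
  have : a * (N - 1) <= dot x x / 4 * (N - 1).
    by rewrite ler_wpM2r ?subr_ge0// ler_wpM2r.
  by lra.
have aN : 0 <= a * N by rewrite mulr_ge0 ?(ltW N0)// ltW.
have := powR_le_expR n1 aN; rewrite powR_mulrn// -/K => H.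
rewrite mulrA ler_pdivrMr ?expR_gt0//.
rewrite [leRHS](_ : _ = expR a * N^-1 * (a ^+ n.+1)^-1 * (K * expR (a * N))); last by ring.
apply: le_trans (ler_wpM2l _ H); last first.
  by rewrite !mulr_ge0 ?expR_ge0 ?invr_ge0 ?exprn_ge0// ltW.
have -> : (a * N) ^+ n.+1 = a ^+ n.+1 * (N * N ^+ n) by rewrite -exprS; exact: exprMn.
rewrite le_eqVlt; apply/orP; left; apply/eqP.
have A0 : a ^+ n.+1 != 0 by rewrite expf_neq0// gt_eqF.
by move: (a ^+ n.+1) A0 (N ^+ n) => A A0 B; field; rewrite A0 gt_eqF.
Qed.

(** Near 0 continuity of [psi] costs [e]; far from 0, where [psi] has no growth bound, [hkerN_tail]
    reduces everything to the single integrable function [phi]. *)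
Lemma approximate_identity_le (psi : 'rV[R]_n -> R) (b_ : nat -> R) (b : R) :
  {for 0, continuous psi} ->
  (forall k, mu.-integrable setT (EFin \o (fun y => psi y * hkerN k y))) ->
  (forall k, \int[mu]_y (psi y * hkerN k y) <= b_ k) ->
  b_ k @[k --> \oo] --> b -> psi 0 <= b.
Proof.
move=> cpsi ipsi psib bb.
apply/ler_addgt0Pr => e e0.
have ih k : mu.-integrable setT (EFin \o hkerN k) /\ \int[mu]_y hkerN k y = 1.
  by apply: integral_hker; rewrite invr_gt0.
have /cvgrPdist_le/(_ e e0) := cpsi.
move=> /nbhs_ballP[r /= r0 Hr].
have [C [C0 HC]] := hkerN_tail r0.
pose phi y := `|psi y * hkerN 0 y - psi 0 * hkerN 0 y|.
have iphi : mu.-integrable setT (EFin \o phi).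
  rewrite (_ : _ \o _ = abse \o (EFin \o (fun y => 1 * (psi y * hkerN 0 y) + (- psi 0) * hkerN 0 y))).
    by apply: integrable_abse; apply: integrable_lin => //; case: (ih 0%N).
  by apply/funext => y; rewrite /= /phi mul1r mulNr.
pose I := \int[mu]_y phi y.
have phi0 y : 0 <= phi y by rewrite normr_ge0.
have key k : psi 0 <= b_ k + e + C / k.+1%:R * I.
  have [i1 i2] := ih k.
  have pt y : psi 0 * hkerN k y <=
      (1 * (psi y * hkerN k y) + e * hkerN k y) + C / k.+1%:R * phi y.
    rewrite mul1r; have h0 := hkerN_ge0 k y.
    have [yr|yr] := leP (r ^+ 2) (dot y y).
      have H := HC k y yr.
      have : `|psi y - psi 0| * hkerN k y <= C / k.+1%:R * phi y.
        rewrite /phi -mulrBl normrM (ger0_norm (hkerN_ge0 0 y)) [leRHS]mulrCA.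
        by rewrite ler_wpM2l.
      have : (psi 0 - psi y) * hkerN k y <= `|psi y - psi 0| * hkerN k y.
        by rewrite ler_wpM2r// distrC ler_norm.
      have : 0 <= e * hkerN k y by rewrite mulr_ge0// ltW.
      move: (C / _ * _) => u; nra.
    (* The library ball is for the sup norm, which the Euclidean norm dominates. *)
    have : ball (0 : 'rV[R]_n) r y.
      split=> // i j; rewrite ord1 /ball/= !mxE sub0r normrN.
      rewrite -(@ltr_pXn2r _ 2) ?nnegrE ?(ltW r0)// real_normK ?num_real//.
      apply: le_lt_trans yr; rewrite /dot (bigD1 j)//= -expr2 lerDl.
      by apply: sumr_ge0 => l _; rewrite -expr2 sqr_ge0.
    move=> /Hr /= /ler_normlP[_ H].
    have : (psi 0 - psi y) * hkerN k y <= e * hkerN k y by rewrite ler_wpM2r.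
    have : 0 <= C / k.+1%:R * phi y by rewrite mulr_ge0// divr_ge0.
    move: (C / _ * _) => u; nra.
  have : \int[mu]_y (psi 0 * hkerN k y) <=
     \int[mu]_y (1 * (1 * (psi y * hkerN k y) + e * hkerN k y) + C / k.+1%:R * phi y).
    apply: le_Rintegral => //.
    - rewrite (_ : _ \o _ = fun y => ((psi 0)%:E * (EFin \o hkerN k) y)%E).
        exact: integrableZl.
      by apply/funext => y; rewrite /= EFinM.
    - by apply: integrable_lin => //; exact: integrable_lin.
    - by move=> y _; rewrite [1 * (_ + _)]mul1r.
  rewrite RintegralZl// i2 mulr1 Rintegral_lin//; last exact: integrable_lin.
  rewrite Rintegral_lin// i2 !mul1r mulr1 -/I => H.
  by apply: (le_trans H); rewrite lerD2r lerD2r.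
have L : b_ k + e + C / k.+1%:R * I @[k --> \oo] --> b + e + C * 0 * I.
  apply: cvgD; first by apply: cvgD => //; exact: cvg_cst.
  by apply: cvgMl; apply: cvgMr; exact: cvg_harmonic.
rewrite mulr0 mul0r addr0 in L.
by apply: (cvgr_to_ge L); apply: nearW => k; exact: key.
Qed.

End approximate_identity.

(** * From almost every point to every nonzero point *)

Section pointwise_bound.
Context {R : realType} (d : nat) (alpha m : R).
Notation mu := (@lebesgue_rV R d).

Lemma measurable_rV_box (A : 'I_d -> set (measurableTypeR R)) :
  (forall i, measurable (A i)) ->
  measurable [set y : 'rV[R]_d | forall i, A i (y ord0 i)].
Proof.
move=> mA; rewrite (_ : [set y | _] = \bigcap_(i in [set: 'I_d])
    ((fun x : 'rV[R]_d => x ord0 i : measurableTypeR R) @^-1` A i)).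
  apply: fin_bigcap_measurable => // i _.
  by rewrite -[X in measurable X]setTI; exact: measurable_rV_coord.
by apply/seteqP; split=> x /= Bx i; [move=> _|]; exact: Bx.
Qed.

(** Each side extends from [x] away from 0, so every point of the box is at least as far from 0 as
    [x] in each coordinate, and within [e] of it. *)
Lemma lebesgue_rV_box_gt0 (x : 'rV[R]_d) (e : R) : 0 < e ->
  let A (i : 'I_d) : set (measurableTypeR R) :=
    if 0 <= x ord0 i then `]x ord0 i, x ord0 i + e[%classic
    else `]x ord0 i - e, x ord0 i[%classic in
  measurable [set y : 'rV[R]_d | forall i, A i (y ord0 i)] /\
  mu [set y : 'rV[R]_d | forall i, A i (y ord0 i)] = (e ^+ d)%:E.
Proof.
move=> e0 A; have mA i : measurable (A i) by rewrite /A; case: ifP => _; exact: measurable_itv.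
split; first exact: measurable_rV_box.
rewrite lebesgue_rV_box// (eq_bigr (fun=> e%:E)).
  by rewrite prodEFin prodr_const card_ord.
move=> i _; rewrite /A; case: ifP => _; rewrite lebesgue_measure_itv/= lte_fin.
  by rewrite ltrDl e0 -EFinB addrC addKr.
by rewrite gtrBl e0 -EFinB opprB addrC subrK.
Qed.

Lemma dot_gt0 (x : 'rV[R]_d) : x != 0 -> 0 < dot x x.
Proof.
move=> x0; rewrite lt_neqAle dot_ge0 andbT eq_sym; apply: contra x0 => /eqP dx.
have dx0 : \sum_(i < d) x ord0 i * x ord0 i == 0 by rewrite -/(dot x x) dx.
move: dx0; rewrite psumr_eq0; last by move=> i _; rewrite -expr2 sqr_ge0.
move/allP => H; apply/eqP/rowP => i; rewrite mxE.
by have := H i (mem_index_enum _); rewrite /= -expr2 sqrf_eq0 => /eqP.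
Qed.

(* Almost every [x] comes from testing against Gaussians.  Every [x != 0] is then reached because [b] is
   nonincreasing: the points near [x] that are farther from 0 contain a box of positive measure. *)
Lemma heat_kernel_le (p : R -> 'rV[R]_d -> R) (t : R) (b_ : nat -> R -> R) (b : R -> R) :
  heat_kernel alpha m p -> 0 < t ->
  (forall k x, x != 0 ->
    (2 * pi) ^- d * \int[mu]_xi (cos (dot x xi) * (Lexp alpha m t xi * gaussr k.+1%:R^-1 xi))
    <= b_ k (dot x x)) ->
  (forall r, 0 < r -> b_ k r @[k --> \oo] --> b r) ->
  (forall r s, 0 < r -> r <= s -> b s <= b r) ->
  forall x, x != 0 -> p t x <= b (dot x x).
Proof.
move=> hp t0 hb cb bdec.
have cp : continuous (p t) by case: (hp t t0).
have aex : {ae mu, forall x, x != 0 -> p t x <= b (dot x x)}.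
  have : {ae mu, forall x k,
    mu.-integrable setT (EFin \o (fun y => p t (x - y) * hkerN k y)) /\
    \int[mu]_y (p t (x - y) * hkerN k y) =
    (2 * pi) ^- d * \int[mu]_xi (cos (dot x xi) * (Lexp alpha m t xi * gaussr k.+1%:R^-1 xi))}.
    apply/ae_foralln => k; apply: heat_kernel_gauss => //.
  apply: filterS => x Hx x0.
  rewrite -[X in p t X](subr0 x).
  apply: (@approximate_identity_le _ _ (fun y => p t (x - y)) (b_ ^~ (dot x x))).
  - apply: continuous_comp; last exact: cp.
    move=> A /nbhs_ballP[e /= e0 He]; apply/nbhs_ballP; exists e => //= y y0.
    apply: He; split=> // i j; have [_ /(_ i j)] := y0; rewrite /ball/= !mxE.
    by rewrite sub0r normrN subr0 subKr.
  - by move=> k; case: (Hx k).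
  - by move=> k; case: (Hx k) => _ ->; exact: hb.
  - exact/cb/dot_gt0.
move=> x x0; rewrite leNgt; apply/negP => bp.
have /cvgrPdist_lt/(_ (p t x - b (dot x x))) := cp x.
rewrite subr_gt0 => /(_ bp) /nbhs_ballP[e /= e0 He].
have [N [mN N0 HN]] := aex.
(* A failure at [x] persists at nearby points, and farther from 0 the bound is no larger; the whole
   box would then lie in the null set [N]. *)
have := lebesgue_rV_box_gt0 x e0 => /=; set B := [set y | _] => -[mB muB].
have BN : B `<=` N.
  move=> y By; apply: HN => /= Hy.
  have yx i : x ord0 i ^+ 2 <= y ord0 i ^+ 2 /\ `|x ord0 i - y ord0 i| < e.
    have := By i; case: ifPn => [xi|]; rewrite /= in_itv/=.
      move=> /andP[h1 h2].
      split; last by rewrite ltr_norml; apply/andP; split; lra.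
      by rewrite lerXn2r ?nnegrE//; lra.
    rewrite -ltNge => xi /andP[h1 h2].
    split; last by rewrite ltr_norml; apply/andP; split; lra.
    by rewrite -[leLHS]sqrrN -[leRHS]sqrrN lerXn2r ?nnegrE//; lra.
  have dxy : dot x x <= dot y y.
    by apply: ler_sum => i _; rewrite -!expr2; case: (yx i).
  have y0 : y != 0.
    apply/eqP => y0; have := lt_le_trans (dot_gt0 x0) dxy.
    by rewrite y0 /dot big1 ?ltxx// => i _; rewrite mxE mul0r.
  have bxy : ball x e y by split=> // i j; rewrite ord1 /ball/=; case: (yx j).
  have := He y bxy; rewrite /= => H.
  have := Hy y0; have := bdec _ _ (dot_gt0 x0) dxy; move: H.
  by move=> /ltr_normlP[_]; lra.
have : (mu B <= mu N)%E.
  by rewrite le_measure ?inE.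
rewrite N0 muB lee_fin => H.
by have := exprn_gt0 d e0; rewrite ltNge H.
Qed.

End pointwise_bound.

(** * Discrete subordination *)

Section subordination.
Context {R : realType} (d : nat) (b M : R).
Hypotheses (hd : (1 <= d)%N) (b01 : 0 < b < 1) (M0 : 0 < M).
Notation mu := (@lebesgue_rV R d).
Notation leb := (@lebesgue_measure R).

Let b0 : 0 < b. Proof. by case/andP: b01. Qed.

Lemma integrable_expRN :
  leb.-integrable `]0, +oo[%classic (EFin \o (fun s => expR (- (M * s)))).
Proof.
apply/integrableP; split.
  apply/measurable_EFinP; apply: measurable_funTS.
  apply: continuous_measurable_fun => x; apply: continuous_comp; last exact: continuous_expR.
  by apply: cvgN; apply: cvgMr.
under eq_integral do rewrite /= ger0_norm ?expR_ge0//.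
have dF (x : R) : is_derive x 1 (fun s => - M^-1 * expR (- (M * s))) (expR (- (M * x))).
  by apply: is_derive_eq; rewrite /GRing.scale/=; field; rewrite gt_eqF.
have cF x : {for x, continuous (fun s : R => - M^-1 * expR (- (M * s)))}.
  by apply/differentiable_continuous/derivable1_diffP; have [] := dF x.
have mE : measurable_fun setT (fun s : measurableTypeR R => expR (- (M * s))).
  apply: continuous_measurable_fun => x; apply: continuous_comp; last exact: continuous_expR.
  by apply: cvgN; apply: cvgMr.
rewrite integral_itv_obnd_cbnd; last exact/measurable_EFinP/measurable_funTS.
rewrite (@ge0_continuous_FTC2y _ _ (fun s => - M^-1 * expR (- (M * s))) 0 0).
- by rewrite -EFinB ltry.
- by move=> x _; exact: expR_ge0.
- apply: continuous_subspaceT => x; apply: continuous_comp; last exact: continuous_expR.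
  by apply: cvgN; apply: cvgMr.
- rewrite -[X in _ --> X](mulr0 (- M^-1)); apply: cvgMr.
  apply: (cvg_comp (fun s => M * s) (fun s => expR (- s))); last exact: cvgr_expR.
  apply/cvgryPge => A; near=> s.
  by rewrite mulrC -ler_pdivrMr//; near: s; exact: nbhs_pinfty_ge.
- by move=> x _; have [] := dF x.
- exact/cvg_at_right_filter/cF.
- by move=> x _; rewrite derive1E; have [_ ->] := dF x.
Unshelve. all: by end_near. Qed.

Lemma sqrt_powR (y : R) n : 0 <= y -> Num.sqrt y ^+ n = y `^ (n%:R / 2).
Proof. by move=> y0; rewrite mulrC powRrM powR12_sqrt// powR_mulrn// sqrtr_ge0. Qed.

(** In terms of [X = r2 / (4 u)] the kernel is a constant times [X ^ (d / 2) * exp (- X)], which is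
    bounded. This supplies a majorant uniform in the Gaussian time. *)
Lemma hker_bound (r2 : R) : 0 < r2 ->
  exists C : R, 0 <= C /\ forall u, 0 < u -> hker d u r2 <= C.
Proof.
move=> r0; have p0 := @pi_gt0 R.
have q0 : 0 < d%:R / 2 :> R by rewrite divr_gt0// ltr0n.
exists ((pi * r2) `^ (- (d%:R / 2)) * (d%:R / 2) `^ (d%:R / 2)).
split; first by rewrite mulr_ge0 ?powR_ge0.
move=> u u0; pose X := r2 / (4 * u).
have X0 : 0 < X by rewrite divr_gt0// mulr_gt0.
have pr : 0 < pi * r2 by rewrite mulr_gt0.
have E (a : R) : 4 * a * u = (a * r2) / (r2 / (4 * u)).
  by field; rewrite !gt_eqF.
rewrite /hker sqrt_powR ?mulr_ge0 ?(ltW u0)// ?(ltW p0)// (E pi) -/X expRN.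
rewrite powRM ?(ltW pr)// ?invr_ge0 ?(ltW X0)// invfM -powRN -mulrA ler_wpM2l ?powR_ge0//.
rewrite -powR_inv1 ?(ltW X0)// -powRrM mulN1r powRN invrK ler_pdivrMr ?expR_gt0//.
exact: powR_le_expR (ltW X0).
Qed.

Lemma hker_le_r n (u r s : R) : 0 < u -> r <= s -> hker n u s <= hker n u r.
Proof.
move=> u0 rs; rewrite /hker ler_wpM2l ?invr_ge0 ?exprn_ge0 ?sqrtr_ge0//.
by rewrite ler_expR lerN2 ler_wpM2r// invr_ge0 mulr_ge0// ltW.
Qed.

(** A later time increases the exponential, and the normalization loses at most a factor [2 ^ n]. *)
Lemma hker_le_u n (u v r : R) : 0 < u -> u <= v -> v <= 4 * u -> 0 <= r ->
  hker n u r <= 2 ^+ n * hker n v r.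
Proof.
move=> u0 uv v4 r0; have p0 := @pi_gt0 R.
have v0 : 0 < v := lt_le_trans u0 uv.
have pv : 0 < 4 * pi * v by rewrite !mulr_gt0.
have pu : 0 < 4 * pi * u by rewrite !mulr_gt0.
rewrite /hker mulrA; apply: ler_pM; rewrite ?invr_ge0 ?exprn_ge0 ?sqrtr_ge0 ?expR_ge0//.
  rewrite -[leLHS]mul1r ler_pdivrMr ?exprn_gt0 ?sqrtr_gt0// mulrAC.
  rewrite ler_pdivlMr ?exprn_gt0 ?sqrtr_gt0// mul1r -exprMn lerXn2r ?nnegrE ?mulr_ge0 ?sqrtr_ge0//.
  have -> : 2 * Num.sqrt (4 * pi * u) = Num.sqrt (2 ^+ 2 * (4 * pi * u)).
    by rewrite [RHS]sqrtrM ?sqr_ge0// sqrtr_sqr ger0_norm.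
  rewrite ler_wsqrtr//.
  have := ler_wpM2l (ltW (mulr_gt0 (ltr0n R 4) p0)) v4.
  by rewrite (_ : 4 * pi * (4 * u) = 2 ^+ 2 * (4 * pi * u)); last ring.
rewrite ler_expR lerN2 ler_wpM2l// lef_pV2 ?posrE ?mulr_gt0//.
by rewrite ler_wpM2l.
Qed.

Lemma cvg_hker n (u_ : nat -> R) (u r : R) : 0 < u -> u_ k @[k --> \oo] --> u ->
  hker n (u_ k) r @[k --> \oo] --> hker n u r.
Proof.
move=> u0 uu; have p0 := @pi_gt0 R.
have pu : 0 < 4 * pi * u by rewrite !mulr_gt0.
rewrite /hker; apply: cvgM.
  apply: cvgV; first by rewrite expf_neq0// gt_eqF// sqrtr_gt0.
  have H : Num.sqrt (4 * pi * u_ k) @[k --> \oo] --> Num.sqrt (4 * pi * u).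
    by apply: (continuous_cvg _ (@sqrt_continuous R (4 * pi * u))); apply: cvgMr.
  exact: (continuous_cvg _ (@exprn_continuous R n _) H).
have H : - (r / (4 * u_ k)) @[k --> \oo] --> - (r / (4 * u)).
  apply: cvgN; apply: cvgMr; apply: cvgV; last exact: cvgMr.
  by rewrite gt_eqF// mulr_gt0.
exact: (continuous_cvg _ (@continuous_expR R _) H).
Qed.

(* Stands in for the density at [s] of the [b]-stable subordinator at time [t]. *)
Definition omega (t s : R) : R := Num.min (t * s `^ (- b - 1)) (t `^ (- b^-1)).

Lemma omega_ge0 t s : 0 < t -> 0 <= omega t s.
Proof. by move=> t0; rewrite le_min mulr_ge0 ?powR_ge0// ltW. Qed.

(** The shift [e] is the time of the Gaussian test function; [e = 0] is the final majorant. *)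
Definition subord (e t r s : R) : R := hker d (e + s) r * expR (- (M * s)) * omega t s.

Lemma subord_ge0 e t r s : 0 < t -> 0 <= subord e t r s.
Proof. by move=> t0; rewrite !mulr_ge0 ?hker_ge0 ?expR_ge0 ?omega_ge0. Qed.

Lemma measurable_hker n e r : 0 <= e ->
  measurable_fun (`]0, +oo[%classic : set (measurableTypeR R)) (fun s => hker n (e + s) r).
Proof.
move=> e0; apply: open_continuous_measurable_fun; first exact: interval_open.
move=> s; rewrite inE/= in_itv/= andbT => s0.
apply/(@cvg_nbhsP _ R^o) => u us; apply: cvg_hker; first by rewrite ltr_wpDl.
by apply: cvgD => //; exact: cvg_cst.
Qed.

Lemma measurable_omega t : measurable_fun setT (omega t : measurableTypeR R -> R).
Proof.
by apply: measurable_minr => //; apply: measurable_funM.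
Qed.

Lemma measurable_subord e t r : 0 <= e ->
  measurable_fun (`]0, +oo[%classic : set (measurableTypeR R)) (subord e t r).
Proof.
move=> e0; apply: measurable_funM; last exact: (measurable_funTS (measurable_omega t)).
apply: measurable_funM; first exact: measurable_hker.
apply: measurable_funTS; apply: continuous_measurable_fun => x.
apply: continuous_comp; last exact: continuous_expR.
by apply: cvgN; apply: cvgMr.
Qed.

Definition subord_int e t r := \int[leb]_(s in `]0, +oo[) subord e t r s.

Lemma integrable_subord e t r : 0 <= e -> 0 < t -> 0 < r ->
  leb.-integrable `]0, +oo[%classic (EFin \o subord e t r).
Proof.
move=> e0 t0 r0; have [C [C0 HC]] := hker_bound r0.
apply: (@dominated_integrableR _ _ _ leb _ _ _ (fun s => C * t `^ (- b^-1) * expR (- (M * s)))).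
- exact: measurable_itv.
- exact: measurable_subord.
- move=> s; rewrite /= in_itv/= andbT => s0.
  rewrite ger0_norm ?subord_ge0// /subord mulrAC ler_wpM2r ?expR_ge0//.
  by apply: ler_pM; rewrite ?hker_ge0 ?omega_ge0 ?HC ?ltr_wpDl// ge_min lexx orbT.
- rewrite (_ : _ \o _ = (fun s => (C * t `^ (- b^-1))%:E * (expR (- (M * s)))%:E)%E).
    by apply: integrableZl; [exact: measurable_itv|exact: integrable_expRN].
  by apply/funext => s; rewrite /= EFinM.
Qed.

Lemma cvg_subord_int t r : 0 < t -> 0 < r ->
  subord_int k.+1%:R^-1 t r @[k --> \oo] --> subord_int 0 t r.
Proof.
move=> t0 r0; have [C [C0 HC]] := hker_bound r0.
have h k (s : R) : `]0, +oo[%classic s -> `|subord k.+1%:R^-1 t r s| <= C * t `^ (- b^-1) * expR (- (M * s)).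
  rewrite /= in_itv/= andbT => s0.
  rewrite ger0_norm ?subord_ge0// /subord mulrAC ler_wpM2r ?expR_ge0//.
  by apply: ler_pM; rewrite ?hker_ge0 ?omega_ge0 ?HC ?ltr_wpDl// ge_min lexx orbT.
have i : leb.-integrable `]0, +oo[%classic (EFin \o (fun s => C * t `^ (- b^-1) * expR (- (M * s)))).
  rewrite (_ : _ \o _ = (fun s => (C * t `^ (- b^-1))%:E * (expR (- (M * s)))%:E)%E).
    by apply: integrableZl; [exact: measurable_itv|exact: integrable_expRN].
  by apply/funext => s; rewrite /= EFinM.
have mI : measurable (`]0, +oo[%classic : set (measurableTypeR R)) by exact: measurable_itv.
have m_ k : measurable_fun (`]0, +oo[%classic : set (measurableTypeR R)) (subord k.+1%:R^-1 t r).
  by apply: measurable_subord; rewrite invr_ge0.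
have f_f s : `]0, +oo[%classic s ->
    subord k.+1%:R^-1 t r s @[k --> \oo] --> subord 0 t r s.
  rewrite /= in_itv/= andbT => s0.
  rewrite /subord; apply: cvgMl; apply: cvgMl; apply: cvg_hker; first by rewrite add0r.
  by apply: cvgD; [exact: cvg_harmonic|exact: cvg_cst].
by have [_] := dominated_cvgR mI m_ f_f i h.
Qed.

Lemma subord_int_le t r s : 0 < t -> 0 < r -> r <= s -> subord_int 0 t s <= subord_int 0 t r.
Proof.
move=> t0 r0 rs; apply: le_Rintegral.
- exact: measurable_itv.
- by apply: integrable_subord => //; exact: lt_le_trans rs.
- exact: integrable_subord.
- move=> u; rewrite /= in_itv/= andbT => u0.
  by rewrite ler_wpM2r ?omega_ge0// ler_wpM2r ?expR_ge0// hker_le_r// add0r.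
Qed.

Lemma sum_itv_le (F : R -> R) (delta : R) K : 0 < delta -> (forall s, 0 <= F s) ->
  leb.-integrable `]0, +oo[%classic (EFin \o F) ->
  \sum_(k < K) \int[leb]_(s in `]k%:R * delta, k.+1%:R * delta]) F s <=
  \int[leb]_(s in `]0, +oo[) F s.
Proof.
move=> d0 F0 iF.
have iS a c : 0 <= a -> leb.-integrable `]a, c]%classic (EFin \o F).
  move=> a0; apply: integrableS iF; [exact: measurable_itv|exact: measurable_itv|].
  by move=> x /=; rewrite !in_itv/= andbT => /andP[ax _]; exact: le_lt_trans ax.
have -> : \sum_(k < K) \int[leb]_(s in `]k%:R * delta, k.+1%:R * delta]) F s =
    \int[leb]_(s in `]0, K%:R * delta]) F s.
  elim: K => [|K IH].
    by rewrite big_ord0 mul0r set_itv_ge ?Rintegral_set0// bnd_simp ltxx.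
  rewrite big_ord_recr/= IH.
  rewrite (@itv_bndbnd_setU _ _ (BRight (0:R)) (BRight (K%:R * delta)) (BRight (K.+1%:R * delta))); last 2 first.
  - by rewrite bnd_simp mulr_ge0// ltW.
  - by rewrite bnd_simp ler_wpM2r ?(ltW d0)// ler_nat.
  have m1 : measurable (`]0, (K%:R * delta)]%classic : set (measurableTypeR R)).
    exact: measurable_itv.
  have m2 : measurable (`]K%:R * delta, (K.+1%:R * delta)]%classic : set (measurableTypeR R)).
    exact: measurable_itv.
  rewrite Rintegral_setU//.
    rewrite -itv_bndbnd_setU ?bnd_simp ?mulr_ge0 ?(ltW d0)//.
      exact: iS.
    by rewrite ler_wpM2r ?(ltW d0)// ler_nat.
  apply/disj_setPS => x [] /=; rewrite !in_itv/= => /andP[_ h1] /andP[h2 _].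
  by have := lt_le_trans h2 h1; rewrite ltxx.
have mF : measurable_fun (`]0, +oo[%classic : set (measurableTypeR R)) (EFin \o F).
  by case/integrableP: iF.
rewrite /Rintegral fine_le//.
- by apply: integrable_fin_num; [exact: measurable_itv|exact: iS].
- by apply: integrable_fin_num => //; exact: measurable_itv.
- apply: ge0_subset_integral => //.
  + by move=> x _; rewrite lee_fin.
  + by move=> x /=; rewrite !in_itv/= andbT => /andP[].
Qed.

(** Only the power branch depends on [s], and doubling [s] costs [2 ^ (b + 1) <= 4]. *)
Lemma omega_half t s u : 0 < t -> 0 < s -> s <= u -> u <= 2 * s ->
  omega t s <= 4 * omega t u.
Proof.
move=> t0 s0 su u2.
have u0 : 0 < u := lt_le_trans s0 su.
have b1 : b < 1 by case/andP: b01.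
rewrite /omega minr_pMr//; rewrite le_min !ge_min; apply/andP; split; apply/orP.
  left; rewrite mulrCA ler_wpM2l ?(ltW t0)//.
  apply: (@le_trans _ _ ((u / 2) `^ (- b - 1))).
    rewrite -opprD !powRN lef_pV2 ?posrE ?powR_gt0// ?divr_gt0//.
    rewrite ge0_ler_powR ?nnegrE ?addr_ge0 ?(ltW b0) ?(ltW s0) ?divr_ge0 ?(ltW u0)//.
    by rewrite ler_pdivrMr// mulrC.
  rewrite powRM ?(ltW u0)// mulrC ler_wpM2r ?powR_ge0//.
  rewrite -powR_inv1// -powRrM mulN1r opprB opprK.
  apply: (@le_trans _ _ (2 `^ 2)); last by rewrite powR_mulrn// expr2; lra.
  by rewrite ler_powR ?ler1n//; lra.
by right; rewrite ler_peMl ?powR_ge0// ler1n.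
Qed.

(** One term of the series against one cell of the integral. The scaling [T = t * delta ^ (- b)]
    turns the two bounds on [a] into [C * delta] times the branches of [omega t s0], and every
    factor of [subord] is comparable on the cell with its value at the left end [s0]. *)
Lemma subord_step e t r delta k (C T a : R) :
  0 < e -> 0 < t -> 0 < r -> 0 < delta -> 0 <= C ->
  T = t * delta `^ (- b) ->
  a <= C * T `^ (- b^-1) -> a <= C * (T * k.+1%:R `^ (- b - 1)) ->
  a * expR (- (k.+1%:R * delta * M)) * hker d (e + k.+1%:R * delta) r <=
  C * (4 * 2 ^+ d) * expR (delta * M) *
    \int[leb]_(s in `]k.+1%:R * delta, k.+2%:R * delta]) subord e t r s.
Proof.
move=> e0 t0 r0 d0 C0 TE a1 a2.
set s0 := k.+1%:R * delta.
have k0 : 0 < k.+1%:R :> R by rewrite ltr0n.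
have k1 : 1 <= k.+1%:R :> R by rewrite ler1n.
have s00 : 0 < s0 by rewrite mulr_gt0.
(* The cell is no longer than [s0], hence [s <= 2 * s0] on it; this fails for the term of index
   0. *)
have ds0 : delta <= s0 by rewrite /s0 ler_peMl// ltW.
have -> : k.+2%:R * delta = s0 + delta by rewrite /s0 -[k.+2%:R]natr1 mulrDl mul1r.
have E1 : T * k.+1%:R `^ (- b - 1) = delta * (t * s0 `^ (- b - 1)).
  rewrite TE /s0.
  have [u uE] := expR_total d0; have [v vE] := expR_total k0; have [w wE] := expR_total t0.
  rewrite -uE -vE -wE -!expRD -!expRM -!expRD.
  by congr expR; ring.
have E2 : T `^ (- b^-1) = delta * t `^ (- b^-1).
  rewrite TE.
  have [u uE] := expR_total d0; have [w wE] := expR_total t0.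
  rewrite -uE -wE -!expRM -!expRD -!expRM.
  by congr expR; field; rewrite gt_eqF.
have aw : a <= C * delta * omega t s0.
  rewrite /omega minr_pMr ?mulr_ge0 ?(ltW d0)// le_min -!mulrA; apply/andP; split.
    by rewrite -E1.
  by rewrite -E2.
pose I := (`]s0, (s0 + delta)]%classic : set (measurableTypeR R)).
have mI : measurable I by exact: measurable_itv.
have iI : leb.-integrable I (EFin \o subord e t r).
  apply: integrableS (integrable_subord (ltW e0) t0 r0) => //.
  by move=> x; rewrite /I /= !in_itv/= andbT => /andP[h _]; exact: lt_trans h.
pose V := expR (- (s0 * M)) * hker d (e + s0) r * omega t s0.
have V0 : 0 <= V by rewrite !mulr_ge0 ?expR_ge0 ?hker_ge0 ?omega_ge0.
have Vle s : I s -> V <= 4 * 2 ^+ d * expR (delta * M) * subord e t r s.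
  rewrite /I /= in_itv/= => /andP[s0s ss0].
  have h1 : expR (- (s0 * M)) <= expR (delta * M) * expR (- (M * s)).
    rewrite -expRD ler_expR.
    have := ler_wpM2r (ltW M0) ss0; rewrite mulrDl; lra.
  have h2 : hker d (e + s0) r <= 2 ^+ d * hker d (e + s) r.
    by apply: hker_le_u; [rewrite addr_gt0|lra|lra|exact: ltW].
  have h3 : omega t s0 <= 4 * omega t s.
    by apply: omega_half => //; [exact: ltW|lra].
  rewrite /V /subord.
  have H := ler_pM (expR_ge0 _) (hker_ge0 _ _ _) h1 h2.
  have H' := ler_pM (mulr_ge0 (expR_ge0 _) (hker_ge0 _ _ _)) (omega_ge0 _ t0) H h3.
  by apply: (le_trans H'); rewrite le_eqVlt; apply/orP; left; apply/eqP; ring.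
have VI : V * delta <= 4 * 2 ^+ d * expR (delta * M) * \int[leb]_(s in I) subord e t r s.
  have muI : leb I = delta%:E.
    rewrite /I lebesgue_measure_itv/= lte_fin ltrDl d0 -EFinB.
    by congr EFin; ring.
  have -> : V * delta = \int[leb]_(s in I) cst V s.
    by rewrite Rintegral_cst// [X in fine X]muI.
  rewrite -RintegralZl//; apply: le_Rintegral => //.
  - apply/integrableP; split; first exact/measurable_EFinP.
    under eq_integral do rewrite /= ger0_norm//.
    by rewrite integral_cst// [X in (_ * X)%E]muI ltry.
  - rewrite (_ : _ \o _ = (fun s => (4 * 2 ^+ d * expR (delta * M))%:E * (EFin \o subord e t r) s)%E).
      exact: integrableZl.
    by apply/funext => s; rewrite /= EFinM.
have CVI := ler_wpM2l C0 VI.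
apply: (@le_trans _ _ (C * (V * delta))).
  rewrite (_ : C * (V * delta) = C * delta * omega t s0 * (expR (- (s0 * M)) * hker d (e + s0) r)); last first.
    by rewrite /V; ring.
  by rewrite -mulrA ler_wpM2r// mulr_ge0 ?expR_ge0 ?hker_ge0.
by apply: le_trans CVI _; rewrite le_eqVlt; apply/orP; left; apply/eqP; rewrite -/I; ring.
Qed.

(** Dominated convergence with the test Gaussian as majorant; it serves the limit of the partial
    sums and then the limit [delta -> 0]. *)
Lemma transform_limit_le (phi_ : nat -> 'rV[R]_d -> R) (phi : 'rV[R]_d -> R)
    (c_ : nat -> R) (c e : R) (x : 'rV[R]_d) :
  0 < e -> (forall k, measurable_fun setT (phi_ k)) ->
  (forall k xi, `|phi_ k xi| <= 1) -> (forall xi, phi_ k xi @[k --> \oo] --> phi xi) ->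
  c_ k @[k --> \oo] --> c ->
  (forall k, (2 * pi) ^- d * \int[mu]_xi (cos (dot x xi) * (phi_ k xi * gaussr e xi)) <= c_ k) ->
  (2 * pi) ^- d * \int[mu]_xi (cos (dot x xi) * (phi xi * gaussr e xi)) <= c.
Proof.
move=> e0 mphi phi1 phil cl H.
have mcos : measurable_fun setT (fun xi : 'rV[R]_d => cos (dot x xi)).
  apply: (measurableT_comp (continuous_measurable_fun (@continuous_cos R))).
  exact: measurable_dotr.
pose f_ k (xi : 'rV[R]_d) := cos (dot x xi) * (phi_ k xi * gaussr e xi).
have mf k : measurable_fun setT (f_ k).
  by apply: measurable_funM => //; apply: measurable_funM => //; exact: measurable_gaussr.
have fl xi : setT xi -> f_ k xi @[k --> \oo] --> cos (dot x xi) * (phi xi * gaussr e xi).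
  by move=> _; apply: cvgMr; apply: cvgMl; exact: phil.
have fg k xi : setT xi -> `|f_ k xi| <= gaussr e xi.
  move=> _; rewrite !normrM (ger0_norm (gaussr_ge0 _ _)) mulrA ler_piMl ?gaussr_ge0//.
  by rewrite mulr_ile1// cos_max.
have [_ L] := dominated_cvgR measurableT mf fl (integrable_gaussr d e0) fg.
by apply: (ler_cvg_to (cvgMr L) cl); exact: nearW.
Qed.

Definition stable_partial (a : nat -> R) (delta : R) K (xi : 'rV[R]_d) : R :=
  \sum_(k < K) a k * expR (- (delta * (dot xi xi + M))) ^+ k.

(** The [k]-th power of the multiplier times [gaussr e] is [exp (- k delta M)] times the Gaussian of
    parameter [e + k delta], whose inverse transform is a heat kernel. *)
Lemma stable_partial_transform (a : nat -> R) delta e (x : 'rV[R]_d) K : 0 < e -> 0 < delta ->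
  mu.-integrable setT (EFin \o (fun xi =>
    cos (dot x xi) * (stable_partial a delta K xi * gaussr e xi))) /\
  (2 * pi) ^- d * \int[mu]_xi (cos (dot x xi) * (stable_partial a delta K xi * gaussr e xi)) =
  \sum_(k < K) a k * expR (- (k%:R * delta * M)) * hker d (e + k%:R * delta) (dot x x).
Proof.
move=> e0 d0; elim: K => [|K [i1 i2]].
  rewrite (_ : (fun xi => cos (dot x xi) * (stable_partial a delta 0 xi * gaussr e xi)) = cst 0).
    by rewrite big_ord0 /Rintegral integral0 mulr0; split => //; exact: integrable0.
  by apply/funext => xi; rewrite /stable_partial big_ord0 mul0r mulr0.
have u0 : 0 < e + K%:R * delta by rewrite ltr_wpDr// mulr_ge0// ltW.
have E : (fun xi => cos (dot x xi) * (stable_partial a delta K.+1 xi * gaussr e xi)) =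
  (fun xi => 1 * (cos (dot x xi) * (stable_partial a delta K xi * gaussr e xi)) +
  (a K * expR (- (K%:R * delta * M))) * cgaussr (e + K%:R * delta) 0 x xi).
  apply/funext => xi.
  rewrite /stable_partial big_ord_recr/= mul1r [(_ + _) * gaussr e xi]mulrDl mulrDr; congr (_ + _).
  have G : expR (- (delta * (dot xi xi + M))) ^+ K * gaussr e xi =
      expR (- (K%:R * delta * M)) * gaussr (e + K%:R * delta) xi.
    by rewrite /gaussr -expRM_natl -!expRD; congr expR; ring.
  by rewrite /cgaussr addr0 -[a K * _ * gaussr e xi]mulrA G; ring.
have i3 := integrable_cgaussr 0 x u0.
rewrite E; split; first exact: integrable_lin.
rewrite Rintegral_lin// mul1r mulrDr i2 big_ord_recr/=; congr (_ + _).
by rewrite mulrCA fourier_gaussr// cos0 mul1r.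
Qed.

Lemma stable_partial_bound (a : nat -> R) (C t delta e : R) (x : 'rV[R]_d) K :
  let T := t * delta `^ (- b) in
  0 <= C -> 0 < t -> 0 < delta -> 0 < e -> 0 < dot x x ->
  (forall k, 0 <= a k) -> a 0%N = expR (- T) ->
  (forall k, a k <= C * T `^ (- b^-1)) -> (forall k, a k.+1 <= C * (T * k.+1%:R `^ (- b - 1))) ->
  \sum_(k < K) a k * expR (- (k%:R * delta * M)) * hker d (e + k%:R * delta) (dot x x) <=
  expR (- T) * hker d e (dot x x) +
  C * (4 * 2 ^+ d) * expR (delta * M) * subord_int e t (dot x x).
Proof.
move=> T C0 t0 d0 e0 x0 a0 aT a1 a2.
have CC : 0 <= C * (4 * 2 ^+ d) * expR (delta * M) by rewrite !mulr_ge0 ?expR_ge0 ?exprn_ge0.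
have I0 (J : set (measurableTypeR R)) : 0 <= \int[leb]_(s in J) subord e t (dot x x) s.
  by apply: Rintegral_ge0 => s _; exact: subord_ge0.
case: K => [|K].
  by rewrite big_ord0 addr_ge0 ?mulr_ge0 ?expR_ge0 ?hker_ge0// ?I0.
(* The term [k = 0] escapes [subord_step] and is kept apart; its weight [exp (- T)] vanishes
   later. *)
rewrite big_ord_recl/= aT !mul0r oppr0 expR0 mulr1 addr0 lerD2l.
apply: (@le_trans _ _ (\sum_(k < K) C * (4 * 2 ^+ d) * expR (delta * M) *
    \int[leb]_(s in `]k.+1%:R * delta, k.+2%:R * delta]) subord e t (dot x x) s)).
  by apply: ler_sum => k _; exact: (subord_step e0 t0 x0 d0 C0 erefl).
rewrite -mulr_sumr ler_wpM2l//.
have i := integrable_subord (ltW e0) t0 x0.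
apply: le_trans (sum_itv_le K.+1 d0 (fun s => subord_ge0 _ _ _ t0) i).
(* The cells in use start at [delta]; the missing cell []0, delta]] is nonnegative. *)
by rewrite big_ord_recl/= lerDr I0.
Qed.

Lemma stable_transform_le (C : R) : 0 <= C ->
  (forall T : R, 0 < T -> exists a : nat -> R,
    [/\ forall k, 0 <= a k, a 0%N = expR (- T),
      forall y : R, 0 <= y < 1 -> pseries a y @ \oo --> expR (- (T * (1 - y) `^ b)),
      forall k, a k <= C * T `^ (- b^-1) &
      forall k, a k.+1 <= C * (T * k.+1%:R `^ (- b - 1))]) ->
  forall (t e : R) (x : 'rV[R]_d), 0 < t -> 0 < e -> 0 < dot x x ->
  (2 * pi) ^- d * \int[mu]_xi
    (cos (dot x xi) * (expR (- (t * (dot xi xi + M) `^ b)) * gaussr e xi)) <=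
  C * (4 * 2 ^+ d) * subord_int e t (dot x x).
Proof.
move=> C0 HC t e x t0 e0 x0.
pose z (xi : 'rV[R]_d) := dot xi xi + M.
have z0 xi : 0 < z xi by rewrite ltr_wpDl// dot_ge0.
have mz : measurable_fun setT z by apply: measurable_funD => //; exact: measurable_dotxx.
pose del n : R := n.+1%:R^-1.
have del0 n : 0 < del n by rewrite invr_gt0.
pose T n := t * del n `^ (- b).
have T0 n : 0 < T n by rewrite mulr_gt0// powR_gt0.
pose y n xi := expR (- (del n * z xi)).
have y01 n xi : 0 <= y n xi < 1.
  by rewrite expR_ge0 expR_lt1 oppr_lt0 mulr_gt0.
have my n : measurable_fun setT (y n).
  apply: (measurableT_comp (@measurable_expR R)); apply: measurable_funN.
  exact: measurable_funM.
have step n : (2 * pi) ^- d * \int[mu]_xi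
    (cos (dot x xi) * (expR (- (T n * (1 - y n xi) `^ b)) * gaussr e xi)) <=
    expR (- T n) * hker d e (dot x x) +
    C * (4 * 2 ^+ d) * expR (del n * M) * subord_int e t (dot x x).
  have [a [a0 aT ay a1 a2]] := HC (T n) (T0 n).
  have ylim xi : stable_partial a (del n) K xi @[K --> \oo] --> expR (- (T n * (1 - y n xi) `^ b)).
    have := ay _ (y01 n xi); apply: cvg_trans; apply: near_eq_cvg; apply: nearW => K.
    by rewrite /pseries/series/= big_mkord.
  have nd xi : nondecreasing_seq (fun K => stable_partial a (del n) K xi).
    apply/nondecreasing_seqP => K; rewrite /stable_partial big_ord_recr/= lerDl.
    by rewrite mulr_ge0// exprn_ge0// expR_ge0.
  apply: (transform_limit_le e0 _ _ ylim (cvg_cst _)).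
  - move=> K; apply: measurable_sum => k; apply: measurable_funM => //.
    by apply: measurable_funX; exact: my.
  - move=> K xi; rewrite ger0_norm; last first.
      by apply: sumr_ge0 => k _; rewrite mulr_ge0// exprn_ge0// expR_ge0.
    apply: (@le_trans _ _ (expR (- (T n * (1 - y n xi) `^ b)))).
      rewrite -(cvg_lim _ (ylim xi))//; apply: nondecreasing_cvgn_le => //.
      by apply/cvg_ex; exists (expR (- (T n * (1 - y n xi) `^ b))); exact: ylim.
    by rewrite expR_le1 oppr_le0 mulr_ge0 ?powR_ge0// ltW.
  - move=> K; have [_ ->] := stable_partial_transform a x K e0 (del0 n).
    exact: stable_partial_bound.
apply: (transform_limit_le e0 _ _ _ _ step).
- move=> n; apply: (measurableT_comp (@measurable_expR R)); apply: measurable_funN.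
  apply: measurable_funM => //.
  apply: (measurableT_comp (@measurable_powR R _)).
  exact: measurable_funB.
- move=> n xi; rewrite ger0_norm ?expR_ge0// expR_le1 oppr_le0 mulr_ge0 ?powR_ge0//.
  exact: ltW.
- move=> xi.
  have E n : T n * (1 - y n xi) `^ b = t * ((1 - y n xi) / del n) `^ b.
    rewrite /T -mulrA; congr (_ * _).
    rewrite powRM ?invr_ge0 ?(ltW (del0 n))//; last by rewrite subr_ge0 ltW//; case/andP: (y01 n xi).
    by rewrite -powR_inv1 ?(ltW (del0 n))// -powRrM mulN1r mulrC.
  under eq_fun do rewrite E.
  (* The squeeze [z / (1 + delta z) <= (1 - exp (- delta z)) / delta <= z] uses [1 + u <= exp u] at
     both signs. *)
  have L : (1 - y n xi) / del n @[n --> \oo] --> z xi.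
    apply: (@squeeze_cvgr _ _ _ _ (fun n => z xi / (1 + del n * z xi)) (cst (z xi))).
    + apply: nearW => n; have dz : 0 < del n * z xi by rewrite mulr_gt0.
      have e1 := expR_ge1Dx (- (del n * z xi)); have e2 := expR_ge1Dx (del n * z xi).
      apply/andP; split; last by rewrite /= ler_pdivrMr// mulrC /y; lra.
      rewrite ler_pdivlMr// mulrAC ler_pdivrMr ?addr_gt0// /y expRN.
      have e0' : 0 < expR (del n * z xi) by exact: expR_gt0.
      rewrite [z xi * _]mulrC.
      have : (1 + del n * z xi) / expR (del n * z xi) <= 1.
        by rewrite ler_pdivrMr// mul1r.
      by move: (_^-1) => i; nra.
    + rewrite -[X in _ --> X](_ : z xi / (1 + 0 * z xi) = _); last by rewrite mul0r addr0 divr1.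
      apply: cvgMr; apply: cvgV; first by rewrite mul0r addr0 oner_eq0.
      by apply: cvgD; [exact: cvg_cst|apply: cvgMl; exact: cvg_harmonic].
    + exact: cvg_cst.
  have cpow : {for z xi, continuous (fun u : R => expR (- (t * u `^ b)))}.
    apply/differentiable_continuous/derivable1_diffP.
    by have := is_derive1_powR b (z0 xi) => ?; apply: ex_derive.
  exact: (continuous_cvg _ cpow L).
- have -> : C * (4 * 2 ^+ d) * subord_int e t (dot x x) =
     0 * hker d e (dot x x) + C * (4 * 2 ^+ d) * expR (0 * M) * subord_int e t (dot x x).
    by rewrite !mul0r expR0 mulr1 add0r.
  (* [powR_le_expR] with exponent [1 / b] makes this at most a constant times [T ^ (- 1 / b)], which
     is linear in [del n]. *)
  have eT : expR (- T n) @[n --> \oo] --> 0.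
    have bV : 0 < b^-1 by rewrite invr_gt0.
    apply: (@squeeze_cvgr _ _ _ _ (cst 0) (fun n => b^-1 `^ b^-1 * t `^ (- b^-1) * del n)).
    + apply: nearW => n; rewrite expR_ge0/=.
      have := powR_le_expR bV (ltW (T0 n)) => H.
      rewrite expRN -[leLHS]mul1r ler_pdivrMr ?expR_gt0//.
      have TT : T n `^ (- b^-1) = t `^ (- b^-1) * del n.
        rewrite /T powRM ?powR_ge0 ?(ltW t0)//; congr (_ * _).
        by rewrite -powRrM mulrNN mulfV ?gt_eqF// powRr1// ltW.
      rewrite -mulrA -TT mulrAC powRN ler_pdivlMr ?powR_gt0// mul1r.
      exact: H.
    + exact: cvg_cst.
    + rewrite -[X in _ --> X](mulr0 (b^-1 `^ b^-1 * t `^ (- b^-1))).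
      by apply: cvgMr; exact: cvg_harmonic.
  apply: cvgD; first exact: cvgMl.
  apply: cvgMl; apply: cvgMr.
  have L : del n * M @[n --> \oo] --> 0 * M by apply: cvgMl; exact: cvg_harmonic.
  exact: (continuous_cvg _ (@continuous_expR R _) L).
Qed.

End subordination.

(** * The resolvent kernel *)

Section integral_bounds.
Context {R : realType}.
Notation leb := (@lebesgue_measure R).

(* [f] need not be measurable: a heat kernel is not known to be measurable in time. *)
Lemma ge0_majorized_integral d (T : measurableType d) (mu : {measure set T -> \bar R})
    (D : set T) (f g : T -> \bar R) :
  (forall x, D x -> (0 <= g x)%E) -> (forall x, D x -> (f x <= g x)%E) ->
  (\int[mu]_(x in D) f x <= \int[mu]_(x in D) g x)%E.
Proof.
move=> g0 fg; rewrite integralE.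
apply: (@le_trans _ _ (\int[mu]_(x in D) (f ^\+)%E x)%E).
  rewrite geeDl// oppe_le0; apply: integral_ge0 => x _; exact: funeneg_ge0.
rewrite !ge0_integralE//.
apply: le_ereal_sup => _ /= [h hf <-]; exists h => //= x.
apply: le_trans (hf x) _; apply: lee_restrict => y Dy.
by rewrite funeposE ge_max fg// g0.
Qed.

Lemma ge0_integral_itv_split (f : R -> R) (a c : R) : a <= c ->
  measurable_fun (`]a, +oo[%classic : set (measurableTypeR R)) f ->
  (forall s, a < s -> 0 <= f s) ->
  (\int[leb]_(s in `]a, +oo[) (f s)%:E =
   \int[leb]_(s in `]a, c]) (f s)%:E + \int[leb]_(s in `]c, +oo[) (f s)%:E)%E.
Proof.
move=> ac mf f0.
have E : `]a, +oo[%classic = `]a, c] `|` `]c, +oo[ :> set R.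
  by apply: (@itv_bndbnd_setU _ _ (BRight a) (BRight c)); rewrite ?bnd_simp.
rewrite [in LHS]E ge0_integral_setU//.
- by rewrite -E; exact/measurable_EFinP.
- by rewrite -E => s; rewrite /= in_itv/= andbT lee_fin => /f0.
- by apply/disj_setPS => x [] /=; rewrite !in_itv/= andbT => /andP[_] /le_lt_trans h /h; rewrite ltxx.
Qed.

Lemma is_derive_powR_primitive (c x : R) : c + 1 != 0 -> 0 < x ->
  is_derive x 1 (fun s => s `^ (c + 1) / (c + 1)) (x `^ c).
Proof.
move=> c1 x0; have H := is_derive1_powR (c + 1) x0.
apply: is_derive_eq.
by rewrite /GRing.scale/= addrK !mulr0 add0r mulKf.
Qed.

Lemma powRD_gt0 (a x y : R) : 0 < a -> a `^ x * a `^ y = a `^ (x + y).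
Proof. by move=> a0; rewrite powRD//; apply/implyP => _; rewrite gt_eqF. Qed.

Lemma continuous_powR_gt0 (c x : R) : 0 < x -> {for x, continuous (fun s : R => s `^ c)}.
Proof.
move=> x0; apply/differentiable_continuous/derivable1_diffP.
by have := is_derive1_powR c x0 => ?; apply: ex_derive.
Qed.

(** The primitive stays abstract so that the exponent -1, with its logarithm, is covered as well. *)
Lemma integral_powR_itv_le (F : R -> R) (a c : R) : 0 < a -> a <= 1 ->
  (forall x : R, 0 < x -> is_derive x 1 F (x `^ c)) ->
  (\int[leb]_(s in `[a, 1%R]) (s `^ c)%:E <= (F 1 - F a)%:E)%E.
Proof.
move=> a0; rewrite le_eqVlt => /predU1P[->|a1] dF.
  by rewrite set_itv1 (@integral_Sset1 _ _ _ 1) ?subrr.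
have cF (x : R) : 0 < x -> {for x, continuous F}.
  by move=> x0; apply/differentiable_continuous/derivable1_diffP; have [] := dF x x0.
rewrite (@continuous_FTC2 _ _ F) ?EFinB//.
- apply: continuous_in_subspaceT => x; rewrite inE/= in_itv/= => /andP[ax _].
  exact/continuous_powR_gt0/(lt_le_trans a0).
- split.
  + by move=> x; rewrite in_itv/= => /andP[ax _]; have [] := dF x (lt_trans a0 ax).
  + exact/cvg_at_right_filter/cF.
  + exact/cvg_at_left_filter/cF.
- by move=> x; rewrite in_itv/= => /andP[ax _]; rewrite derive1E; have [_ ->] := dF x (lt_trans a0 ax).
Qed.

Lemma integral_powR_tail (a c : R) : 0 < a -> c + 1 < 0 ->
  (\int[leb]_(s in `[a, +oo[) (s `^ c)%:E = (a `^ (c + 1) / - (c + 1))%:E)%E.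
Proof.
move=> a0 c1; have c0 : c + 1 != 0 by rewrite lt_eqF.
have dF (x : R) : 0 < x -> is_derive x 1 (fun s => s `^ (c + 1) / (c + 1)) (x `^ c).
  exact: is_derive_powR_primitive.
rewrite (@ge0_continuous_FTC2y _ _ (fun s => s `^ (c + 1) / (c + 1)) a 0).
- by rewrite -EFinB sub0r invrN mulrN.
- by move=> x _; exact: powR_ge0.
- apply: continuous_in_subspaceT => x; rewrite inE/= in_itv/= andbT => ax.
  exact/continuous_powR_gt0/(lt_le_trans a0).
- rewrite -[X in _ --> X](mul0r (c + 1)^-1); apply: cvgMl.
  apply/cvgrPdist_le => e e0; near=> s.
  rewrite sub0r normrN ger0_norm ?powR_ge0//.
  have se : e `^ (c + 1)^-1 <= s by near: s; exact: nbhs_pinfty_ge.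
  have E : e = (e `^ (c + 1)^-1) `^ (c + 1) by rewrite -powRrM mulVf// powRr1// ltW.
  have y0 : 0 < e `^ (c + 1)^-1 by rewrite powR_gt0.
  rewrite [leRHS]E; move: (e `^ _) y0 se => y y0 ys.
  have s0 : 0 < s by exact: lt_le_trans ys.
  have VE (x : R) : x `^ (c + 1) = (x `^ (- (c + 1)))^-1 by rewrite -powRN opprK.
  rewrite !VE lef_pV2 ?posrE ?powR_gt0//.
  by rewrite ge0_ler_powR ?nnegrE ?(ltW y0) ?(ltW s0) ?oppr_ge0 ?(ltW c1).
- by move=> x ax; have [] := dF x (lt_trans a0 ax).
- apply: cvg_at_right_filter.
  by apply: cvgMl; exact: continuous_powR_gt0.
- by move=> x; rewrite in_itv/= andbT => ax; rewrite derive1E; have [_ ->] := dF x (lt_trans a0 ax).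
Unshelve. all: by end_near. Qed.

Lemma powR_expRN_bound (q a s : R) : 0 < q -> 0 < a -> 0 < s ->
  s `^ (- q) * expR (- (a / s)) <= q `^ q * a `^ (- q).
Proof.
move=> q0 a0 s0; have as0 : 0 < a / s by rewrite divr_gt0.
have H := powR_le_expR q0 (ltW as0).
rewrite expRN ler_pdivrMr ?expR_gt0//.
have -> : s `^ (- q) = a `^ (- q) * (a / s) `^ q.
  have [u uE] := expR_total a0; have [v vE] := expR_total s0.
  by rewrite -uE -vE -expRN -expRD -!expRM -expRD; congr expR; ring.
by rewrite [q `^ q * _]mulrC -mulrA ler_wpM2l// powR_ge0.
Qed.

End integral_bounds.

(** * Integration over time *)

Section resolvent_estimate.
Context {R : realType} (d : nat) (b M : R).
Hypotheses (hd : (1 <= d)%N) (b01 : 0 < b < 1) (M0 : 0 < M).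
Notation leb := (@lebesgue_measure R).

Let b0 : 0 < b. Proof. by case/andP: b01. Qed.
Let b1 : b < 1. Proof. by case/andP: b01. Qed.

Let measurable_expRN (q : R) : measurable_fun setT (fun t : measurableTypeR R => expR (- (q * t))).
Proof.
apply: continuous_measurable_fun => x; apply: continuous_comp; last exact: continuous_expR.
by apply: cvgN; apply: cvgMr.
Qed.

Lemma integral_omega_le (q : R) : 0 < q -> exists C : R, 0 <= C /\ forall s : R, 0 < s ->
  (\int[leb]_(t in `]0%R, +oo[) (expR (- (q * t)) * omega b t s)%:E <=
  (C * Num.min (s `^ (- b - 1)) (s `^ (b - 1)))%:E)%E.
Proof.
move=> q0; have q20 : 0 < q / 2 by rewrite divr_gt0.
have bV : - b^-1 + 1 < 0 by rewrite addrC subr_lt0 invf_gt1.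
(* Half of the decay absorbs the factor [t] of the first branch of [omega], as
   [t <= 2 / q * exp (q t / 2)]. *)
pose C1 := 2 / q * \int[leb]_(t in `]0%R, +oo[) expR (- (q / 2 * t)).
pose C2 := 1 + (- (- b^-1 + 1))^-1.
have C20 : 0 <= C2 by rewrite addr_ge0// invr_ge0 oppr_ge0 ltW.
have C10 : 0 <= C1.
  by rewrite mulr_ge0 ?divr_ge0 ?(ltW q0)//; apply: Rintegral_ge0 => t _; exact: expR_ge0.
exists (Num.max C1 C2); split; first by rewrite le_max C10.
move=> s s0.
have mom : measurable_fun setT (fun t : measurableTypeR R => omega b t s).
  apply: measurable_minr; first exact: measurable_funM.
  exact: measurable_powR.
have mf : measurable_fun (`]0, +oo[%classic : set (measurableTypeR R))
    (fun t => expR (- (q * t)) * omega b t s).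
  by apply: measurable_funTS; apply: measurable_funM.
have f0 t : 0 < t -> 0 <= expR (- (q * t)) * omega b t s.
  by move=> t0; rewrite mulr_ge0 ?expR_ge0 ?omega_ge0.
rewrite minr_pMr ?le_max ?C10// EFin_min le_min; apply/andP; split.
  have iE := integrable_expRN q20.
  apply: (@le_trans _ _ (\int[leb]_(t in `]0%R, +oo[)
      ((2 / q * s `^ (- b - 1))%:E * (expR (- (q / 2 * t)))%:E))%E).
    apply: ge0_majorized_integral => t; rewrite /= in_itv/= andbT => t0.
      by rewrite -EFinM lee_fin !mulr_ge0 ?powR_ge0 ?expR_ge0 ?invr_ge0// ltW.
    rewrite -EFinM lee_fin.
    apply: (@le_trans _ _ (expR (- (q * t)) * (t * s `^ (- b - 1)))).
      by rewrite ler_wpM2l ?expR_ge0// ge_min lexx.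
    have -> : expR (- (q * t)) = expR (- (q / 2 * t)) * expR (- (q / 2 * t)).
      by rewrite -expRD; congr expR; field.
    rewrite [leLHS](_ : _ = t * expR (- (q / 2 * t)) * (s `^ (- b - 1) * expR (- (q / 2 * t)))); last by ring.
    rewrite -[leRHS]mulrA ler_wpM2r ?mulr_ge0 ?powR_ge0 ?expR_ge0// expRN ler_pdivrMr ?expR_gt0//.
    have H := expR_ge1Dx (q / 2 * t).
    rewrite -ler_pdivrMl ?divr_gt0// invf_div; apply: le_trans H.
    by rewrite lerDr.
  rewrite integralZl//.
  have -> : (\int[leb]_(t in `]0%R, +oo[) (expR (- (q / 2 * t)))%:E =
      (\int[leb]_(t in `]0%R, +oo[) expR (- (q / 2 * t)))%:E)%E.
    by rewrite /Rintegral fineK//; apply: integrable_fin_num.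
  rewrite -EFinM lee_fin mulrAC -/C1 ler_wpM2r ?powR_ge0//.
  by rewrite le_max lexx.
have sb0 : 0 < s `^ b by rewrite powR_gt0.
(* The branches of [omega] cross at [t = s ^ b], with common value [s ^ (- 1)]. Below, the length
   [s ^ b] times this value gives [s ^ (b - 1)]; above, the tail of [t ^ (- 1 / b)] has the same
   order. *)
rewrite (@ge0_integral_itv_split _ _ 0 (s `^ b))//; last exact: ltW.
apply: (@le_trans _ _ ((s `^ (b - 1))%:E + (s `^ (b - 1) * (- (- b^-1 + 1))^-1)%:E)%E).
  apply: leeD.
    have -> : (s `^ (b - 1))%:E = (\int[leb]_(t in `]0%R, (s `^ b)%R]) (cst (s `^ (- 1))%:E) t)%E.
      rewrite integral_cst//= lebesgue_measure_itv/= lte_fin sb0 sube0.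
      by rewrite -EFinM; congr EFin; rewrite powRD_gt0// addrC.
    apply: ge0_majorized_integral => t; rewrite /= in_itv/= => /andP[t0 tsb].
      by rewrite lee_fin powR_ge0.
    rewrite lee_fin -[leRHS]mul1r; apply: ler_pM; rewrite ?expR_ge0 ?omega_ge0//.
      by rewrite expR_le1 oppr_le0 mulr_ge0 ?ltW.
    apply: (@le_trans _ _ (s `^ b * s `^ (- b - 1))).
      by rewrite /omega ge_min ler_wpM2r ?powR_ge0.
    by rewrite powRD_gt0// addrA subrr add0r.
  have -> : (s `^ (b - 1) * (- (- b^-1 + 1))^-1)%:E =
      (\int[leb]_(t in `[(s `^ b)%R, +oo[) (t `^ (- b^-1))%:E)%E.
    rewrite integral_powR_tail// -powRrM; congr (_ `^ _ * _)%:E.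
    by field; rewrite gt_eqF.
  rewrite -integral_itv_obnd_cbnd; last first.
    by apply/measurable_EFinP; apply: measurable_funTS; exact: measurable_powR.
  apply: ge0_majorized_integral => t; rewrite /= in_itv/= andbT => t0.
    by rewrite lee_fin powR_ge0.
  have {}t0 : 0 < t := lt_trans sb0 t0.
  rewrite lee_fin -[leRHS]mul1r; apply: ler_pM; rewrite ?expR_ge0 ?omega_ge0//.
    by rewrite expR_le1 oppr_le0 mulr_ge0 ?ltW.
  by rewrite /omega ge_min lexx orbT.
rewrite -EFinD lee_fin -[X in X + _]mulr1 -mulrDr -/C2 mulrC ler_wpM2r ?powR_ge0//.
by rewrite le_max lexx orbT.
Qed.

Definition resolvent_ker (r s : R) : R :=
  hker d s r * expR (- (M * s)) * Num.min (s `^ (- b - 1)) (s `^ (b - 1)).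

(** Tonelli exchanges the integrals in [t] and [s], and [integral_omega_le] bounds the inner one.
    The first conjunct, from the same construction, is what later allows a constant to be moved into
    the integral. *)
Lemma integral_subord_le (q : R) : 0 < q -> exists C : R, 0 <= C /\ forall r : R, 0 < r ->
  measurable_fun (`]0, +oo[%classic : set (measurableTypeR R))
    (fun t => expR (- (q * t)) * subord_int d b M 0 t r) /\
  (\int[leb]_(t in `]0%R, +oo[) (expR (- (q * t)) * subord_int d b M 0 t r)%:E <=
  C%:E * \int[leb]_(s in `]0%R, +oo[) (resolvent_ker r s)%:E)%E.
Proof.
move=> q0; have [C [C0 HC]] := integral_omega_le q0.
exists C; split => // r r0.
pose D := (`]0, +oo[%classic : set (measurableTypeR R)).
have mD : measurable D by exact: measurable_itv.
(* Both factors are cut off to the half-line so that Tonelli can be applied on the whole plane. *)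
pose A : measurableTypeR R -> R := (fun t => expR (- (q * t))) \_ D.
pose B : measurableTypeR R -> R := (fun s => hker d s r * expR (- (M * s))) \_ D.
have B1 : measurable_fun D (fun s => hker d s r * expR (- (M * s))).
  apply: measurable_funM; last exact: measurable_funTS.
  have := @measurable_hker R d 0 r (lexx 0).
  by apply: eq_measurable_fun => s _; rewrite add0r.
have A1 : measurable_fun D (fun t => expR (- (q * t))) by exact: measurable_funTS.
have mA : measurable_fun setT A.
  exact: (measurable_restrictT (fun t : measurableTypeR R => expR (- (q * t))) mD).1 A1.
have mB : measurable_fun setT B.
  exact: (measurable_restrictT
    (fun s : measurableTypeR R => hker d s r * expR (- (M * s))) mD).1 B1.
have mom : measurable_fun setT (fun x : measurableTypeR R * measurableTypeR R => omega b x.1 x.2).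
  apply: measurable_minr.
    apply: measurable_funM; first exact: measurable_fst.
    by apply: (measurableT_comp (@measurable_powR R _)); exact: measurable_snd.
  by apply: (measurableT_comp (@measurable_powR R _)); exact: measurable_fst.
pose F (x : measurableTypeR R * measurableTypeR R) : \bar R := (A x.1 * B x.2 * omega b x.1 x.2)%:E.
have DE (t : measurableTypeR R) : (t \in D) = (0 < t).
  by apply/idP/idP; rewrite inE /D /= in_itv/= andbT.
have AE t : 0 < t -> A t = expR (- (q * t)) by move=> t0; rewrite /A patchE DE t0.
have BE s : 0 < s -> B s = hker d s r * expR (- (M * s)) by move=> s0; rewrite /B patchE DE s0.
have A0 t : t <= 0 -> A t = 0 by move=> t0; rewrite /A patchE DE ltNge t0.
have B0 s : s <= 0 -> B s = 0 by move=> s0; rewrite /B patchE DE ltNge s0.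
have A_ge0 t : 0 <= A t by have [/A0->//|/AE->] := leP t 0; exact: expR_ge0.
have B_ge0 s : 0 <= B s by have [/B0->//|/BE->] := leP s 0; rewrite mulr_ge0 ?hker_ge0 ?expR_ge0.
have mF : measurable_fun setT F.
  apply/measurable_EFinP; apply: measurable_funM => //; apply: measurable_funM.
    by apply: (measurableT_comp mA); exact: measurable_fst.
  by apply: (measurableT_comp mB); exact: measurable_snd.
have F0 x : (0 <= F x)%E.
  rewrite lee_fin; have [/A0->|x0] := leP x.1 0; first by rewrite !mul0r.
  by rewrite !mulr_ge0 ?omega_ge0.
have E1 t : ((fun t => (expR (- (q * t)) * subord_int d b M 0 t r)%:E) \_ D) t =
    (\int[leb]_s F (t, s))%E.
  rewrite patchE DE; case: ifPn => [|nt].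
    move=> t0.
    have i : leb.-integrable D (EFin \o subord d b M 0 t r) by exact: integrable_subord.
    have -> : subord_int d b M 0 t r = fine (\int[leb]_(s in D) (subord d b M 0 t r s)%:E)%E by [].
    rewrite EFinM fineK; last exact: integrable_fin_num.
    rewrite -integralZl// integral_mkcond; apply: eq_integral => s _.
  rewrite patchE DE; case: ifPn => [|ns].
      move=> s0.
      by rewrite /F /= AE// BE// /subord add0r -EFinM !mulrA.
    by rewrite /F/= B0 ?mulr0 ?mul0r// leNgt.
  by rewrite integral0_eq// => s _; rewrite /F/= A0 ?mul0r// leNgt.
split.
  apply/measurable_EFinP; apply: (measurable_restrictT (fun t : measurableTypeR R =>
    (expR (- (q * t)) * subord_int d b M 0 t r)%:E) mD).2.
  rewrite [X in measurable_fun _ X](_ : _ = fubini_F leb F); last exact/funext.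
  exact: measurable_fun_fubini_tonelli_F.
rewrite [leLHS]integral_mkcond (eq_integral _ _ (fun t _ => E1 t)) fubini_tonelli//.
have E2 s : (\int[leb]_t F (t, s) = (B s)%:E * \int[leb]_(t in D) (expR (- (q * t)) * omega b t s)%:E)%E.
  rewrite -ge0_integralZl//.
  - rewrite [RHS]integral_mkcond; apply: eq_integral => t _.
    rewrite patchE DE; case: ifPn => [|nt].
      by move=> t0; rewrite /F/= AE// -EFinM mulrA [B s * _]mulrC.
    by rewrite /F/= A0 ?mul0r// leNgt.
  - apply/measurable_EFinP; apply: measurable_funTS; apply: measurable_funM => //.
    apply: measurable_minr; first exact: measurable_funM.
    exact: measurable_powR.
  - by move=> t /mem_set; rewrite DE => t0; rewrite lee_fin mulr_ge0 ?expR_ge0 ?omega_ge0.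
  - by rewrite lee_fin.
under eq_integral do rewrite E2.
rewrite -ge0_integralZl//; last 2 first.
- apply/measurable_EFinP; apply: measurable_funM => //.
  apply: measurable_funTS; apply: measurable_minr; exact: measurable_powR.
- move=> s; rewrite /= in_itv/= andbT => s0; rewrite lee_fin mulr_ge0 ?mulr_ge0 ?hker_ge0 ?expR_ge0//.
  by rewrite le_min !powR_ge0.
rewrite [leRHS]integral_mkcond; apply: ge0_majorized_integral => s _; rewrite patchE DE; case: ifPn.
- move=> s0; rewrite -EFinM lee_fin mulr_ge0// !mulr_ge0 ?hker_ge0 ?expR_ge0//.
  by rewrite le_min !powR_ge0.
- by [].
- move=> s0; rewrite BE//.
  apply: (le_trans (lee_wpmul2l _ (HC s s0))); first by rewrite lee_fin mulr_ge0 ?hker_ge0 ?expR_ge0.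
  by rewrite -!EFinM lee_fin /resolvent_ker mulrCA.
- move=> ns; by rewrite B0 ?mul0e// leNgt.
Qed.

End resolvent_estimate.

(** * Estimates of the time-integrated majorant *)

Section resolvent_kernel_bound.
Context {R : realType} (d : nat) (b M : R).
Hypotheses (hd : (1 <= d)%N) (b01 : 0 < b < 1) (M0 : 0 < M).
Notation leb := (@lebesgue_measure R).
Notation d2 := (d%:R / 2 : R).

Let b0 : 0 < b. Proof. by case/andP: b01. Qed.
Let b1 : b < 1. Proof. by case/andP: b01. Qed.
Let d20 : 0 < d2. Proof. by rewrite divr_gt0// ltr0n. Qed.

Lemma hker_le_powR (a s : R) : 0 < s ->
  hker d s a <= s `^ (- d2) * expR (- (a / 4 / s)).
Proof.
move=> s0; have p2 := @pi_ge2 R.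
have s4 : s <= 4 * pi * s by rewrite ler_peMl ?(ltW s0)//; lra.
rewrite /hker; have -> : a / (4 * s) = a / 4 / s by rewrite invfM mulrA.
rewrite ler_wpM2r ?expR_ge0// sqrt_powR ?(le_trans (ltW s0))// powRN.
rewrite lef_pV2 ?posrE ?powR_gt0 ?(lt_le_trans s0)//.
by rewrite ge0_ler_powR ?nnegrE ?(ltW s0) ?(ltW d20) ?(le_trans (ltW s0)).
Qed.

Lemma resolvent_ker_ge0 a s : 0 <= resolvent_ker d b M a s.
Proof. by rewrite !mulr_ge0 ?hker_ge0 ?expR_ge0// le_min !powR_ge0. Qed.

Lemma measurable_resolvent_ker a :
  measurable_fun (`]0, +oo[%classic : set (measurableTypeR R)) (resolvent_ker d b M a).
Proof.
apply: measurable_funM; last first.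
  by apply: measurable_funTS; apply: measurable_minr; exact: measurable_powR.
apply: measurable_funM.
  have := @measurable_hker R d 0 a (lexx 0).
  by apply: eq_measurable_fun => s _; rewrite add0r.
apply: measurable_funTS; apply: continuous_measurable_fun => x.
apply: continuous_comp; last exact: continuous_expR.
by apply: cvgN; apply: cvgMr.
Qed.

Lemma resolvent_ker_le a s : 0 < s ->
  resolvent_ker d b M a s <= s `^ (- d2) * expR (- (a / 4 / s)) * expR (- (M * s)) *
    Num.min (s `^ (- b - 1)) (s `^ (b - 1)).
Proof.
move=> s0; rewrite ler_wpM2r ?le_min ?powR_ge0// ler_wpM2r ?expR_ge0//.
exact: hker_le_powR.
Qed.

(** Meant for [s <= a]: the Gaussian exponential absorbs the singularity [s ^ (b - 1 - d2)] and
    leaves a bound constant in [s]. *)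
Lemma resolvent_ker_le_small a s : 0 < a -> 0 < s ->
  resolvent_ker d b M a s <=
  (1 + d2 - b) `^ (1 + d2 - b) * (a / 4) `^ (- (1 + d2 - b)).
Proof.
move=> a0 s0; apply: le_trans (resolvent_ker_le _ s0) _.
have q0 : 0 < 1 + d2 - b by rewrite addrAC addr_gt0// subr_gt0.
have a4 : 0 < a / 4 by rewrite divr_gt0.
apply: le_trans (powR_expRN_bound q0 a4 s0).
have -> : s `^ (- (1 + d2 - b)) = s `^ (- d2) * s `^ (b - 1).
  by rewrite powRD_gt0//; congr (_ `^ _); ring.
rewrite -!mulrA ler_wpM2l ?powR_ge0// [leRHS]mulrC ler_wpM2l ?expR_ge0//.
rewrite -[leRHS]mul1r; apply: ler_pM; rewrite ?expR_ge0 ?le_min ?powR_ge0//.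
  by rewrite expR_le1 oppr_le0 mulr_ge0 ?ltW.
by rewrite ge_min lexx orbT.
Qed.

Lemma resolvent_ker_le_middle a s : 0 < a -> 0 < s ->
  resolvent_ker d b M a s <= s `^ (b - 1 - d2).
Proof.
move=> a0 s0; apply: le_trans (resolvent_ker_le _ s0) _.
have -> : s `^ (b - 1 - d2) = s `^ (- d2) * s `^ (b - 1).
  by rewrite powRD_gt0// addrC.
apply: ler_pM; rewrite ?le_min ?mulr_ge0 ?expR_ge0 ?powR_ge0//.
  rewrite -mulrA ler_piMr ?powR_ge0// mulr_ile1 ?expR_ge0 ?expR_le1 ?oppr_le0//.
    by rewrite !divr_ge0// ltW.
  by rewrite mulr_ge0 ?ltW.
by rewrite ge_min lexx orbT.
Qed.

(** The other branch of the minimum with both exponentials kept: it is integrable on [[1, +oo)], and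
    as it stands it is a Bessel integrand up to scaling. *)
Lemma resolvent_ker_le_large a s : 0 < a -> 0 < s ->
  resolvent_ker d b M a s <= s `^ (- (b + d2) - 1) * expR (- (M * s) - a / (4 * s)).
Proof.
move=> a0 s0; apply: le_trans (resolvent_ker_le _ s0) _.
have -> : s `^ (- (b + d2) - 1) = s `^ (- d2) * s `^ (- b - 1).
  by rewrite powRD_gt0//; congr (_ `^ _); ring.
rewrite expRD; have -> : a / (4 * s) = a / 4 / s by rewrite invfM mulrA.
apply: (@le_trans _ _ (s `^ (- d2) * expR (- (a / 4 / s)) * expR (- (M * s)) * s `^ (- b - 1))).
  by rewrite ler_wpM2l ?mulr_ge0 ?expR_ge0 ?powR_ge0// ge_min lexx.
by rewrite le_eqVlt; apply/orP; left; apply/eqP; ring.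
Qed.

(** Here [a] is the squared norm, and the three summands come from []0, a]], []a, 1]] and []1,
    +oo[]. The primitive [F] is a parameter because the middle exponent is -1 when [alpha = d]. *)
Lemma integral_resolvent_ker_le1 (F : R -> R) (a : R) : 0 < a -> a <= 1 ->
  (forall x : R, 0 < x -> is_derive x 1 F (x `^ (b - 1 - d2))) ->
  (\int[leb]_(s in `]0%R, +oo[) (resolvent_ker d b M a s)%:E <=
  ((1 + d2 - b) `^ (1 + d2 - b) * 4^-1 `^ (- (1 + d2 - b)) * a `^ (b - d2) + (F 1 - F a) +
   (b + d2)^-1)%:E)%E.
Proof.
move=> a0 a1 dF.
have mk := measurable_resolvent_ker a.
rewrite (@ge0_integral_itv_split _ _ 0 a) ?(ltW a0)//; last first.
  by move=> s _; exact: resolvent_ker_ge0.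
rewrite (@ge0_integral_itv_split _ _ a 1)//; last 2 first.
- apply: measurable_funS mk => //.
  by move=> s /=; rewrite !in_itv/= !andbT; exact: lt_trans.
- by move=> s _; exact: resolvent_ker_ge0.
rewrite [X in (_ <= X)%E]EFinD [X in (_ <= X + _)%E]EFinD -[X in (_ <= X)%E]addeA; apply: leeD; last apply: leeD.
- apply: (@le_trans _ _ (\int[leb]_(s in `]0%R, a])
    (cst ((1 + d2 - b) `^ (1 + d2 - b) * (a / 4) `^ (- (1 + d2 - b)))%:E) s)%E).
    apply: ge0_majorized_integral => s; rewrite /= in_itv/= => /andP[s0 _].
      by rewrite lee_fin mulr_ge0 ?powR_ge0.
    by rewrite lee_fin resolvent_ker_le_small.
  rewrite integral_cst//= lebesgue_measure_itv/= lte_fin a0 sube0 -EFinM lee_fin.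
  rewrite powRM ?(ltW a0)// -!mulrA ler_wpM2l ?powR_ge0// mulrCA ler_wpM2l ?powR_ge0//.
  by rewrite -[X in _ * X](@powRr1 _ a) ?(ltW a0)// powRD_gt0// (_ : _ + 1 = b - d2)//; ring.
- apply: le_trans (integral_powR_itv_le a0 a1 dF).
  rewrite -integral_itv_obnd_cbnd; last first.
    by apply/measurable_EFinP; apply: measurable_funTS; exact: measurable_powR.
  apply: ge0_majorized_integral => s; rewrite /= in_itv/= => /andP[/(lt_trans a0) s0 _].
    by rewrite lee_fin powR_ge0.
  by rewrite lee_fin resolvent_ker_le_middle.
- have -> : ((b + d2)^-1)%:E = (\int[leb]_(s in `[1%R, +oo[) (s `^ (- (b + d2) - 1))%:E)%E.
    have bd : 0 < b + d2 by rewrite addr_gt0.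
    rewrite integral_powR_tail ?subrK ?oppr_lt0// powR1 opprK.
    by rewrite mul1r.
  rewrite -integral_itv_obnd_cbnd; last first.
    by apply/measurable_EFinP; apply: measurable_funTS; exact: measurable_powR.
  apply: ge0_majorized_integral => s; rewrite /= in_itv/= andbT => s1.
    by rewrite lee_fin powR_ge0.
  have s0 : 0 < s := lt_trans ltr01 s1.
  rewrite lee_fin; apply: le_trans (resolvent_ker_le_large a0 s0) _.
  rewrite ler_piMr ?powR_ge0// expR_le1 -opprD oppr_le0.
  by rewrite addr_ge0 ?divr_ge0 ?mulr_ge0 ?ltW.
Qed.

End resolvent_kernel_bound.

(** * The Bessel integral and its rescaling *)

Section bessel_substitution.
Context {R : realType}.
Notation leb := (@lebesgue_measure R).
Variables (rho z : R).
Hypotheses (rho0 : 0 < rho) (z0 : 0 < z).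

Definition bessel_integrand (u : R) : R := u `^ (- rho - 1) * expR (- u - z ^+ 2 / (4 * u)).

Lemma bessel_integrand_ge0 u : 0 <= bessel_integrand u.
Proof. by rewrite mulr_ge0 ?powR_ge0 ?expR_ge0. Qed.

Let z4 : 0 < z ^+ 2 / 4. Proof. by rewrite divr_gt0 ?exprn_gt0. Qed.

(** Any power of [u] can be gained from [exp (- z ^ 2 / (4 u))]: [n = 0] serves integrability,
    [n = 1] continuity at 0. *)
Lemma bessel_integrand_le (n : nat) : exists C : R, 0 <= C /\
  forall u, 0 < u -> bessel_integrand u <= C * u ^+ n * expR (- u).
Proof.
have q0 : 0 < rho + 1 + n%:R by apply: ltr_wpDr => //; rewrite addr_gt0.
exists ((rho + 1 + n%:R) `^ (rho + 1 + n%:R) * (z ^+ 2 / 4) `^ (- (rho + 1 + n%:R))).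
split; first by rewrite mulr_ge0 ?powR_ge0.
move=> u u0; rewrite /bessel_integrand [- u - _]addrC expRD mulrA ler_wpM2r ?expR_ge0//.
apply: le_trans (ler_wpM2r _ (powR_expRN_bound q0 z4 u0)); last by rewrite exprn_ge0// ltW.
rewrite -[u ^+ n]powR_mulrn ?(ltW u0)// [leRHS]mulrAC powRD_gt0//.
have -> : - (rho + 1 + n%:R) + n%:R = - rho - 1 by ring.
by rewrite invfM mulrA.
Qed.

Lemma continuous_bessel_integrand (u : R) : 0 < u -> {for u, continuous bessel_integrand}.
Proof.
move=> u0; apply: cvgM; first exact: continuous_powR_gt0.
have H : - v - z ^+ 2 / (4 * v) @[v --> u] --> - u - z ^+ 2 / (4 * u).
  apply: cvgB; first exact: cvgN.
  by apply: cvgMr; apply: cvgV; [rewrite gt_eqF// mulr_gt0|exact: cvgMr].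
exact: (continuous_cvg _ (@continuous_expR R _) H).
Qed.

Lemma integrable_bessel_integrand :
  leb.-integrable `]0, +oo[%classic (EFin \o bessel_integrand).
Proof.
have [C [C0 HC]] := bessel_integrand_le 0.
apply: (@dominated_integrableR _ _ _ leb _ _ _ (fun s => C * expR (- (1 * s)))).
- exact: measurable_itv.
- apply: open_continuous_measurable_fun; first exact: interval_open.
  by move=> u; rewrite inE/= in_itv/= andbT; exact: continuous_bessel_integrand.
- move=> u; rewrite /= in_itv/= andbT => u0; rewrite ger0_norm ?bessel_integrand_ge0//.
  by have := HC u u0; rewrite expr0 mulr1 mul1r.
- rewrite (_ : _ \o _ = (fun s => C%:E * (expR (- (1 * s)))%:E)%E).
    by apply: integrableZl; [exact: measurable_itv|exact: integrable_expRN].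
  by apply/funext => s; rewrite /= EFinM.
Qed.

Lemma integral_bessel_scale (M : R) : 0 < M ->
  (\int[leb]_(s in `]0%R, +oo[) (s `^ (- rho - 1) * expR (- (M * s) - z ^+ 2 / M / (4 * s)))%:E =
  (M `^ rho * \int[leb]_(u in `]0%R, +oo[) bessel_integrand u)%:E)%E.
Proof.
move=> M0.
have iB := integrable_bessel_integrand.
have mB : measurable_fun (`]0, +oo[%classic : set (measurableTypeR R)) bessel_integrand.
  by case/integrableP: iB => /measurable_EFinP.
(* The convention that 0 to a nonzero power is 0 agrees with the limit from the right, so the
   substitution rule applies on the closed half-line. *)
have g0 : bessel_integrand 0 = 0.
  by rewrite /bessel_integrand powR0 ?mul0r// lt_eqF//; have := rho0; lra.
have cB : {within `[0, +oo[, continuous bessel_integrand}.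
  apply/continuous_within_itvcyP; split.
    by move=> u; rewrite in_itv/= andbT; exact: continuous_bessel_integrand.
  have [C [C0 HC]] := bessel_integrand_le 1.
  rewrite g0; apply: (@squeeze_cvgr _ _ _ _ (cst 0) (fun u => C * u)).
  - near=> u; have u0 : 0 < u by near: u; exact: nbhs_right_gt.
    rewrite bessel_integrand_ge0/=; apply: le_trans (HC u u0) _.
    by rewrite expr1 ler_piMr ?mulr_ge0 ?(ltW u0)// expR_le1 oppr_le0 ltW.
  - exact: cvg_cst.
  - rewrite -[X in _ --> X](mulr0 C); apply: cvgMr.
    by apply: cvg_at_right_filter; exact: cvg_id.
pose F : R -> R := *%R M.
have dM (x : R) : is_derive x 1 F M.
  by apply: is_derive_eq; rewrite /GRing.scale/= ?mulr1 ?mulr0 ?addr0 ?add0r.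
have dME : F^`()%classic = cst M.
  by apply/funext => x; rewrite derive1E; have [_ ->] := dM x.
have := @increasing_ge0_integration_by_substitutiony R F bessel_integrand 0.
have F0 : F 0 = 0 by rewrite /F mulr0.
rewrite dME F0 => H.
have {}H : (\int[leb]_(u in `[0%R, +oo[) (bessel_integrand u)%:E =
    \int[leb]_(s in `[0%R, +oo[) (bessel_integrand (M * s) * M)%:E)%E.
  apply: H.
  - by move=> x y _ _ xy; rewrite ltr_pM2l.
  - by move=> x _; exact: cvg_cst.
  - exact: is_cvg_cst.
  - exact: is_cvg_cst.
  - split; first by move=> x _; have [] := dM x.
    by apply: cvg_at_right_filter; exact: cvgMr.
  - apply/cvgryPge => A; near=> s.
    by rewrite /F mulrC -ler_pdivrMr//; near: s; exact: nbhs_pinfty_ge.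
  - exact: cB.
  - by move=> x _; exact: bessel_integrand_ge0.
have E : (\int[leb]_(u in `]0%R, +oo[) (bessel_integrand u)%:E =
   (\int[leb]_(u in `]0%R, +oo[) bessel_integrand u)%:E)%E.
  by rewrite /Rintegral fineK//; apply: integrable_fin_num => //; exact: measurable_itv.
have mBM : measurable_fun (`]0, +oo[%classic : set (measurableTypeR R))
    (fun s => bessel_integrand (M * s) * M).
  apply: open_continuous_measurable_fun; first exact: interval_open.
  move=> s; rewrite inE/= in_itv/= andbT => s0; apply: cvgMl.
  have L : M * x @[x --> s] --> M * s by exact: cvgMr.
  exact: (continuous_cvg _ (continuous_bessel_integrand (mulr_gt0 M0 s0)) L).
have H2 : (\int[leb]_(u in `]0%R, +oo[) (bessel_integrand u)%:E =
    \int[leb]_(s in `]0%R, +oo[) (bessel_integrand (M * s) * M)%:E)%E.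
  rewrite integral_itv_obnd_cbnd; last exact/measurable_EFinP.
  by rewrite H -integral_itv_obnd_cbnd//; exact/measurable_EFinP.
rewrite EFinM -E H2.
rewrite -ge0_integralZl ?lee_fin ?powR_ge0//; last 2 first.
- exact/measurable_EFinP.
- by move=> s _; rewrite lee_fin mulr_ge0 ?bessel_integrand_ge0// ltW.
apply: eq_integral => s; rewrite inE/= in_itv/= andbT => s0.
rewrite -EFinM; congr EFin; rewrite /bessel_integrand.
have -> : z ^+ 2 / M / (4 * s) = z ^+ 2 / (4 * (M * s)) by field; rewrite !gt_eqF.
have -> : s `^ (- rho - 1) = M `^ rho * (M * s) `^ (- rho - 1) * M.
  have [u uE] := expR_total M0; have [v vE] := expR_total s0.
  by rewrite -uE -vE -!expRD -!expRM -!expRD; congr expR; ring.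
by ring.
Unshelve. all: by end_near. Qed.

End bessel_substitution.

(** * Comparison with [H_da] *)

Section resolvent_kernel_H.
Context {R : realType} (d : nat) (alpha m : R).
Hypotheses (hd : (1 <= d)%N) (halpha : 0 < alpha < 2) (m0 : 0 < m).
Notation leb := (@lebesgue_measure R).
Let b : R := alpha / 2.
Let M : R := m `^ (2 / alpha).

Let alpha0 : 0 < alpha. Proof. by case/andP: halpha. Qed.
Let b01 : 0 < b < 1.
Proof. by case/andP: halpha => a0 a2; rewrite divr_gt0//= ltr_pdivrMr// mul1r. Qed.
Let M0 : 0 < M. Proof. exact: powR_gt0. Qed.
Let b0 : 0 < b. Proof. by case/andP: b01. Qed.
Let d0 : 0 < d%:R :> R. Proof. by rewrite ltr0n. Qed.

Lemma integral_resolvent_ker_large (r : R) : 1 < r ->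
  (\int[leb]_(s in `]0%R, +oo[) (resolvent_ker d b M (r ^+ 2) s)%:E <=
  (2 `^ (1 + (b + d%:R / 2)) * H_da d alpha m r)%:E)%E.
Proof.
move=> r1; have r0 : 0 < r := lt_trans ltr01 r1.
pose rho := b + d%:R / 2.
have rho0 : 0 < rho by rewrite addr_gt0// divr_gt0.
pose z := m `^ alpha^-1 * r.
have z0 : 0 < z by rewrite mulr_gt0// powR_gt0.
(* [M] is the square of [m ^ (1 / alpha)], so the substitution [u = M s] produces exactly the
   argument of the Bessel function. *)
have zM : z ^+ 2 / M = r ^+ 2.
  rewrite /z exprMn -(powR_mulrn _ (powR_ge0 _ _)) -powRrM mulrC [alpha^-1 * _]mulrC -/M.
  by rewrite mulKf// gt_eqF.
apply: (@le_trans _ _ (\int[leb]_(s in `]0%R, +oo[)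
    (s `^ (- rho - 1) * expR (- (M * s) - z ^+ 2 / M / (4 * s)))%:E)%E).
  apply: ge0_majorized_integral => s; rewrite /= in_itv/= andbT => s0.
    by rewrite lee_fin mulr_ge0 ?powR_ge0 ?expR_ge0.
  by rewrite lee_fin zM; apply: resolvent_ker_le_large => //; rewrite exprn_gt0.
rewrite integral_bessel_scale// lee_fin /H_da [r <= 1]leNgt r1/=.
rewrite /kappa /bessel_K -/z.
have -> : (d%:R + alpha) / 2 = rho by rewrite /rho /b; field.
have -> : (d%:R + alpha) / (2 * alpha) = rho / alpha.
  by rewrite /rho /b; field; rewrite gt_eqF.
set I := (X in M `^ rho * X); rewrite -[X in _ <= _ * (_ * (_ * (_ * X)))]/I.
rewrite le_eqVlt; apply/orP; left; apply/eqP.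
(* The constant [2 ^ (1 + rho)] undoes the powers of 2 in the prefactor of [bessel_K]. *)
have E : M `^ rho = 2 `^ (1 + rho) * r `^ (- rho) * m `^ (rho / alpha) * (2^-1 * (z / 2) `^ rho).
  have t0 : 0 < 2 :> R by [].
  rewrite /M /z; have [u uE] := expR_total m0; have [v vE] := expR_total r0.
  have [w wE] := expR_total t0.
  rewrite -wE -uE -vE -!expRN -!expRM -!expRD -!expRM -!expRD; congr expR.
  rewrite wE; field.
  by rewrite gt_eqF.
by rewrite E; ring.
Qed.

End resolvent_kernel_H.

Section resolvent_kernel_H_le.
Context {R : realType} (d : nat) (alpha m : R).
Hypotheses (hd : (1 <= d)%N) (halpha : 0 < alpha < 2) (m0 : 0 < m).
Notation leb := (@lebesgue_measure R).
Notation b := (alpha / 2).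
Notation M := (m `^ (2 / alpha)).
Notation d2 := (d%:R / 2 : R).

Let b01 : 0 < b < 1.
Proof. by case/andP: halpha => a0 a2; rewrite divr_gt0//= ltr_pdivrMr// mul1r. Qed.
Let M0 : 0 < M. Proof. exact: powR_gt0. Qed.
Let b0 : 0 < b. Proof. by case/andP: b01. Qed.
Let d0 : 0 < d%:R :> R. Proof. by rewrite ltr0n. Qed.

Lemma integral_resolvent_ker_small : exists C : R, 0 <= C /\ forall r : R, 0 < r -> r <= 1 ->
  (\int[leb]_(s in `]0%R, +oo[) (resolvent_ker d b M (r ^+ 2) s)%:E <=
  (C * h_da d alpha r)%:E)%E.
Proof.
pose A := (1 + d2 - b) `^ (1 + d2 - b) * 4^-1 `^ (- (1 + d2 - b)).
have A0 : 0 <= A by rewrite mulr_ge0 ?powR_ge0.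
have B0 : 0 < b + d2 by rewrite addr_gt0// divr_gt0.
have BV : 0 <= (b + d2)^-1 by rewrite invr_ge0 ltW.
have ar (r c : R) : 0 < r -> (r ^+ 2) `^ c = r `^ (2 * c).
  by move=> r0; rewrite -powR_mulrn ?(ltW r0)// -powRrM.
have cE : b - 1 - d2 + 1 = b - d2 by ring.
have [ad|da|ad] := ltgtP alpha d%:R.
(* Case [alpha < d]: all contributions are at most multiples of [h = r ^ (- (d - alpha))], as
   [h >= 1]. *)
- have bd : 0 < d2 - b by rewrite subr_gt0 ltr_pM2r.
  exists (A + (d2 - b)^-1 + (b + d2)^-1); split.
    by rewrite !addr_ge0// invr_ge0 ltW.
  move=> r r0 r1; have r20 : 0 < r ^+ 2 by rewrite exprn_gt0.
  have r21 : r ^+ 2 <= 1 by rewrite exprn_ile1// ltW.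
  have c0 : b - 1 - d2 + 1 != 0 by rewrite cE -oppr_eq0 opprB gt_eqF.
  have := integral_resolvent_ker_le1 hd b01 M0 r20 r21 (fun x x0 => is_derive_powR_primitive c0 x0).
  move/le_trans; apply; rewrite lee_fin -/A /h_da ad cE powR1 !ar//.
  have -> : 2 * (b - d2) = - (d%:R - alpha) by field.
  set h := r `^ _.
  have h1 : 1 <= h.
    rewrite /h powRN -[leLHS]invr1 lef_pV2 ?posrE ?powR_gt0//.
    have H : r `^ (d%:R - alpha) <= 1 `^ (d%:R - alpha).
      by rewrite ge0_ler_powR ?nnegrE ?subr_ge0 ?(ltW r0) ?(ltW ad).
    by rewrite powR1 in H.
  have e1 : (b - d2)^-1 = - (d2 - b)^-1 by rewrite -invrN opprB.
  have dV : 0 < (d2 - b)^-1 by rewrite invr_gt0.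
  have : (b + d2)^-1 <= (b + d2)^-1 * h by rewrite ler_peMr.
  rewrite e1; move: (b + d2)^-1 (d2 - b)^-1 dV => U V V0; lra.
(* Case [alpha > d]: the exponent [b - d2] is positive, so everything stays bounded. *)
- have bd : 0 < b - d2 by rewrite subr_gt0 ltr_pM2r.
  exists (A + (b - d2)^-1 + (b + d2)^-1); split.
    by rewrite !addr_ge0// invr_ge0 ltW.
  move=> r r0 r1; have r20 : 0 < r ^+ 2 by rewrite exprn_gt0.
  have r21 : r ^+ 2 <= 1 by rewrite exprn_ile1// ltW.
  have c0 : b - 1 - d2 + 1 != 0 by rewrite cE gt_eqF.
  have := integral_resolvent_ker_le1 hd b01 M0 r20 r21 (fun x x0 => is_derive_powR_primitive c0 x0).
  move/le_trans; apply; rewrite lee_fin -/A /h_da ltNge (ltW da)/= gt_eqF// mulr1 cE powR1.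
  have h1 : (r ^+ 2) `^ (b - d2) <= 1.
    have H : (r ^+ 2) `^ (b - d2) <= 1 `^ (b - d2).
      by rewrite ge0_ler_powR ?nnegrE ?(ltW bd) ?(ltW r20).
    by rewrite powR1 in H.
  rewrite lerD2r lerD//; first by rewrite ler_piMr.
  by rewrite mul1r gerBl mulr_ge0 ?powR_ge0 ?invr_ge0 ?(ltW bd).
(* Case [alpha = d]: constants are absorbed by [ln (1 + 1 / r) >= ln 2], and the middle part
   [- ln (r ^ 2)] is at most [2 * ln (1 + 1 / r)]. *)
- have bd : b = d2 by rewrite ad.
  have l2 : 0 < ln 2 :> R by rewrite ln_gt0// ltr1n.
  exists ((A + (b + d2)^-1) / ln 2 + 2); split.
    by rewrite addr_ge0// divr_ge0 ?addr_ge0 ?(ltW l2).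
  move=> r r0 r1; have r20 : 0 < r ^+ 2 by rewrite exprn_gt0.
  have r21 : r ^+ 2 <= 1 by rewrite exprn_ile1// ltW.
  have dln (x : R) : 0 < x -> is_derive x 1 (@ln R) (x `^ (b - 1 - d2)).
    move=> x0; have -> : b - 1 - d2 = - 1 by rewrite bd; ring.
    by rewrite powR_inv1 ?(ltW x0)//; exact: is_derive1_ln.
  have := integral_resolvent_ker_le1 hd b01 M0 r20 r21 dln.
  move/le_trans; apply; rewrite lee_fin -/A /h_da ad ltxx eqxx.
  rewrite subrr powRr0 mulr1 ln1 sub0r lnXn//.
  have rV : 1 <= r^-1 by rewrite invf_ge1.
  have l1 : ln 2 <= ln (1 + r^-1) :> R.
    by rewrite ler_ln ?posrE ?addr_gt0 ?invr_gt0//; lra.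
  have l3 : - ln r <= ln (1 + r^-1).
    by rewrite -lnV ?posrE// ler_ln ?posrE ?addr_gt0 ?invr_gt0//; lra.
  have : A + (b + d2)^-1 <= (A + (b + d2)^-1) / ln 2 * ln (1 + r^-1).
    by rewrite mulrAC -mulrA ler_peMr ?addr_ge0// ler_pdivlMr// mul1r.
  rewrite bd => H.
  rewrite [leRHS]mulrDl; apply: le_trans (lerD H (ler_wpM2l _ l3)); last by [].
  by rewrite le_eqVlt; apply/orP; left; apply/eqP; rewrite mulr2n; ring.
Qed.

Lemma h_da_ge0 (r : R) : 0 < r -> 0 <= h_da d alpha r.
Proof.
move=> r0; rewrite /h_da; case: ifP => _; first exact: powR_ge0.
by case: ifP => // _; rewrite ln_ge0// lerDl invr_ge0 ltW.
Qed.

Lemma H_da_ge0 (r : R) : 0 < r -> 0 <= H_da d alpha m r.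
Proof.
move=> r0; rewrite /H_da; case: ifP => _; first exact: h_da_ge0.
rewrite !mulr_ge0 ?powR_ge0// ?invr_ge0//.
by apply: Rintegral_ge0 => t _; rewrite mulr_ge0 ?powR_ge0 ?expR_ge0.
Qed.

Lemma integral_resolvent_ker_H : exists C : R, 0 <= C /\ forall r : R, 0 < r ->
  (\int[leb]_(s in `]0%R, +oo[) (resolvent_ker d b M (r ^+ 2) s)%:E <=
  (C * H_da d alpha m r)%:E)%E.
Proof.
have [C [C0 HC]] := integral_resolvent_ker_small.
exists (C + 2 `^ (1 + (b + d2))); split; first by rewrite addr_ge0// powR_ge0.
move=> r r0; have H0 := H_da_ge0 r0.
have [r1|r1] := leP r 1.
  apply: le_trans (HC r r0 r1) _; rewrite lee_fin.
  have -> : h_da d alpha r = H_da d alpha m r by rewrite /H_da r1.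
  by rewrite ler_wpM2r// lerDl powR_ge0.
apply: le_trans (integral_resolvent_ker_large hd halpha m0 r1) _.
by rewrite lee_fin ler_wpM2r// lerDr.
Qed.

Lemma heat_kernel_subord_le : exists C : R, 0 <= C /\
  forall p : R -> 'rV[R]_d -> R, heat_kernel alpha m p ->
  forall t x, 0 < t -> x != 0 ->
  p t x <= C * expR (t * m) * subord_int d b M 0 t (dot x x).
Proof.
have [C [C0 HC]] := stable_generating_function b01.
have CC0 : 0 <= C * (4 * 2 ^+ d) by rewrite !mulr_ge0// exprn_ge0.
exists (C * (4 * 2 ^+ d)); split => // p hp t x t0 x0.
apply: (@heat_kernel_le R d alpha m p t
  (fun k r => C * (4 * 2 ^+ d) * expR (t * m) * subord_int d b M k.+1%:R^-1 t r)
  (fun r => C * (4 * 2 ^+ d) * expR (t * m) * subord_int d b M 0 t r) hp t0 _ _ _ x x0).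
- move=> k y y0.
  have k0 : 0 < k.+1%:R^-1 :> R by rewrite invr_gt0.
  have := stable_transform_le hd b01 M0 C0 HC t0 k0 (dot_gt0 y0).
  rewrite -(ler_pM2l (expR_gt0 (t * m))) => H.
  rewrite [leRHS]mulrAC [leRHS]mulrC; apply: le_trans H.
  rewrite mulrCA ler_wpM2l ?invr_ge0 ?exprn_ge0 ?mulr_ge0 ?pi_ge0//.
  rewrite -[X in _ <= X]RintegralZl//; last first.
    apply: (@dominated_integrableR _ _ _ (lebesgue_rV d) setT _ _ _ _ _ (integrable_gaussr d k0)).
    - exact: measurableT.
    - apply: measurable_funM.
        apply: (measurableT_comp (continuous_measurable_fun (@continuous_cos R))).
        exact: measurable_dotr.
      apply: measurable_funM; last exact: measurable_gaussr.
      apply: (measurableT_comp (@measurable_expR R)); apply: measurable_funN.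
      apply: measurable_funM => //; apply: (measurableT_comp (@measurable_powR R _)).
      by apply: measurable_funD => //; exact: measurable_dotxx.
    - move=> xi _; rewrite !normrM (ger0_norm (gaussr_ge0 _ _)) mulrA ler_piMl ?gaussr_ge0//.
      rewrite mulr_ile1// ?cos_max// ger0_norm ?expR_ge0// expR_le1 oppr_le0 mulr_ge0 ?powR_ge0//.
      exact: ltW.
  rewrite le_eqVlt; apply/orP; left; apply/eqP; apply: eq_Rintegral => xi _.
  have -> : Lexp alpha m t xi = expR (t * m) * expR (- (t * (dot xi xi + M) `^ b)).
    by rewrite /Lexp /L_symbol enorm_sqr -expRD; congr expR; ring.
  by ring.
- move=> r r0; apply: cvgMr; exact: cvg_subord_int.
- move=> r s r0 rs; rewrite ler_wpM2l ?mulr_ge0 ?expR_ge0//.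
  exact: subord_int_le.
Qed.

End resolvent_kernel_H_le.

Theorem proposition6p14 (R : realType) (d : nat) (alpha : R)
    (hd : (1 <= d)%N) (halpha : 0 < alpha < 2)
    (m : R) (hm : 0 < m) (lambda : R) (hlambda : m < lambda) :
  exists C : R,
    forall p : R -> 'rV[R]_d -> R, heat_kernel alpha m p ->
    forall x : 'rV[R]_d, x != 0 ->
      (resolvent_kernel p lambda x <= (C * H_da d alpha m (enorm x))%:E)%E.
Proof.
have b01 : 0 < alpha / 2 < 1.
  by case/andP: halpha => a0 a2; rewrite divr_gt0//= ltr_pdivrMr// mul1r.
have M0 : 0 < m `^ (2 / alpha) by rewrite powR_gt0.
(* The decay rate that is left once [exp (- lambda t)] has absorbed the growth [exp (t m)] of the
   kernel bound. *)
have q0 : 0 < lambda - m by rewrite subr_gt0.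
have [C1 [C10 H1]] := heat_kernel_subord_le hd halpha hm.
have [C2 [C20 H2]] := integral_subord_le hd b01 M0 q0.
have [C3 [C30 H3]] := integral_resolvent_ker_H hd halpha hm.
exists (C1 * (C2 * C3)) => p hp x x0.
have r0 := dot_gt0 x0; have e0 : 0 < enorm x by rewrite sqrtr_gt0.
have [mf H2x] := H2 _ r0.
pose f (t : R) : R := expR (- ((lambda - m) * t)) * subord_int d (alpha / 2) (m `^ (2 / alpha)) 0 t (dot x x).
have f0 (t : R) : 0 < t -> 0 <= f t.
  move=> t0; rewrite mulr_ge0 ?expR_ge0//; apply: Rintegral_ge0 => s _.
  exact: subord_ge0.
apply: (@le_trans _ _ (C1%:E * \int[lebesgue_measure]_(t in `]0%R, +oo[) (f t)%:E)%E).
  rewrite /resolvent_kernel -ge0_integralZl//; last 2 first.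
  - exact/measurable_EFinP.
  - by move=> t; rewrite /= in_itv/= andbT lee_fin; exact: f0.
  apply: ge0_majorized_integral => t; rewrite /= in_itv/= andbT => t0.
    by rewrite -EFinM lee_fin mulr_ge0// f0.
  rewrite -EFinM lee_fin; apply: le_trans (ler_wpM2l (expR_ge0 _) (H1 p hp t x t0 x0)) _.
  rewrite le_eqVlt; apply/orP; left; apply/eqP.
  have -> : expR (- lambda * t) = expR (- ((lambda - m) * t)) * (expR (t * m))^-1.
    by rewrite -expRN -expRD; congr expR; ring.
  by rewrite /f; field; rewrite gt_eqF ?expR_gt0.
rewrite -!mulrA EFinM lee_wpmul2l ?lee_fin//.
apply: le_trans H2x _; rewrite EFinM lee_wpmul2l ?lee_fin//.
by have := H3 _ e0; rewrite enorm_sqr.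
Qed.
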